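(* Let $1\le k\le m$. The size of any maximal (by inclusion) collection of pairwise quasi-commuting quantum minors in $\mathbb{C}_q[Mat_{k\times m}]$ is sharply bounded by $km$; that is, every such collection has at most $km$ elements, and there exists such a collection with exactly $km$ elements.
   Context: Notation: $[a\dots b]=\{a,a+1,\dots,b\}$. Quantum matrices: $\mathbb{C}_q[Mat_{k\times m}]$ ($k\le m$) is the unital $\mathbb{C}(q)$-algebra ($q$ an indeterminate) generated by $x_{i,j}$, $i\in[1\dots k]$, $j\in[1\dots m]$, subject to the relations: (i) $x_{s,t}x_{i,j}=q\,x_{i,j}x_{s,t}$ if either ($s>i$ and $t=j$) or ($s=i$ and $t>j$); (ii) $x_{s,t}x_{i,j}=x_{i,j}x_{s,t}$ if $s>i$ and $t<j$; (iii) $x_{s,t}x_{i,j}=x_{i,j}x_{s,t}+(q-q^{-1})x_{i,t}x_{s,j}$ if $s>i$ and $t>j$. Quantum minors: for non-empty $I=\{i_1<\dots<i_l\}\subset[1\dots k]$ and $J=\{j_1<\dots<j_l\}\subset[1\dots m]$ of the same size $l$, $\Delta_{I,J}=\sum_{\sigma\in S_l}(-q)^{-\ell(\sigma)}x_{i_1,j_{\sigma(1)}}\cdots x_{i_l,j_{\sigma(l)}}$, where $\ell(\sigma)$ is the length (number of inversions) of $\sigma$. Two quantum minors $\Delta_{A,B}$ and $\Delta_{C,D}$ quasi-commute if $\Delta_{C,D}\Delta_{A,B}=q^c\,\Delta_{A,B}\Delta_{C,D}$ for some integer $c$. *)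

(* Defs.v *)
From HB Require Import structures.
From mathcomp Require Import all_boot all_order all_algebra all_fingroup.
From mathcomp Require Import generic_quotient ring_quotient fraction.
From mathcomp Require Import finmap monalg complex.
From mathcomp Require Import boolp reals.

Set Implicit Arguments.
Unset Strict Implicit.
Unset Printing Implicit Defensive.

Import GRing.Theory.

Local Open Scope ring_scope.
Local Open Scope quotient_scope.

Lemma malg_scalerAr (K : monomType) (F : comNzRingType) (c : F)
  (u v : {malg F[K]}) : c *: (u * v) = u * (c *: v).
Proof.
apply/malgP=> w; rewrite mcoeffZ.
rewrite (mcoeffMlw _ (fsubset_refl _) (msuppZ_le c v)).
rewrite mcoeffMl mulr_sumr; apply: eq_bigr => w1 _.
rewrite mulr_sumr; apply: eq_bigr => w2 _.
by rewrite mcoeffZ mulrnAr mulrCA.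
Qed.

(* {fmonom T} is the free monoid on T (words, not commutative monomials), so  *)
(* the monoid algebra below is the free associative unital algebra on the     *)
(* generators x_{i,j}. All indices are 0-based.                               *)
Notation free_alg F k m := {malg F[{fmonom ('I_k * 'I_m)%type}]}.

Section Relators.
Context {F : fieldType} (q : F) {k m : nat} {A : lalgType F}.
Variable x : 'I_k -> 'I_m -> A.

Inductive qmat_relator : A -> Prop :=
| qmat_relator_q (s i : 'I_k) (t j : 'I_m) :
    (i < s)%N /\ t = j \/ s = i /\ (j < t)%N ->
    qmat_relator (x s t * x i j - q *: (x i j * x s t))
| qmat_relator_comm (s i : 'I_k) (t j : 'I_m) :
    (i < s)%N -> (t < j)%N ->
    qmat_relator (x s t * x i j - x i j * x s t)
| qmat_relator_cross (s i : 'I_k) (t j : 'I_m) :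
    (i < s)%N -> (j < t)%N ->
    qmat_relator (x s t * x i j -
      (x i j * x s t + (q - q^-1) *: (x i t * x s j))).

Lemma qmat_relator_eq0 (f : {rmorphism A -> F}) u :
  (forall c v, f (c *: v) = c * f v) -> (forall i j, f (x i j) = 0) ->
  qmat_relator u -> f u = 0.
Proof.
move=> fZ fx0 [] *; rewrite !(rmorphB, rmorphD, fZ, rmorphM) /= !fx0;
by rewrite !(mulr0, addr0, subr0).
Qed.

End Relators.

Section QuantumMatrices.
Context {F : fieldType} (q : F) {k m : nat}.
Local Notation A := (free_alg F k m).
Implicit Types u v : A.

Definition gen (i : 'I_k) (j : 'I_m) : A := << fmu (i, j) >>.

Inductive qmat_ideal : A -> Prop :=
| qmat_ideal_relator u : qmat_relator q gen u -> qmat_ideal u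
| qmat_ideal0 : qmat_ideal 0
| qmat_idealD u v : qmat_ideal u -> qmat_ideal v -> qmat_ideal (u + v)
| qmat_idealMl a u : qmat_ideal u -> qmat_ideal (a * u)
| qmat_idealMr a u : qmat_ideal u -> qmat_ideal (u * a).

Definition qmat_idealb : {pred A} := fun u => `[< qmat_ideal u >].

Lemma qmat_idealP u : reflect (qmat_ideal u) (u \in qmat_idealb).
Proof. exact: asboolP. Qed.

Lemma qmat_ideal_zmod_closed : zmod_closed qmat_idealb.
Proof.
split=> [|u v /qmat_idealP Iu /qmat_idealP Iv].
  exact/qmat_idealP/qmat_ideal0.
apply/qmat_idealP/qmat_idealD => //.
by rewrite -mulN1r; apply: qmat_idealMl.
Qed.
HB.instance Definition _ :=
  GRing.isZmodClosed.Build A qmat_idealb qmat_ideal_zmod_closed.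

Lemma qmat_idealZ c u : qmat_ideal u -> qmat_ideal (c *: u).
Proof.
by move=> Iu; rewrite -[u in c *: u]mul1r scalerAl; apply: qmat_idealMl.
Qed.

Lemma mcoeff1_gen i j :
  mcoeff (mone : {fmonom ('I_k * 'I_m)%type}) (gen i j) = 0.
Proof.
rewrite mcoeffU1; case: eqP => // /(congr1 (@fmonom_val _)).
by rewrite fmU fm1.
Qed.

Lemma qmat_ideal_mcoeff1 u :
  qmat_ideal u -> mcoeff (mone : {fmonom ('I_k * 'I_m)%type}) u = 0.
Proof.
elim=> [{}u | | v w _ v0 _ w0 | a v _ v0 | a v _ v0].
- by apply: qmat_relator_eq0 => [c v | i j];
    [exact: mcoeffZ | exact: mcoeff1_gen].
- exact: mcoeff0.
- by rewrite mcoeffD v0 w0 addr0.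
- by rewrite rmorphM /= v0 mulr0.
- by rewrite rmorphM /= v0 mul0r.
Qed.

End QuantumMatrices.

(* The library only gives quotients by ideals a ring structure for            *)
(* commutative rings, so the algebra structure on the two-sided quotient is   *)
(* built here.                                                                *)
Definition qmat (F : fieldType) (q : F) (k m : nat) : Type :=
  Quotient.quot (@qmat_idealb F q k m).

Section QuantumMatrixAlgebra.
Context (F : fieldType) (q : F) (k m : nat).
Local Notation A := (free_alg F k m).
Local Notation Q := (qmat q k m).

HB.instance Definition _ := GRing.Zmodule.on Q.
HB.instance Definition _ : EqQuotient A (Quotient.equiv (@qmat_idealb F q k m)) Q
  := EqQuotient.on Q.

Lemma qmat_piP (u v : A) : \pi_Q u = \pi_Q v <-> qmat_ideal q (u - v).
Proof.
split=> [/eqP|Iuv].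
  by rewrite piE Quotient.equivE => /qmat_idealP.
by apply/eqP; rewrite piE Quotient.equivE; apply/qmat_idealP.
Qed.

Lemma qmat_piD (u v : A) : \pi_Q (u + v) = \pi_Q u + \pi_Q v.
Proof. exact: Quotient.pi_add. Qed.

Lemma qmat_repr (u : A) : qmat_ideal q (u - repr (\pi_Q u)).
Proof. by apply/qmat_piP; rewrite reprK. Qed.

Definition qmat_one : Q := \pi_Q 1.
Definition qmat_mul : Q -> Q -> Q := lift_op2 Q *%R.
Definition qmat_scale (c : F) : Q -> Q := lift_op1 Q ( *:%R c).

Lemma qmat_mulE (u v : A) : qmat_mul (\pi_Q u) (\pi_Q v) = \pi_Q (u * v).
Proof.
unlock qmat_mul; apply/esym/qmat_piP; set u' := repr _; set v' := repr _.
have -> : u * v - u' * v' = (u - u') * v + u' * (v - v').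
  by rewrite mulrBl mulrBr addrA subrK.
apply: qmat_idealD.
  by apply/qmat_idealMr/qmat_repr.
by apply/qmat_idealMl/qmat_repr.
Qed.

Lemma qmat_scaleE c (u : A) : qmat_scale c (\pi_Q u) = \pi_Q (c *: u).
Proof.
unlock qmat_scale; apply/esym/qmat_piP; rewrite -scalerBr;
 apply/qmat_idealZ/qmat_repr.
Qed.

Lemma qmat_mulA : associative qmat_mul.
Proof.
by elim/quotW=> x; elim/quotW=> y; elim/quotW=> z; rewrite !qmat_mulE mulrA.
Qed.

Lemma qmat_mul1 : left_id qmat_one qmat_mul.
Proof. by elim/quotW=> x; rewrite qmat_mulE mul1r. Qed.

Lemma qmat_mulr1 : right_id qmat_one qmat_mul.
Proof. by elim/quotW=> x; rewrite qmat_mulE mulr1. Qed.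

Lemma qmat_mulDl : left_distributive qmat_mul +%R.
Proof.
elim/quotW=> x; elim/quotW=> y; elim/quotW=> z.
by rewrite -qmat_piD !qmat_mulE mulrDl qmat_piD.
Qed.

Lemma qmat_mulDr : right_distributive qmat_mul +%R.
Proof.
elim/quotW=> x; elim/quotW=> y; elim/quotW=> z.
by rewrite -qmat_piD !qmat_mulE mulrDr qmat_piD.
Qed.

Lemma qmat_one_neq0 : qmat_one != 0.
Proof.
have pi0 : \pi_Q 0 = 0 :> Q.
  by apply: (addrI (\pi_Q 0)); rewrite -qmat_piD !addr0.
apply/eqP; rewrite -pi0 => /qmat_piP; rewrite subr0 => /qmat_ideal_mcoeff1.
by rewrite rmorph1 => /eqP; rewrite oner_eq0.
Qed.

HB.instance Definition _ := GRing.Zmodule_isNzRing.Build Q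
  qmat_mulA qmat_mul1 qmat_mulr1 qmat_mulDl qmat_mulDr qmat_one_neq0.

Lemma qmat_scaleA c d x : qmat_scale c (qmat_scale d x) = qmat_scale (c * d) x.
Proof. by elim/quotW: x => x; rewrite !qmat_scaleE scalerA. Qed.

Lemma qmat_scale1 : left_id 1 qmat_scale.
Proof. by elim/quotW=> x; rewrite qmat_scaleE scale1r. Qed.

Lemma qmat_scaleDr : right_distributive qmat_scale +%R.
Proof.
move=> c; elim/quotW=> x; elim/quotW=> y.
by rewrite -qmat_piD !qmat_scaleE scalerDr qmat_piD.
Qed.

Lemma qmat_scaleDl x : {morph qmat_scale^~ x : c d / c + d}.
Proof.
by elim/quotW: x => x c d; rewrite !qmat_scaleE scalerDl qmat_piD.
Qed.

HB.instance Definition _ := GRing.Zmodule_isLmodule.Build F Q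
  qmat_scaleA qmat_scale1 qmat_scaleDr qmat_scaleDl.

Lemma qmat_scaleAl (c : F) (x y : Q) : c *: (x * y) = (c *: x) * y.
Proof.
elim/quotW: x => x; elim/quotW: y => y.
by rewrite /GRing.scale /GRing.mul /= !(qmat_scaleE, qmat_mulE) scalerAl.
Qed.

HB.instance Definition _ :=
  GRing.Lmodule_isLalgebra.Build F Q qmat_scaleAl.

Lemma qmat_scaleAr (c : F) (x y : Q) : c *: (x * y) = x * (c *: y).
Proof.
elim/quotW: x => x; elim/quotW: y => y.
by rewrite /GRing.scale /GRing.mul /= !(qmat_scaleE, qmat_mulE) malg_scalerAr.
Qed.

HB.instance Definition _ :=
  GRing.Lalgebra_isAlgebra.Build F Q qmat_scaleAr.

End QuantumMatrixAlgebra.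

Section QuantumMinors.
Context {F : fieldType} {q : F} {k m : nat}.
Local Notation Q := (qmat q k m).

Definition qx (i : 'I_k) (j : 'I_m) : Q := \pi_Q (gen i j).

Definition perm_length (l : nat) (s : 'S_l) : nat :=
  #|[set p : 'I_l * 'I_l | (p.1 < p.2)%N && (s p.2 < s p.1)%N]|.

(* enum_val lists the elements of a set of ordinals in increasing order, and  *)
(* \prod multiplies the factors from left to right in that order.             *)
Definition qminor (I : {set 'I_k}) (J : {set 'I_m}) (eqIJ : #|I| = #|J|) : Q :=
  \sum_(s : 'S_#|I|) (- q) ^ (- (perm_length s)%:Z) *:
    \prod_(a < #|I|) qx (enum_val a) (enum_val (cast_ord eqIJ (s a))).

Definition is_qminor (x : Q) : Prop :=
  exists (I : {set 'I_k}) (J : {set 'I_m}) (eqIJ : #|I| = #|J|),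
    I != set0 /\ x = qminor eqIJ.

Definition quasi_commute (x y : Q) : Prop :=
  exists c : int, y * x = q ^ c *: (x * y).

Definition qc_collection (S : {fset Q}) : Prop :=
  {in S, forall x, is_qminor x} /\ {in S &, forall x y, quasi_commute x y}.

(* Only finitely many elements are quantum minors, so restricting to finite   *)
(* collections loses nothing.                                                 *)
Definition maximal_qc_collection (S : {fset Q}) : Prop :=
  qc_collection S /\
  forall T : {fset Q}, qc_collection T -> (S `<=` T)%fset -> T = S.

End QuantumMinors.

Definition Cq (R : realType) : fieldType := {fraction {poly (complex R)}}.

Definition qvar {R : realType} : Cq R := tofrac ('X : {poly (complex R)}).

(* Main.v *)
From HB Require Import structures.
Require Import Defs.
From mathcomp Require Import all_boot all_order all_algebra all_fingroup.
From mathcomp Require Import generic_quotient fraction finmap monalg complex.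
From mathcomp Require Import boolp functions reals.
From mathcomp Require Import zify ring.

(** The proof has two halves.

    Upper bound.  Encode the minor with rows [I] and columns [J] by a subset of
    [k + m] points with [k] elements: the rows outside [I], listed from the last
    to the first, followed by the columns in [J] ([word]).  Two words cross when their
    differences alternate, [a < b < c < d] with [a], [c] in the first only and
    [b], [d] in the second only.  Minors that quasi-commute have words that do
    not cross ([const_weight_noncrossing]), and a family of pairwise noncrossing
    [k]-subsets of [k + m] points has at most [k * m + 1] members
    ([card_noncrossing]).  The word of the empty minor crosses no other word and
    is not the word of a minor, which leaves [k * m].

    To see that quasi-commuting minors do not cross, suppose
    [Y * X = q ^ c *: (X * Y)].  Then [(Y * X - X * Y) / (q - 1)] becomes
    [c * X * Y] at [q = 1], so the Poisson bracket of the two classical minors is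
    [c] times their product at every matrix [P] of scalars.  For this to make
    sense the quantum matrices must specialize to [P] at [q = 1].  Operators on
    a space of functions do this: for each [P] there are operators that satisfy
    the defining relations, preserve the functions with values regular at
    [q = 1], and have modulo [q - 1] a common eigenvector with eigenvalues the
    entries of [P] ([all_realizable]).  The bracket is then
    computed at 0/1 matrices [P] in which both minors reduce to one monomial,
    given by bijections [M] and [M'] from rows to columns.  There it is a sum of
    signs, which must not depend on the choice of [P], [M] and [M']
    ([quasi_commute_weight]).  At a crossing, two choices give different sums.

    Sharpness.  For each position of the matrix take the largest solid square
    minor whose upper left corner is there.  An entry of the matrix
    quasi-commutes with a minor unless it lies strictly above and to the left,
    or strictly below and to the right, of that minor ([minor_entry]; the
    essential case is the centrality of the quantum determinant), and for two
    solid minors of the family one of them has no such entries relative to the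
    other ([solid_quasi_commute]).  These [k * m] minors are distinct because
    they take different values in a suitable realization ([qminor_inj]). *)

Set Implicit Arguments.
Unset Strict Implicit.
Unset Printing Implicit Defensive.

Import Order.TTheory GRing.Theory Num.Theory.

Local Open Scope ring_scope.

(** * Sets of ordinals listed in increasing order *)

Section OrdSets.
Context {n : nat}.
Implicit Types (I J : {set 'I_n}) (i j s t : 'I_n).

Definition below J j := #|[set i in J | (i < j)%N]|.
Definition above J j := #|[set i in J | (j < i)%N]|.

Lemma below_rem J j t : t \in J -> t != j ->
  below J j = (below (J :\ t) j + (t < j))%N.
Proof.
move=> tJ ntj; rewrite /below (cardsD1 t) !inE tJ /= addnC; congr addn.
by apply: eq_card => i; rewrite !inE; case: (i == t).
Qed.

Lemma above_rem J j t : t \in J -> t != j ->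
  above J j = (above (J :\ t) j + (j < t))%N.
Proof.
move=> tJ ntj; rewrite /above (cardsD1 t) !inE tJ /= addnC; congr addn.
by apply: eq_card => i; rewrite !inE; case: (i == t).
Qed.

Lemma below_self J j : below (J :\ j) j = below J j.
Proof.
by apply: eq_card => i; rewrite !inE; case: eqP => [->|]; rewrite ?ltnn ?andbF.
Qed.

Lemma above_self J j : above (J :\ j) j = above J j.
Proof.
by apply: eq_card => i; rewrite !inE; case: eqP => [->|]; rewrite ?ltnn ?andbF.
Qed.

Lemma below_above J j : j \in J -> (below J j + above J j).+1 = #|J|.
Proof.
move=> jJ; rewrite (cardsD1 j J) jJ add1n; congr S.
have -> : J :\ j = [set i in J | (i < j)%N] :|: [set i in J | (j < i)%N].
  apply/setP => i; rewrite !inE -(inj_eq val_inj) neq_ltn -andb_orr andbC.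
  by rewrite orbC.
rewrite cardsU (_ : _ :&: _ = set0) ?cards0 ?subn0 //.
by apply/setP => i; rewrite !inE; case: ltngtP; rewrite ?andbF ?andFb.
Qed.

(** The strict order is used because a list sorted by it is determined by its
    members. *)
Definition ordlt : rel 'I_n := fun i j => (i < j)%N.

Lemma ordlt_trans : transitive ordlt.
Proof. by move=> i j s; apply: ltn_trans. Qed.

Lemma enum_ordlt I : pairwise ordlt (enum I).
Proof.
rewrite /(enum _) pairwise_filter // -enumT.
have := iota_ltn_sorted 0 n; rewrite -val_enum_ord.
by rewrite sorted_map sorted_pairwise //; apply: ordlt_trans.
Qed.

Lemma enum_ordlt_eq I (s : seq 'I_n) : pairwise ordlt s -> I =i s -> enum I = s.
Proof.
move=> ss eIs; apply: (@irr_sorted_eq _ ordlt).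
- exact: ordlt_trans.
- by move=> i; rewrite /ordlt ltnn.
- by rewrite sorted_pairwise ?enum_ordlt //; apply: ordlt_trans.
- by rewrite sorted_pairwise //; apply: ordlt_trans.
- by move=> i; rewrite mem_enum eIs.
Qed.

Lemma enum_split I s : s \in I ->
  enum I = enum [set i in I | (i < s)%N] ++ s :: enum [set i in I | (s < i)%N].
Proof.
move=> sI; apply: enum_ordlt_eq => [|i].
  rewrite pairwise_cat /= !enum_ordlt /= andbT; apply/andP; split.
    apply/allrelP => i j; rewrite mem_enum inE => /andP[_ lis].
    rewrite inE mem_enum inE => /predU1P[->//|/andP[_]].
    exact: ltn_trans.
  by apply/allP => i; rewrite mem_enum inE => /andP[].
rewrite mem_cat inE !mem_enum !inE -(inj_eq val_inj).
by case: ltngtP => [||/val_inj ->]; rewrite ?andbT ?andbF ?orbF.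
Qed.

Lemma enum_rem I s : enum (I :\ s) =
  enum [set i in I | (i < s)%N] ++ enum [set i in I | (s < i)%N].
Proof.
apply: enum_ordlt_eq => [|i].
  rewrite pairwise_cat /= !enum_ordlt /= !andbT.
  apply/allrelP => i j; rewrite !mem_enum !inE => /andP[_ lis] /andP[_].
  exact: ltn_trans.
rewrite mem_cat !mem_enum !inE -(inj_eq val_inj).
by case: ltngtP => [||/val_inj ->]; rewrite ?andbT ?andbF ?orbF.
Qed.

Lemma enum_setU1_max I s : (forall i, i \in I -> (i < s)%N) ->
  enum (s |: I) = rcons (enum I) s.
Proof.
move=> ltIs; apply: enum_ordlt_eq => [|i].
  rewrite pairwise_rcons enum_ordlt andbT.
  by apply/allP => i; rewrite mem_enum; apply: ltIs.
by rewrite mem_rcons !inE mem_enum.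
Qed.

Lemma enum_setU1_min I s : (forall i, i \in I -> (s < i)%N) ->
  enum (s |: I) = s :: enum I.
Proof.
move=> ltsI; apply: enum_ordlt_eq => [|i].
  rewrite /= enum_ordlt andbT.
  by apply/allP => i; rewrite mem_enum; apply: ltsI.
by rewrite !inE mem_enum.
Qed.

Lemma setD1C I i j : (I :\ i) :\ j = (I :\ j) :\ i.
Proof. by apply/setP => s; rewrite !inE andbCA. Qed.

Lemma max_elem I : I != set0 ->
  exists2 i, i \in I & forall j, j \in I -> (j <= i)%N.
Proof.
case/set0Pn => i0 i0I.
case: (@arg_maxnP _ i0 (mem I) (@nat_of_ord n) i0I) => i iI im.
by exists i.
Qed.

Lemma min_elem I : I != set0 ->
  exists2 i, i \in I & forall j, j \in I -> (i <= j)%N.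
Proof.
case/set0Pn => i0 i0I.
case: (@arg_minnP _ i0 (mem I) (@nat_of_ord n) i0I) => i iI im.
by exists i.
Qed.

Lemma below_min I j : (forall i, i \in I -> (j <= i)%N) -> below I j = 0%N.
Proof.
move=> jm; apply: eq_card0 => i; rewrite !inE.
by apply/negP => /andP[/jm]; rewrite ltnNge => ->.
Qed.

Lemma above_max I j : (forall i, i \in I -> (i <= j)%N) -> above I j = 0%N.
Proof.
move=> jm; apply: eq_card0 => i; rewrite !inE.
by apply/negP => /andP[/jm]; rewrite ltnNge => ->.
Qed.

End OrdSets.

Lemma eq_card_rem n p (I : {set 'I_n}) (J : {set 'I_p}) i j :
  #|I| = #|J| -> i \in I -> j \in J -> #|I :\ i| = #|J :\ j|.
Proof.
by move=> eIJ iI jJ; move: eIJ; rewrite (cardsD1 i I) iI (cardsD1 j J) jJ => -[].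
Qed.

(** Pairing the two orders of each unordered pair is what makes the quadratic
    relations applicable inside a double sum. *)
Lemma sum_offdiag (V : nmodType) n (J : {set 'I_n}) (G : 'I_n -> 'I_n -> V) :
  \sum_(j in J) \sum_(t in J :\ j) G j t =
  \sum_(j in J) \sum_(t in J | (t < j)%N) (G j t + G t j).
Proof.
transitivity (\sum_(j in J) (\sum_(t in J | (t < j)%N) G j t +
                             \sum_(t in J | (j < t)%N) G j t)).
  apply: eq_bigr => j jJ.
  rewrite (bigID (fun t : 'I_n => (t < j)%N)) /=; congr (_ + _).
    apply: eq_bigl => t; rewrite !inE -(inj_eq val_inj).
    by case: ltngtP; rewrite ?andbF ?andbT.
  apply: eq_bigl => t; rewrite !inE -(inj_eq val_inj).
  by case: ltngtP; rewrite ?andbF ?andbT.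
rewrite big_split /= [X in _ + X](exchange_big_dep (mem J)) /=; last first.
  by move=> i j _ /andP[].
rewrite -big_split /=; apply: eq_bigr => j jJ; rewrite [RHS]big_split /=.
congr (_ + _); apply: eq_bigl => t; rewrite ?jJ //.
Qed.

(** * Minors of a quantum matrix as exterior products *)

Section QMatrix.
Context {F : fieldType} (q : F) {T : algType F}.
Hypothesis q0 : q != 0.

(** Any matrix over [T] that satisfies the relations, not only the generic one:
    transposes and matrices of operators are needed too. *)
Definition qmatrix k m (x : 'I_k -> 'I_m -> T) :=
  forall u, qmat_relator q x u -> u = 0.

Lemma qm_row k m (x : 'I_k -> 'I_m -> T) (i : 'I_k) (j t : 'I_m) : qmatrix x -> (j < t)%N ->
  x i t * x i j = q *: (x i j * x i t).
Proof.
by move=> qx jt; apply/subr0_eq/qx; apply: qmat_relator_q; right.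
Qed.

Lemma qm_col k m (x : 'I_k -> 'I_m -> T) (i s : 'I_k) (t : 'I_m) : qmatrix x -> (i < s)%N ->
  x s t * x i t = q *: (x i t * x s t).
Proof.
by move=> qx lis; apply/subr0_eq/qx; apply: qmat_relator_q; left.
Qed.

Lemma qm_comm k m (x : 'I_k -> 'I_m -> T) (i s : 'I_k) (t j : 'I_m) : qmatrix x ->
  (i < s)%N -> (t < j)%N -> x s t * x i j = x i j * x s t.
Proof.
by move=> qx lis ltj; apply/subr0_eq/qx; apply: qmat_relator_comm.
Qed.

Lemma qm_cross k m (x : 'I_k -> 'I_m -> T) (i s : 'I_k) (t j : 'I_m) : qmatrix x ->
  (i < s)%N -> (j < t)%N ->
  x s t * x i j = x i j * x s t + (q - q^-1) *: (x i t * x s j).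
Proof.
by move=> qx lis ltj; apply/subr0_eq/qx; apply: qmat_relator_cross.
Qed.

Definition xtr k m (x : 'I_k -> 'I_m -> T) : 'I_m -> 'I_k -> T := fun j i => x i j.

Lemma qmatrix_tr k m (x : 'I_k -> 'I_m -> T) : qmatrix x -> qmatrix (xtr x).
Proof.
move=> qx u [s i t j [[lis <-]|[<- ltj]]|s i t j lis ltj|s i t j lis ltj];
  apply/eqP; rewrite /xtr subr_eq0; apply/eqP.
- exact: qm_row.
- exact: qm_col.
- by rewrite (@qm_comm _ _ _ t j i s qx ltj lis).
- by rewrite (qm_cross qx ltj lis) (qm_comm qx ltj lis).
Qed.

Let w := - q^-1.

Section Rows.
Context {k m : nat} (x : 'I_k -> 'I_m -> T).
Hypothesis qx : qmatrix x.
Implicit Types (r s : 'I_k) (f : {set 'I_m} -> T) (I : {set 'I_k}) (J : {set 'I_m}) (rs : seq 'I_k).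

(** Write [y_j] for exterior variables with [y_t y_j = - q^-1 y_j y_t] when
    [j < t] and [y_j y_j = 0], commuting with [T].  A function on column sets
    stands for the element [sum_J f(J) y_J], and [rowl r], [rowr r] are left and
    right multiplication by the row vector [sum_j x_rj y_j]. *)
Definition rowl r f : {set 'I_m} -> T := fun J =>
  \sum_(j in J) w ^+ below J j *: (x r j * f (J :\ j)).

Definition rowr r f : {set 'I_m} -> T := fun J =>
  \sum_(j in J) w ^+ above J j *: (f (J :\ j) * x r j).

Definition ext1 : {set 'I_m} -> T := fun J => (J == set0)%:R.

Definition extprod rs := foldr rowl ext1 rs.

Lemma rowlZ r c f : rowl r (fun J => c *: f J) = fun J => c *: rowl r f J.
Proof.
apply/funext => J; rewrite /rowl scaler_sumr; apply: eq_bigr => j _.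
by rewrite -scalerAr !scalerA mulrC.
Qed.

Lemma rowl0 r : rowl r (fun=> 0) = fun=> 0.
Proof.
by apply/funext => J; rewrite /rowl big1 // => j _; rewrite mulr0 scaler0.
Qed.

Lemma rowl2E r s f J : rowl s (rowl r f) J =
  \sum_(j in J) \sum_(t in J | (t < j)%N)
    w ^+ (below J t + below (J :\ t) j) *:
     ((w *: (x s j * x r t) + x s t * x r j) * f (J :\ j :\ t)).
Proof.
transitivity (\sum_(j in J) \sum_(t in J :\ j)
   w ^+ (below J j + below (J :\ j) t) *: (x s j * x r t * f (J :\ j :\ t))).
  apply: eq_bigr => j _; rewrite /rowl mulr_sumr scaler_sumr.
  by apply: eq_bigr => t _; rewrite -scalerAr scalerA -exprD mulrA.
rewrite sum_offdiag; apply: eq_bigr => j jJ; apply: eq_bigr => t /andP[tJ ltj].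
have ntj : t != j by rewrite -(inj_eq val_inj) neq_ltn ltj.
rewrite [(J :\ t) :\ j]setD1C mulrDl scalerDr; congr (_ + _).
rewrite -scalerAl scalerA -exprSr; congr (w ^+ _ *: _).
rewrite (below_rem tJ ntj) (@below_rem _ J t j) //; last by rewrite eq_sym.
by rewrite ltj ltnNge ltnW //= addn0 addn1 addSn addnC.
Qed.

(** The row vectors satisfy the same relations as the exterior variables. *)
Lemma rowl_swap (r s : 'I_k) f : (r < s)%N ->
  rowl s (rowl r f) = fun J => w *: rowl r (rowl s f) J.
Proof.
move=> lrs; apply/funext => J; rewrite !rowl2E scaler_sumr.
apply: eq_bigr => j jJ; rewrite scaler_sumr; apply: eq_bigr => t /andP[tJ ltj].
rewrite [RHS]scalerA [w * _]mulrC -[RHS]scalerA; congr (_ *: _).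
rewrite [RHS]scalerAl; congr (_ * _).
rewrite (qm_cross qx lrs ltj) (qm_comm qx lrs ltj).
rewrite scalerDr scalerA -addrA [in RHS]addrC scalerDr scalerA; congr (_ + _).
rewrite -[X in _ + X]scale1r -scalerDl; congr (_ *: _).
by rewrite /w; field.
Qed.

Lemma rowl_sq r f : rowl r (rowl r f) = fun=> 0.
Proof.
apply/funext => J; rewrite !rowl2E big1 // => j jJ.
rewrite big1 // => t /andP[tJ ltj].
rewrite (qm_row r qx ltj) scalerA.
have -> : w * q = -1 by rewrite /w; field.
by rewrite scaleN1r addrC subrr mul0r scaler0.
Qed.

(** Left and right multiplications commute; the powers of [w] agree because
    removing [t] changes [below J j] exactly when removing [j] changes
    [above J t]. *)
Lemma rowlr r s f : rowl r (rowr s f) = rowr s (rowl r f).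
Proof.
apply/funext => J; rewrite /rowl /rowr.
transitivity (\sum_(j in J) \sum_(t in J :\ j)
   w ^+ (below J j + above (J :\ j) t) *: (x r j * f (J :\ j :\ t) * x s t)).
  apply: eq_bigr => j _; rewrite mulr_sumr scaler_sumr.
  by apply: eq_bigr => t _; rewrite -scalerAr scalerA -exprD mulrA.
rewrite (exchange_big_dep (mem J)) /=; last by move=> i j _; rewrite inE=> /andP[].
apply: eq_bigr => t tJ; rewrite mulr_suml scaler_sumr.
rewrite (eq_bigl (mem (J :\ t))); last first.
  by move=> j; rewrite !inE tJ andbT eq_sym andbC.
apply: eq_bigr => j /setD1P[njt jJ].
rewrite -scalerAl scalerA -exprD setD1C; congr (_ ^+ _ *: _).
rewrite (@below_rem _ _ j t) // 1?eq_sym // (@above_rem _ J t j) //.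
by rewrite addnC -[RHS]addnA; congr addn; apply: addnC.
Qed.

Lemma rowl_ext1 r : rowl r ext1 = rowr r ext1.
Proof.
apply/funext => J; apply: eq_bigr => j jJ; rewrite /ext1.
case: eqP => [e|_]; last by rewrite mulr0 mul0r !scaler0.
rewrite mulr1 mul1r -below_self -above_self e; congr (_ ^+ _ *: _).
by rewrite /below /above !(eq_card0 (A := [set _ in _ | _])) // => i; rewrite !inE.
Qed.

Lemma extprod_rcons rs r : extprod (rcons rs r) = rowr r (extprod rs).
Proof.
elim: rs => [|s rs IH] /=; first exact: rowl_ext1.
by rewrite IH rowlr.
Qed.

Lemma extprod_cons_dup s rs : s \in rs -> extprod (s :: rs) = fun=> 0.
Proof.
elim: rs => // r rs IH; rewrite inE => /predU1P[->|/IH /= E].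
  by rewrite /= rowl_sq.
have w0 : w != 0 by rewrite /w oppr_eq0 invr_eq0.
rewrite /=; have [lrs|lsr|/val_inj ->] := ltngtP r s; last by rewrite rowl_sq.
  by rewrite rowl_swap // E rowl0; apply/funext => J; rewrite scaler0.
apply/funext => J; apply: (scalerI w0).
by have /(congr1 (@^~ J)) /= <- := rowl_swap (extprod rs) lsr; rewrite E rowl0 scaler0.
Qed.

Lemma extprod_rcons_dup s rs : s \in rs -> extprod (rcons rs s) = fun=> 0.
Proof.
elim: rs => // r rs IH; rewrite inE => /predU1P[->|/IH E].
  by rewrite rcons_cons extprod_cons_dup // mem_rcons mem_head.
by rewrite /= E rowl0.
Qed.

Lemma extprod_cons_smaller s rs rs' : all (fun r : 'I_k => (r < s)%N) rs ->
  extprod (s :: rs ++ rs') = fun J => w ^+ size rs *: extprod (rs ++ s :: rs') J.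
Proof.
elim: rs => [_|r rs IH /= /andP[lrs als]].
  by apply/funext => J /=; rewrite scale1r.
rewrite rowl_swap //; have /= -> := IH als.
by rewrite rowlZ; apply/funext => J; rewrite scalerA exprS.
Qed.

Lemma extprod_rcons_larger s rs rs' : all (fun r : 'I_k => (s < r)%N) rs ->
  extprod (rs' ++ rcons rs s) =
  fun J => w ^+ size rs *: extprod (rs' ++ s :: rs) J.
Proof.
move=> als; elim: rs' => [|r rs' IH] /=; last first.
  by rewrite IH rowlZ.
elim: rs als => [_|r rs IH /= /andP[lsr als]].
  by apply/funext => J /=; rewrite scale1r.
rewrite IH // rowlZ /= rowl_swap //; apply/funext => J.
by rewrite scalerA exprSr.
Qed.

(** When the commutation factors of [y] with the entries split into a row part
    and a column part, every monomial of the minor picks up the same factor. *)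
Lemma extprod_qcomm (y : T) (e : 'I_k -> F) (e' : 'I_m -> F) rs J :
  (forall r j, r \in rs -> j \in J ->
    y * x r j = (e r * e' j) *: (x r j * y)) ->
  y * extprod rs J =
  (\prod_(r <- rs) e r * \prod_(j in J) e' j) *: (extprod rs J * y).
Proof.
elim: rs J => [|r rs IH] J yx /=.
  rewrite /ext1; case: eqP => [->|_]; last by rewrite mulr0 mul0r scaler0.
  by rewrite big_nil big_set0 mulr1 mul1r scale1r mulr1.
rewrite /rowl mulr_sumr mulr_suml scaler_sumr; apply: eq_bigr => j jJ.
rewrite -scalerAr mulrA yx ?mem_head // -!scalerAl scalerA -mulrA IH; last first.
  move=> r' j' r'rs /setD1P[_ j'J]; apply: yx => //.
  by rewrite inE r'rs orbT.
rewrite -scalerAr !scalerA !mulrA; congr (_ *: _).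
by rewrite big_cons [in RHS](big_setD1 j jJ) /=; ring.
Qed.

(** The coefficient of [y_J] in the product of the rows in [I]; it agrees with
    the permutation sum by [qminor_minor] below. *)
Definition minor I J := extprod (enum I) J.

Lemma extprod_cons_minor i s I J : i \in I -> s \in I ->
  extprod (i :: enum (I :\ s)) J =
  if i == s then w ^+ below I s *: minor I J else 0.
Proof.
move=> iI sI; case: eqP => [->|/eqP nis]; last first.
  by rewrite extprod_cons_dup // mem_enum !inE nis.
rewrite enum_rem extprod_cons_smaller; last first.
  by apply/allP => i'; rewrite mem_enum inE => /andP[].
by rewrite /minor -cardE -enum_split.
Qed.

Lemma extprod_rcons_minor i s I J : i \in I -> s \in I ->
  extprod (rcons (enum (I :\ s)) i) J =
  if i == s then w ^+ above I s *: minor I J else 0.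
Proof.
move=> iI sI; case: eqP => [->|/eqP nis]; last first.
  by rewrite extprod_rcons_dup // mem_enum !inE nis.
rewrite enum_rem rcons_cat extprod_rcons_larger; last first.
  by apply/allP => i'; rewrite mem_enum inE => /andP[].
by rewrite /minor -cardE -enum_split.
Qed.

Lemma minor_last_row I J i : i \in I -> (forall i', i' \in I -> (i' <= i)%N) ->
  minor I J = \sum_(t in J) w ^+ above J t *: (minor (I :\ i) (J :\ t) * x i t).
Proof.
move=> iI im; rewrite /minor -{1}(setD1K iI) enum_setU1_max ?extprod_rcons //.
move=> i' /setD1P[ni' /im]; rewrite leq_eqVlt => /predU1P[/val_inj e|//].
by rewrite e eqxx in ni'.
Qed.

Lemma minor_first_row I J i : i \in I -> (forall i', i' \in I -> (i <= i')%N) ->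
  minor I J = \sum_(t in J) w ^+ below J t *: (x i t * minor (I :\ i) (J :\ t)).
Proof.
move=> iI im; rewrite /minor -{1}(setD1K iI) enum_setU1_min //.
move=> i' /setD1P[ni' /im]; rewrite leq_eqVlt => /predU1P[/val_inj e|//].
by rewrite e eqxx in ni'.
Qed.

Lemma minor_comm (y : T) I J :
  (forall i j, i \in I -> j \in J -> y * x i j = x i j * y) ->
  y * minor I J = minor I J * y.
Proof.
move=> yx; rewrite /minor (@extprod_qcomm y (fun=> 1) (fun=> 1)).
  by rewrite !big1_eq mul1r scale1r.
by move=> i j; rewrite mem_enum mul1r scale1r; apply: yx.
Qed.

(** Expanding along the last row and then, inductively, along the first column
    gives the same double sum in the other order.  The corner entry of the last
    row and first column has to be moved past its minor, with which it commutes
    since all entries there lie above it and to its right. *)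
Lemma minor_first_col I J j : #|I| = #|J| ->
  j \in J -> (forall j', j' \in J -> (j <= j')%N) ->
  minor I J = \sum_(s in I) w ^+ below I s *: (x s j * minor (I :\ s) (J :\ j)).
Proof.
elim: {I}_.+1 {-2}I J (ltnSn #|I|) => // n IH I J ltIn eIJ jJ jm.
have I0 : I != set0 by rewrite -card_gt0 eIJ card_gt0; apply/set0Pn; exists j.
have [i iI im] := max_elem I0.
have ne_lt t : t \in J :\ j -> (j < t)%N.
  by case/setD1P => ntj /jm; rewrite leq_eqVlt => /predU1P[/val_inj e|//]; rewrite e eqxx in ntj.
have ne_lti s : s \in I :\ i -> (s < i)%N.
  by case/setD1P => ntj /im; rewrite leq_eqVlt => /predU1P[/val_inj e|//]; rewrite e eqxx in ntj.
rewrite (minor_last_row J iI im) (big_setD1 j) //= [RHS](big_setD1 i) //=.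
congr (_ + _).
  rewrite minor_comm; last first.
    move=> i' j' /ne_lti lt1 /ne_lt lt2; exact: (qm_comm qx).
  congr (_ ^+ _ *: _); apply/eqP; rewrite -(eqn_add2l (below J j)) -eqSS.
  rewrite below_above // -eIJ -(below_above iI) eqSS addnC; apply/eqP.
  by rewrite (below_min jm) (above_max im).
transitivity (\sum_(t in J :\ j) \sum_(s in I :\ i)
  w ^+ (above J t + below I s) *:
    (x s j * minor (I :\ i :\ s) (J :\ t :\ j) * x i t)).
  apply: eq_bigr => t tJj; have ltjt := ne_lt _ tJj; case/setD1P: tJj => ntj tJ.
  rewrite (IH (I :\ i) (J :\ t)); first last.
  - by move=> j' /setD1P[_ /jm].
  - by rewrite !inE eq_sym ntj jJ.
  - exact: eq_card_rem.
  - by move: ltIn; rewrite (cardsD1 i I) iI.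
  rewrite mulr_suml scaler_sumr; apply: eq_bigr => s sIi.
  have lsi := ne_lti _ sIi.
  rewrite -scalerAl scalerA -exprD; congr (_ ^+ (_ + _) *: _).
  rewrite (@below_rem _ I s i) //; last by rewrite -(inj_eq val_inj) neq_ltn lsi orbT.
  by rewrite ltnNge ltnW //= addn0.
rewrite exchange_big /=; apply: eq_bigr => s sIi; have lsi := ne_lti _ sIi.
have nis : i != s by rewrite -(inj_eq val_inj) neq_ltn lsi orbT.
rewrite (@minor_last_row (I :\ s) (J :\ j) i); first last.
- by move=> i' /setD1P[_ /im].
- by rewrite !inE iI andbT.
rewrite mulr_sumr scaler_sumr; apply: eq_bigr => t tJj.
have ltjt := ne_lt _ tJj.
have njt : j != t by rewrite -(inj_eq val_inj) neq_ltn ltjt.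
rewrite -scalerAr scalerA -exprD setD1C [J :\ t :\ j]setD1C.
rewrite mulrA addnC; congr (_ ^+ (_ + _) *: _).
by rewrite (@above_rem _ J t j) // ltnNge ltnW //= addn0.
Qed.

End Rows.

(** Expansions along columns follow from those along rows by this symmetry. *)
Lemma minor_tr k m (x : 'I_k -> 'I_m -> T) (I : {set 'I_k}) (J : {set 'I_m}) :
  qmatrix x -> #|I| = #|J| ->
  minor x I J = minor (xtr x) J I.
Proof.
move=> qx; elim: {J}_.+1 I {-2}J (ltnSn #|J|) => // n IH I J ltJn eIJ.
have [J0|J0] := eqVneq J set0.
  have I0 : I = set0 by apply/eqP; rewrite -cards_eq0 eIJ J0 cards0.
  by rewrite I0 J0 /minor !enum_set0 /= /ext1 !eqxx.
have [j jJ jm] := min_elem J0.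
rewrite (minor_first_col qx eIJ jJ jm) (minor_first_row _ _ jJ jm).
apply: eq_bigr => s sI; rewrite IH //; first by move: ltJn; rewrite (cardsD1 j J) jJ.
exact: eq_card_rem.
Qed.

(** * Commutation of an entry with a minor *)

Section Commutation.
Context {k m : nat} (x : 'I_k -> 'I_m -> T).
Hypothesis qx : qmatrix x.
Context (I : {set 'I_k}) (J : {set 'I_m}).
Hypothesis eIJ : #|I| = #|J|.

(** Expand the double sum of [x_il * (minor without row s and column l) * x_sj]
    in the two possible orders.  Summing over [l] first leaves only [s = i], as a
    repeated row vector kills the product; summing over [s] first gives a
    product of column vectors in which column [l] is replaced by column [j].
    The three commutation rules below are the cases where that product is
    again a minor. *)
Lemma minor_adjugate i j : i \in I ->
  \sum_(l in J) w ^+ below J l *: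
     (x i l * extprod (xtr x) (rcons (enum (J :\ l)) j) I) =
  w ^+ #|I|.-1 *: (minor x I J * x i j).
Proof.
move=> iI; have qxT := qmatrix_tr qx.
transitivity (\sum_(l in J) \sum_(s in I) w ^+ (below J l + above I s) *:
    (x i l * minor x (I :\ s) (J :\ l) * x s j)).
  apply: eq_bigr => l lJ; rewrite extprod_rcons // /rowr mulr_sumr scaler_sumr.
  apply: eq_bigr => s sI; rewrite -scalerAr scalerA -exprD mulrA minor_tr //.
  exact: eq_card_rem.
rewrite exchange_big /= (big_setD1 i) //= [X in _ + X]big1 ?addr0; last first.
  move=> s /setD1P[nsi sI].
  transitivity (w ^+ above I s *: (extprod x (i :: enum (I :\ s)) J * x s j)).
    rewrite /= /rowl mulr_suml scaler_sumr; apply: eq_bigr => l lJ.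
    by rewrite -scalerAl scalerA -exprD addnC.
  by rewrite extprod_cons_minor // eq_sym (negPf nsi) mul0r scaler0.
transitivity (w ^+ above I i *: (extprod x (i :: enum (I :\ i)) J * x i j)).
  rewrite /= /rowl mulr_suml scaler_sumr; apply: eq_bigr => l lJ.
  by rewrite -scalerAl scalerA -exprD addnC.
rewrite extprod_cons_minor // eqxx -scalerAl scalerA -exprD; congr (_ ^+ _ *: _).
by rewrite -(below_above iI) addnC.
Qed.

Let w0 : w != 0. Proof. by rewrite /w oppr_eq0 invr_eq0. Qed.

Lemma minor_central i j : i \in I -> j \in J ->
  minor x I J * x i j = x i j * minor x I J.
Proof.
move=> iI jJ; apply: (scalerI (expf_neq0 #|I|.-1 w0)).
rewrite -minor_adjugate // (big_setD1 j) //= [X in _ + X]big1 ?addr0; last first.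
  move=> l /setD1P[nlj lJ]; have qxT := qmatrix_tr qx.
  by rewrite extprod_rcons_minor // eq_sym (negPf nlj) mulr0 scaler0.
rewrite extprod_rcons_minor ?eqxx //; last exact: qmatrix_tr.
rewrite -minor_tr // -scalerAr scalerA -exprD; congr (_ ^+ _ *: _).
by rewrite eIJ -(below_above jJ).
Qed.

(** The sum in [minor_adjugate] is, up to its missing term [l = j], the
    expansion of a minor with a repeated row, which vanishes; hence it equals
    minus the missing term. *)
Lemma minor_right_col i (j : 'I_m) : i \in I -> (forall l, l \in J -> (l < j)%N) ->
  minor x I J * x i j = q^-1 *: (x i j * minor x I J).
Proof.
move=> iI jm; have qxT := qmatrix_tr qx.
have jJ : j \notin J by apply/negP => /jm; rewrite ltnn.
apply: (scalerI (expf_neq0 #|I|.-1 w0)); rewrite -minor_adjugate //.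
have /esym : extprod x (i :: enum I) (j |: J) = 0.
  by rewrite extprod_cons_dup // mem_enum.
rewrite /= /rowl big_setU1 //= setU1K // => /eqP.
rewrite eq_sym addrC addr_eq0 => /eqP E.
transitivity (\sum_(l in J) w ^+ below (j |: J) l *:
    (x i l * extprod x (enum I) ((j |: J) :\ l))).
  apply: eq_bigr => l lJ; congr (_ *: (_ * _)).
    have nlj : j != l by apply: contraTneq lJ => <-.
    rewrite (@below_rem _ (j |: J) l j) ?setU11 ?setU1K //.
    by rewrite ltnNge ltnW ?addn0 // jm.
  rewrite -enum_setU1_max; last by move=> j' /setD1P[_ /jm].
  have -> : j |: J :\ l = (j |: J) :\ l.
    by apply/setP => t; rewrite !inE; case: eqP => [->|//]; case: eqP jJ => [->|]; rewrite ?lJ.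
  rewrite -/(minor _ _ _) -minor_tr //.
  apply/eqP; rewrite -eqSS eIJ; have := cardsD1 l (j |: J).
  by rewrite !inE lJ orbT cardsU1 jJ !add1n => ->.
(* E : the missing term, with exponent #|J| since j is beyond J. *)
rewrite {}E scalerA -scaleNr; congr (_ *: _).
rewrite /below (_ : [set i0 in _ | _] = J); last first.
  apply/setP => t; rewrite !inE; case: eqP => [->|_] /=.
    by rewrite ltnn (negPf jJ).
  by case: (boolP (t \in J)) => //= /jm.
have : (0 < #|J|)%N by rewrite -eIJ card_gt0; apply/set0Pn; exists i.
by rewrite -eIJ; case: #|I| => //= n _; rewrite exprSr /w -mulrN opprK.
Qed.

Lemma minor_left_col i (j : 'I_m) : i \in I -> (forall l, l \in J -> (j < l)%N) ->
  minor x I J * x i j = q *: (x i j * minor x I J).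
Proof.
move=> iI jm; have qxT := qmatrix_tr qx.
have jJ : j \notin J by apply/negP => /jm; rewrite ltnn.
apply: (scalerI (expf_neq0 #|I|.-1 w0)); rewrite -minor_adjugate //.
have /esym : extprod x (i :: enum I) (j |: J) = 0.
  by rewrite extprod_cons_dup // mem_enum.
rewrite /= /rowl big_setU1 //= setU1K // => /eqP.
rewrite eq_sym addrC addr_eq0 => /eqP E.
transitivity (w ^+ #|I|.-1 *: (w^-1 *: \sum_(l in J) w ^+ below (j |: J) l *:
    (x i l * extprod x (enum I) ((j |: J) :\ l)))).
  rewrite !scaler_sumr; apply: eq_bigr => l lJ.
  have cJl : #|J :\ l| = #|I|.-1 by rewrite eIJ (cardsD1 l J) lJ.
  rewrite -[rcons _ _]cat0s extprod_rcons_larger //; last first.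
    by apply/allP => t; rewrite mem_enum => /setD1P[_ /jm].
  rewrite /= -cardE cJl -scalerAr !scalerA; congr (_ *: (_ * _)).
    have nlj : j != l by apply: contraTneq lJ => <-.
    rewrite (@below_rem _ (j |: J) l j) ?setU11 ?setU1K //.
    by rewrite jm // addn1 exprSr mulrC; field.
  rewrite -[rowl _ _ _ _]/(extprod (xtr x) (j :: enum (J :\ l)) I).
  rewrite -enum_setU1_min; last by move=> j' /setD1P[_ /jm].
  have -> : j |: J :\ l = (j |: J) :\ l.
    by apply/setP => t; rewrite !inE; case: eqP => [->|//]; case: eqP jJ => [->|]; rewrite ?lJ.
  rewrite -/(minor _ _ _) -minor_tr //.
  apply/eqP; rewrite -eqSS eIJ; have := cardsD1 l (j |: J).
  by rewrite !inE lJ orbT cardsU1 jJ !add1n => ->.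
rewrite {}E -scaleNr [w^-1 *: _]scalerA; congr (_ *: (_ *: _)).
rewrite /below (_ : [set i0 in _ | _] = set0).
  by rewrite cards0 expr0 mulrN1 /w invrN invrK opprK.
apply/setP => t; rewrite !inE; case: eqP => [->|_] /=; first by rewrite ltnn.
by case: (boolP (t \in J)) => //= /jm; case: ltngtP.
Qed.

End Commutation.

End QMatrix.

(** * Evaluation of the generic quantum matrix *)

Lemma qmat_relator_morph (F : fieldType) (q : F) k m (A B : lalgType F)
  (f : A -> B) (x : 'I_k -> 'I_m -> A) (y : 'I_k -> 'I_m -> B) u :
  {morph f : u v / u + v} -> {morph f : u v / u * v} ->
  (forall c, {morph f : u / c *: u}) -> (forall i j, f (x i j) = y i j) ->
  qmat_relator q x u -> qmat_relator q y (f u).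
Proof.
move=> fD fM fZ fx.
have fB : {morph f : u v / u - v}.
  by move=> a b; rewrite fD -[- b]scaleN1r fZ scaleN1r.
case=> [s i t j h|s i t j h h'|s i t j h h'];
  rewrite ?(fB, fD, fM, fZ) !fx.
- exact: qmat_relator_q.
- exact: qmat_relator_comm.
- exact: qmat_relator_cross.
Qed.

Lemma qmat_relator_lift (F : fieldType) (q : F) k m (A B : lalgType F)
  (f : A -> B) (x : 'I_k -> 'I_m -> A) (y : 'I_k -> 'I_m -> B) u :
  {morph f : u v / u + v} -> {morph f : u v / u * v} ->
  (forall c, {morph f : u / c *: u}) -> (forall i j, f (x i j) = y i j) ->
  qmat_relator q y u -> exists2 v, qmat_relator q x v & f v = u.
Proof.
move=> fD fM fZ fx.
have fB : {morph f : u v / u - v}.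
  by move=> a b; rewrite fD -[- b]scaleN1r fZ scaleN1r.
case=> [s i t j h|s i t j h h'|s i t j h h']; eexists.
- exact: (qmat_relator_q _ _ h).
- by rewrite ?(fB, fD, fM, fZ) !fx.
- exact: (qmat_relator_comm _ _ h h').
- by rewrite ?(fB, fD, fM, fZ) !fx.
- exact: (qmat_relator_cross _ _ h h').
- by rewrite ?(fB, fD, fM, fZ) !fx.
Qed.

Section Lift.
Local Open Scope quotient_scope.
Context {F : fieldType} (q : F) {k m : nat} {T : algType F}.
Context (x : 'I_k -> 'I_m -> T).
Hypothesis xP : qmatrix q x.
Local Notation A := (free_alg F k m).
Local Notation Q := (qmat q k m).

Definition word_eval (w : {fmonom ('I_k * 'I_m)%type}) : T :=
  \prod_(p <- fmonom_val w) x p.1 p.2.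

Lemma word_eval_mmorphism : mmorphism word_eval.
Proof.
split=> [v w|]; last by rewrite /word_eval fm1 big_nil.
by rewrite /word_eval fmM big_cat.
Qed.
HB.instance Definition _ := isMultiplicative.Build _ T word_eval word_eval_mmorphism.

Definition free_eval (u : A) : T := mmap (in_alg T) word_eval u.

Lemma free_eval_is_additive : additive free_eval.
Proof. exact: mmap_is_additive. Qed.
HB.instance Definition _ := GRing.isAdditive.Build A T free_eval free_eval_is_additive.

Lemma free_eval_is_multiplicative : multiplicative free_eval.
Proof.
apply: commr_mmap_is_multiplicative => g w w'.
by rewrite /GRing.comm /= mulr_algl mulr_algr.
Qed.
HB.instance Definition _ :=
  GRing.isMultiplicative.Build A T free_eval free_eval_is_multiplicative.

Lemma free_evalZ c u : free_eval (c *: u) = c *: free_eval u.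
Proof. by rewrite /free_eval mmapZ /= mulr_algl. Qed.

Lemma free_evalD u v : free_eval (u + v) = free_eval u + free_eval v.
Proof. exact: raddfD. Qed.

Lemma free_evalM u v : free_eval (u * v) = free_eval u * free_eval v.
Proof. exact: rmorphM. Qed.

Lemma free_eval_gen i j : free_eval (gen i j) = x i j.
Proof. by rewrite /free_eval mmapU /= scale1r mul1r /word_eval fmU big_seq1. Qed.

Lemma free_eval_ideal u : qmat_ideal q u -> free_eval u = 0.
Proof.
elim=> [{}u | | v v' _ v0 _ v'0 | a v _ v0 | a v _ v0].
- move=> ru; apply: xP; apply: qmat_relator_morph ru.
  + exact: free_evalD.
  + exact: free_evalM.
  + exact: free_evalZ.
  + exact: free_eval_gen.
- exact: raddf0.
- by rewrite raddfD /= v0 v'0 addr0.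
- by rewrite rmorphM /= v0 mulr0.
- by rewrite rmorphM /= v0 mul0r.
Qed.

Definition qmat_eval (u : Q) : T := free_eval (repr u).

Lemma qmat_evalE u : qmat_eval (\pi_Q u) = free_eval u.
Proof.
apply/esym/eqP; rewrite -subr_eq0 -raddfB; apply/eqP/free_eval_ideal.
exact: qmat_repr.
Qed.

Lemma qmat_evalD u v : qmat_eval (u + v) = qmat_eval u + qmat_eval v.
Proof.
elim/quotW: u => u; elim/quotW: v => v.
by rewrite -qmat_piD !qmat_evalE raddfD.
Qed.

Lemma qmat_evalM u v : qmat_eval (u * v) = qmat_eval u * qmat_eval v.
Proof.
elim/quotW: u => u; elim/quotW: v => v.
by rewrite [_ * _]qmat_mulE !qmat_evalE rmorphM.
Qed.

Lemma qmat_evalZ c u : qmat_eval (c *: u) = c *: qmat_eval u.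
Proof.
by elim/quotW: u => u; rewrite [_ *: _]qmat_scaleE !qmat_evalE free_evalZ.
Qed.

Lemma qmat_eval1 : qmat_eval 1 = 1.
Proof.
have -> : 1 = \pi_Q (1 : A) :> Q by [].
by rewrite qmat_evalE; apply: rmorph1.
Qed.

Lemma qmat_eval_qx i j : qmat_eval (qx i j) = x i j.
Proof. by rewrite qmat_evalE free_eval_gen. Qed.

End Lift.

Lemma qx_qmatrix (F : fieldType) (q : F) k m : qmatrix q (@qx F q k m).
Proof.
move=> u /(@qmat_relator_lift F q k m (free_alg F k m) (qmat q k m)
  (\pi_(qmat q k m))%qT (@gen F k m)) [].
- exact: qmat_piD.
- by move=> a b; rewrite [RHS]qmat_mulE.
- by move=> c a; rewrite [RHS]qmat_scaleE.
- by [].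
move=> v rv <-; have -> : 0 = (\pi_(qmat q k m) (0 : free_alg F k m))%qT.
  by apply: (addrI (\pi_(qmat q k m) 0)%qT); rewrite -qmat_piD !addr0.
by apply/qmat_piP; rewrite subr0; apply: qmat_ideal_relator.
Qed.

(** * The algebra of linear operators on functions of countably many exponents *)

Definition latfun (F : fieldType) : lmodType F := ((nat -> nat) -> F^o).

(** All realizations below live in one algebra of operators: the functions
    depend on infinitely many integer variables, so that fresh variables
    are always available. *)
Record latop (F : fieldType) :=
  Latop { latop_fun :> latfun F -> latfun F; latop_linear : linear latop_fun }.

Section LatOp.
Context {F : fieldType}.
Local Notation V := (latfun F).
Local Notation T := (latop F).
Implicit Types (f g : T) (u v : V).

Lemma latopP f g : (forall v, f v = g v) -> f = g.
Proof.
case: f g => [f fl] [g gl] /= /funext efg.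
by rewrite efg in fl *; congr Latop; apply: Prop_irrelevance.
Qed.

HB.instance Definition _ := gen_eqMixin T.
HB.instance Definition _ := gen_choiceMixin T.

Lemma latopD f u v : f (u + v) = f u + f v.
Proof. by rewrite -[u in LHS]scale1r latop_linear scale1r. Qed.

Lemma latop0 f : f 0 = 0.
Proof. by apply: (addrI (f 0)); rewrite -latopD !addr0. Qed.

Lemma latopZ f c u : f (c *: u) = c *: f u.
Proof. by rewrite -[c *: u]addr0 latop_linear latop0 addr0. Qed.

Lemma latopN f u : f (- u) = - f u.
Proof. by rewrite -scaleN1r latopZ scaleN1r. Qed.

Fact zero_linear : linear (fun _ : V => 0 : V).
Proof. by move=> c u v; rewrite scaler0 addr0. Qed.
Fact add_linear f g : linear (fun v => f v + g v).
Proof. by move=> c u v; rewrite !latopD !latopZ scalerDr addrACA. Qed.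
Fact opp_linear f : linear (fun v => - f v).
Proof. by move=> c u v; rewrite latopD latopZ opprD scalerN. Qed.
Fact one_linear : linear (fun v : V => v).
Proof. by []. Qed.
Fact comp_linear f g : linear (fun v => f (g v)).
Proof. by move=> c u v; rewrite !(latopD, latopZ). Qed.
Fact scale_linear c f : linear (fun v => c *: f v).
Proof. by move=> d u v; rewrite !(latopD, latopZ) scalerDr !scalerA mulrC. Qed.

Let addo f g := Latop (add_linear f g).
Let oppo f := Latop (opp_linear f).
Let zeroo := Latop zero_linear.
Let oneo := Latop one_linear.
Let mulo f g := Latop (comp_linear f g).
Let scaleo c f := Latop (scale_linear c f).

Fact addoA : associative addo.
Proof. by move=> f g h; apply: latopP => v /=; rewrite addrA. Qed.
Fact addoC : commutative addo.
Proof. by move=> f g; apply: latopP => v /=; rewrite addrC. Qed.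
Fact add0o : left_id zeroo addo.
Proof. by move=> f; apply: latopP => v /=; rewrite add0r. Qed.
Fact addNo : left_inverse zeroo oppo addo.
Proof. by move=> f; apply: latopP => v /=; rewrite addNr. Qed.

HB.instance Definition _ := GRing.isZmodule.Build T addoA addoC add0o addNo.

Fact muloA : associative mulo.
Proof. by move=> f g h; apply: latopP. Qed.
Fact mul1o : left_id oneo mulo.
Proof. by move=> f; apply: latopP. Qed.
Fact mulo1 : right_id oneo mulo.
Proof. by move=> f; apply: latopP. Qed.
Fact muloDl : left_distributive mulo +%R.
Proof. by move=> f g h; apply: latopP. Qed.
Fact muloDr : right_distributive mulo +%R.
Proof. by move=> f g h; apply: latopP => v /=; rewrite latopD. Qed.
Fact oneo_neq0 : oneo != 0.
Proof.
apply/eqP => /(congr1 (fun f : T => f (fun=> 1) (fun=> 0%N))) /= /eqP.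
by rewrite oner_eq0.
Qed.

HB.instance Definition _ :=
  GRing.Zmodule_isNzRing.Build T muloA mul1o mulo1 muloDl muloDr oneo_neq0.

Fact scaleoA c d f : scaleo c (scaleo d f) = scaleo (c * d) f.
Proof. by apply: latopP => v /=; rewrite scalerA. Qed.
Fact scale1o : left_id 1 scaleo.
Proof. by move=> f; apply: latopP => v /=; rewrite scale1r. Qed.
Fact scaleoDr : right_distributive scaleo +%R.
Proof. by move=> c f g; apply: latopP => v /=; rewrite scalerDr. Qed.
Fact scaleoDl f : {morph scaleo^~ f : c d / c + d}.
Proof. by move=> c d; apply: latopP => v /=; rewrite scalerDl. Qed.

HB.instance Definition _ :=
  GRing.Zmodule_isLmodule.Build F T scaleoA scale1o scaleoDr scaleoDl.

Fact scaleoAl c f g : c *: (f * g) = (c *: f) * g.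
Proof. by apply: latopP. Qed.
HB.instance Definition _ := GRing.Lmodule_isLalgebra.Build F T scaleoAl.

Fact scaleoAr c f g : c *: (f * g) = f * (c *: g).
Proof. by apply: latopP => v /=; rewrite latopZ. Qed.
HB.instance Definition _ := GRing.Lalgebra_isAlgebra.Build F T scaleoAr.

Lemma latop_addE f g v : (f + g) v = f v + g v. Proof. by []. Qed.
Lemma latop_mulE f g v : (f * g) v = f (g v). Proof. by []. Qed.
Lemma latop_scaleE c f v : (c *: f) v = c *: f v. Proof. by []. Qed.

End LatOp.

(** * Elementary row operations on quantum matrices *)

Section RowRelations.
Context {F : fieldType} (q : F) {T : algType F} {m : nat}.
Hypothesis q0 : q != 0.
Implicit Types u v : 'I_m -> T.

Definition row_rel u := forall j t : 'I_m, (j < t)%N ->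
  u t * u j = q *: (u j * u t).

Definition pair_rel u v := forall j t : 'I_m,
  [/\ v t * u t = q *: (u t * v t),
      (t < j)%N -> v t * u j = u j * v t
    & (j < t)%N -> v t * u j = u j * v t + (q - q^-1) *: (u t * v j)].

Lemma qmatrix_rows k (x : 'I_k -> 'I_m -> T) :
  (forall i, row_rel (x i)) ->
  (forall i s : 'I_k, (i < s)%N -> pair_rel (x i) (x s)) -> qmatrix q x.
Proof.
move=> rx px u [s i t j [[lis <-]|[<- ltj]]|s i t j lis ltj|s i t j lis ltj];
  apply/eqP; rewrite subr_eq0; apply/eqP.
- by case: (px i s lis t t).
- exact: rx.
- by case: (px i s lis j t) => _ /(_ ltj).
- by case: (px i s lis j t) => _ _ /(_ ltj).
Qed.

Lemma mul_comm22 (a b c d : T) : b * c = c * b -> a * b * (c * d) = a * c * (b * d).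
Proof. by move=> bc; rewrite -!mulrA [b * _]mulrA bc -mulrA. Qed.

Lemma row_rel_mul c u : (forall j, c * u j = u j * c) -> row_rel u ->
  row_rel (fun j => c * u j).
Proof.
move=> cu ru j t ltj.
have E s s' : c * u s * (c * u s') = c * c * (u s * u s') by rewrite mul_comm22.
by rewrite !E ru // -scalerAr.
Qed.

Lemma pair_rel_add u v v' : pair_rel u v -> pair_rel u v' ->
  pair_rel u (fun j => v j + v' j).
Proof.
move=> r r' j t; have [e1 e2 e3] := r j t; have [e1' e2' e3'] := r' j t.
split=> [|h|h]; rewrite ?mulrDl ?mulrDr ?scalerDr.
- by rewrite e1 e1'.
- by rewrite e2 // e2'.
- by rewrite e3 // e3' // addrACA.
Qed.

Lemma pair_rel_addl u u' v : pair_rel u v -> pair_rel u' v ->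
  pair_rel (fun j => u j + u' j) v.
Proof.
move=> r r' j t; have [e1 e2 e3] := r j t; have [e1' e2' e3'] := r' j t.
split=> [|h|h]; rewrite ?mulrDl ?mulrDr ?scalerDr.
- by rewrite e1 e1'.
- by rewrite e2 // e2'.
- by rewrite e3 // e3' // addrACA.
Qed.

Lemma pair_rel_mul c u v : (forall j, c * u j = u j * c) -> pair_rel u v ->
  pair_rel u (fun j => c * v j).
Proof.
move=> cu r j t; have [e1 e2 e3] := r j t.
split=> [|h|h]; rewrite -!mulrA.
- by rewrite e1 -scalerAr !mulrA cu.
- by rewrite e2 // !mulrA cu.
- by rewrite e3 // mulrDr -scalerAr !mulrA !cu.
Qed.

Lemma pair_rel_mull c u v : (forall j, c * v j = v j * c) -> pair_rel u v ->
  pair_rel (fun j => c * u j) v.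
Proof.
move=> cv r j t; have [e1 e2 e3] := r j t.
split=> [|h|h]; rewrite mulrA -cv -!mulrA.
- by rewrite e1 -scalerAr.
- by rewrite e2.
- by rewrite e3 // mulrDr -scalerAr.
Qed.

(** Multiplying a pair of adjacent rows by the quantum matrix with rows [(a, c)]
    and [(0, b)], whose entries commute with the matrix: the product of two
    quantum matrices with mutually commuting entries is again one. *)
Section Step.
Context (a b c : T) (u v : 'I_m -> T).
Hypotheses (ba : b * a = 1) (ab : a * b = 1).
Hypotheses (ca : c * a = q *: (a * c)) (bc : b * c = q *: (c * b)).
Hypotheses (au : forall j, a * u j = u j * a) (cu : forall j, c * u j = u j * c).
Hypotheses (bu : forall j, b * u j = u j * b).
Hypotheses (av : forall j, a * v j = v j * a) (cv : forall j, c * v j = v j * c).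
Hypotheses (bv : forall j, b * v j = v j * b).
Hypotheses (ru : row_rel u) (rv : row_rel v) (ruv : pair_rel u v).

Let y j := a * u j + c * v j.
Let z j := b * v j.

Lemma step_row : row_rel y.
Proof.
move=> j t ltj; have [_ _ /(_ ltj) e] := ruv j t; have [_ /(_ ltj) e' _] := ruv t j.
have yy s s' : y s * y s' = a * a * (u s * u s') +
    (a * c * (u s * v s') + q *: (a * c * (v s * u s')) + c * c * (v s * v s')).
  rewrite /y mulrDl !mulrDr (mul_comm22 _ _ (esym (au s))).
  rewrite (mul_comm22 _ _ (esym (cu s))) (mul_comm22 _ _ (esym (av s))).
  by rewrite (mul_comm22 _ _ (esym (cv s))) ca -scalerAl !addrA.
rewrite !yy ru // rv // e e' scalerDr -!scalerAr; congr (_ + _).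
rewrite scalerDr; congr (_ + _); rewrite mulrDr !scalerDr -scalerAr !scalerA.
rewrite addrCA; congr (_ + _).
rewrite -[X in X + _]scale1r -scalerDl; congr (_ *: _).
by field.
Qed.

Lemma step_pair : pair_rel y z.
Proof.
have zy i j : z i * y j = v i * u j + q *: (c * b * (v i * v j)).
  rewrite /z /y mulrDr (mul_comm22 _ _ (esym (av i))).
  by rewrite (mul_comm22 _ _ (esym (cv i))) ba mul1r bc -scalerAl.
have yz i j : y i * z j = u i * v j + c * b * (v i * v j).
  by rewrite /z /y mulrDl (mul_comm22 _ _ (esym (bu i))) (mul_comm22 _ _ (esym (bv i))) ab mul1r.
move=> j t; have [e1 e2 e3] := ruv j t; rewrite !zy !yz.
split=> [|h|h].
- by rewrite e1 scalerDr.
- by rewrite e2 // (rv h) -scalerAr.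
- rewrite e3 // rv // -!scalerAr scalerDr -!addrA; congr (_ + _).
  rewrite addrCA; congr (_ + _).
  rewrite !scalerA -[X in _ = X + _]scale1r -scalerDl; congr (_ *: _).
  by field.
Qed.

End Step.
End RowRelations.

(** Only adjacent rows may be combined: with a row in between, one of the
    relations of the left factor would require the product of [c] and the
    diagonal entry [1] of that row to vanish. *)
Lemma qmatrix_step (F : fieldType) (q : F) (T : algType F) n m
    (x : 'I_n -> 'I_m -> T) (i i' : 'I_n) (a b c : T) :
  q != 0 -> i' = i.+1 :> nat -> b * a = 1 -> a * b = 1 ->
  c * a = q *: (a * c) -> b * c = q *: (c * b) ->
  (forall r j, [/\ a * x r j = x r j * a, b * x r j = x r j * b
                 & c * x r j = x r j * c]) ->
  qmatrix q x ->
  qmatrix q (fun r => if r == i then fun j => a * x i j + c * x i' j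
                      else if r == i' then fun j => b * x i' j else x r).
Proof.
move=> q0 ii' ba ab ca bc cx qx.
have ax r j : a * x r j = x r j * a by case: (cx r j).
have bx r j : b * x r j = x r j * b by case: (cx r j).
have xc r j : c * x r j = x r j * c by case: (cx r j).
have rx r : row_rel q (x r) by move=> j t; apply: qm_row.
have px (r s : 'I_n) : (r < s)%N -> pair_rel q (x r) (x s).
  move=> lrs j t; split=> [|h|h]; first exact: qm_col.
    exact: (qm_comm qx).
  exact: qm_cross.
have lii' : (i < i')%N by rewrite ii'.
have nii' : i' != i by rewrite -(inj_eq val_inj) neq_ltn lii' orbT.
apply: qmatrix_rows => [r|r s lrs].
  have [_|nri] := eqVneq r i; first by apply: step_row => //; apply: px.
  by have [_|nri'] := eqVneq r i'; [apply: row_rel_mul | apply: rx].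
have [eri|nri] := eqVneq r i.
  have nsi : s != i by rewrite -eri -(inj_eq val_inj) neq_ltn lrs orbT.
  rewrite (negPf nsi); have [esi'|nsi'] := eqVneq s i'; first by apply: step_pair => //; apply: px.
  have li's : (i' < s)%N.
    rewrite ltn_neqAle eq_sym (inj_eq val_inj) nsi' /=.
    by rewrite ii' -eri.
  apply: pair_rel_addl; apply: pair_rel_mull => //; apply: px => //.
  exact: ltn_trans lii' li's.
have [eri'|nri'] := eqVneq r i'.
  have li's : (i' < s)%N by rewrite -eri'.
  have lis := ltn_trans lii' li's.
  have /negPf-> : s != i by rewrite -(inj_eq val_inj) neq_ltn lis orbT.
  have /negPf-> : s != i' by rewrite -(inj_eq val_inj) neq_ltn li's orbT.
  by apply: pair_rel_mull => //; apply: px.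
have [esi|nsi] := eqVneq s i.
  have lri : (r < i)%N by rewrite -esi.
  apply: pair_rel_add; apply: pair_rel_mul => //; apply: px => //.
  exact: ltn_trans lri lii'.
have [esi'|nsi'] := eqVneq s i'; last exact: px.
apply: pair_rel_mul => //; apply: px.
by rewrite -esi'.
Qed.

(** * Operators that specialize to a given matrix *)

(** The model for [reg] is the ring of rational functions of [q] without a pole
    at [q = 1], where distinct constants stay distinct modulo [q - 1]. *)
Record specialization (K F : fieldType) (q : F) := Specialization {
  spec_cst : {rmorphism K -> F};
  reg : F -> Prop;
  regD : forall a b, reg a -> reg b -> reg (a + b);
  regM : forall a b, reg a -> reg b -> reg (a * b);
  reg_cst : forall c, reg (spec_cst c);
  reg_q : reg q;
  reg_qV : reg q^-1;
  reg_proper : forall c a, reg a -> spec_cst c = (q - 1) * a -> c = 0;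
  spec_q0 : q != 0;
  spec_q1 : q != 1 }.

Section Realization.
Context {K F : fieldType} {q : F} (sp : specialization K q).
Local Notation V := (latfun F).
Local Notation T := (latop F).
Local Notation h := (q - 1).
Implicit Types (u v w : V) (Z : T) (a : nat -> F).

Let q0 : q != 0 := spec_q0 sp.

(** The lattice of functions with regular values, and its multiples of
    [q - 1]. *)
Definition lat v := forall s, reg sp (v s).
Definition small v := exists2 w, lat w & v = h *: w.
Definition stable Z := forall v, lat v -> lat (Z v).

Lemma reg0 : reg sp 0. Proof. by rewrite -(rmorph0 (spec_cst sp)); apply: reg_cst. Qed.
Lemma reg1 : reg sp 1. Proof. by rewrite -(rmorph1 (spec_cst sp)); apply: reg_cst. Qed.
Lemma regN c : reg sp c -> reg sp (- c).
Proof.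
move=> rc; rewrite -mulN1r; apply: regM => //.
by rewrite -(rmorphN1 (spec_cst sp)); apply: reg_cst.
Qed.
Lemma regX c n : reg sp c -> reg sp (c ^+ n).
Proof.
by move=> rc; elim: n => [|n IH]; [exact: reg1 | rewrite exprS; apply: regM].
Qed.

Lemma latD u v : lat u -> lat v -> lat (u + v).
Proof. by move=> lu lv s; apply: regD. Qed.
Lemma latZ c u : reg sp c -> lat u -> lat (c *: u).
Proof. by move=> rc lu s; apply: regM. Qed.

Lemma smallD u v : small u -> small v -> small (u + v).
Proof.
case=> u' lu -> [v' lv ->]; exists (u' + v'); first exact: latD.
by rewrite scalerDr.
Qed.
Lemma smallZ c u : reg sp c -> small u -> small (c *: u).
Proof.
move=> rc [u' lu ->]; exists (c *: u'); first exact: latZ.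
by rewrite !scalerA mulrC.
Qed.
Lemma small0 : small 0.
Proof.
exists 0; last by rewrite scaler0.
by move=> s; apply: reg0.
Qed.
Lemma small_op Z u : stable Z -> small u -> small (Z u).
Proof. by move=> sZ [u' lu ->]; exists (Z u'); [apply: sZ | rewrite latopZ]. Qed.
Fact diag_linear (r : nat) a : linear (fun (v : V) (s : nat -> nat) => a (s r) * v s : F^o).
Proof. by move=> c u v; apply/funext => s; rewrite /= mulrDr mulrCA. Qed.
Definition diag r a : T := Latop (diag_linear r a).

Definition bump (r : nat) (s : nat -> nat) := fun r' => (s r' + (r' == r))%N.
Fact shift_linear r : linear (fun (v : V) s => v (bump r s)).
Proof. by []. Qed.
Definition shift r : T := Latop (shift_linear r).

Lemma diagC r a r' a' : diag r a * diag r' a' = diag r' a' * diag r a.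
Proof. by apply: latopP => v; apply/funext => s; rewrite /= mulrCA. Qed.

Lemma diagM r a a' : diag r a * diag r a' = diag r (fun n => a n * a' n).
Proof. by apply: latopP => v; apply/funext => s; rewrite /= mulrA. Qed.

Lemma shift_diag r a : shift r * diag r a = diag r (fun n => a n.+1) * shift r.
Proof.
by apply: latopP => v; apply/funext => s; rewrite /= /bump eqxx addn1.
Qed.

Lemma shift_diagC r r' a : r' != r -> shift r * diag r' a = diag r' a * shift r.
Proof.
move=> nr; apply: latopP => v; apply/funext => s.
by rewrite /= /bump (negPf nr) addn0.
Qed.

Lemma shiftC r r' : shift r * shift r' = shift r' * shift r.
Proof.
apply: latopP => v; apply/funext => s; rewrite /= /bump; congr (v _).
by apply/funext => r''; rewrite addnAC.
Qed.

Lemma stable_diag r a : (forall n, reg sp (a n)) -> stable (diag r a).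
Proof. by move=> ra v lv s; apply: regM. Qed.

Lemma stable_shift r : stable (shift r).
Proof. by move=> v lv s; apply: lv. Qed.

Definition tau r := diag r (fun n => q ^+ n).
Definition tauV r := diag r (fun n => q^-1 ^+ n).

Lemma tauVK r : tauV r * tau r = 1.
Proof.
rewrite diagM; apply: latopP => v; apply/funext => s /=.
by rewrite -exprMn mulVf // expr1n mul1r.
Qed.
Lemma tauKV r : tau r * tauV r = 1.
Proof. by rewrite diagC tauVK. Qed.

Lemma shift_tau r : shift r * tau r = q *: (tau r * shift r).
Proof.
rewrite shift_diag; apply: latopP => v; apply/funext => s /=.
by rewrite exprS -mulrA.
Qed.
Lemma tauV_shift r : tauV r * shift r = q *: (shift r * tauV r).
Proof.
rewrite shift_diag; apply: latopP => v; apply/funext => s /=.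
rewrite -[RHS]/(q * (q^-1 ^+ (s r).+1 * v (bump r s))).
by rewrite exprS -mulrA [RHS]mulrA divff // mul1r.
Qed.

Lemma expr_sub1 (c : F) n : reg sp c -> exists2 e, reg sp e & c ^+ n - 1 = (c - 1) * e.
Proof.
move=> rc; rewrite subrX1; eexists; last by [].
by elim/big_ind: _ => [||i _]; [exact: reg0 | exact: regD | exact: regX].
Qed.

Lemma tau_small r v : lat v -> small (tau r v - v).
Proof.
move=> lv; have E n := expr_sub1 n (reg_q sp).
pose e n := s2val (cid2 (E n)).
have eP n : reg sp (e n) /\ q ^+ n - 1 = h * e n by rewrite /e; case: cid2.
exists (fun s => (e (s r) * v s : F^o)).
  by move=> s; apply: regM => //; case: (eP (s r)).
apply/funext => s.
have -> : (tau r v - v) s = (q ^+ s r - 1) * v s by rewrite mulrBl mul1r.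
by rewrite (eP (s r)).2 -mulrA.
Qed.

Lemma tauV_small r v : lat v -> small (tauV r v - v).
Proof.
move=> lv; have -> : tauV r v - v = - (tauV r (tau r v - v)).
  by rewrite latopD latopN -[tauV r (tau r v)]latop_mulE tauVK opprB.
rewrite -scaleN1r; apply: smallZ; first exact/regN/reg1.
apply: small_op; last exact: tau_small.
by apply: stable_diag => n; apply/regX/reg_qV.
Qed.

(** Commuting with the operators of the variables from [R] on replaces the
    statement that [Z] only involves the first [R] variables. *)
Definition local R Z := forall r, (R <= r)%N ->
  (forall a, Z * diag r a = diag r a * Z) /\ Z * shift r = shift r * Z.

(** Modulo [q - 1] the vector [f] is a common eigenvector of the entries of [x]
    with eigenvalues the entries of [P], and its value [1] at the origin shows
    that [f] is not a multiple of [q - 1]. *)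
Definition realizes k m (P : 'M[K]_(k, m)) R (x : 'I_k -> 'I_m -> T) (f : V) :=
  [/\ qmatrix q x,
      forall i j, local R (x i j) /\ stable (x i j),
      lat f /\ f (fun=> 0%N) = 1,
      forall r, (R <= r)%N -> shift r f = f
    & forall i j, small (x i j f - spec_cst sp (P i j) *: f)].

Definition realizable k m (P : 'M[K]_(k, m)) := exists R x f, realizes P R x f.

Lemma realizable_castL k k' m (P : 'M[K]_(k, m)) (g : 'I_k' -> 'I_k) :
  {homo g : i j / (i < j)%N} -> realizable P ->
  realizable (\matrix_(i, j) P (g i) j).
Proof.
move=> mg [R [x [f [qx lx lf sf vx]]]]; exists R, (fun i => x (g i)), f.
split=> // [|i j]; last by rewrite mxE.
apply: qmatrix_rows => [i j t|i s lis j t]; first exact: qm_row.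
have lgis : (g i < g s)%N by apply: mg.
split=> [|lt|lt]; first exact: qm_col.
  exact: (qm_comm qx).
exact: qm_cross.
Qed.

(** The nonzero entries lie on one diagonal.  Hence no two of them share a row or
    a column, the last term of the third kind of relation vanishes, and what
    remains holds because constants commute. *)
Lemma realizable_shift_id k m :
  realizable (\matrix_(i < k + m, j < m) (i == k + j :> nat)%:R).
Proof.
pose f : V := fun=> 1; set P := \matrix_(i, j) _.
exists 0%N, (fun i j => (spec_cst sp (P i j))%:A), f; split.
- have e0 i j (c : T) : (0 : K) = P i j -> (spec_cst sp (P i j))%:A * c = 0.
    by move=> <-; rewrite rmorph0 scale0r mul0r.
  have C (i s : 'I_(k + m)) (j t : 'I_m) :
      (spec_cst sp (P i j))%:A * (spec_cst sp (P s t))%:A = (spec_cst sp (P i j * P s t))%:A :> T.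
    by rewrite -scalerAl mul1r scalerA -rmorphM.
  apply: qmatrix_rows => [i j t ltj|i s lis j t]; last split=> [|lt|lt];
    rewrite !C.
  + have -> : P i t * P i j = 0.
      by rewrite !mxE; case: eqP; rewrite ?mul0r // mul1r; case: eqP => //; lia.
    have -> : P i j * P i t = 0.
      by rewrite !mxE; case: eqP; rewrite ?mul0r // mul1r; case: eqP => //; lia.
    by rewrite rmorph0 scale0r scaler0.
  + have -> : P s t * P i t = 0.
      by rewrite !mxE; case: eqP; rewrite ?mul0r // mul1r; case: eqP => //; lia.
    have -> : P i t * P s t = 0.
      by rewrite !mxE; case: eqP; rewrite ?mul0r // mul1r; case: eqP => //; lia.
    by rewrite rmorph0 scale0r scaler0.
  + by rewrite mulrC.
  + have -> : P i t * P s j = 0.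
      by rewrite !mxE; case: eqP; rewrite ?mul0r // mul1r; case: eqP => //; lia.
    by rewrite rmorph0 scale0r scaler0 addr0 mulrC.
- move=> i j; split.
    by move=> r _; split=> [a|]; rewrite mulr_algl mulr_algr.
  by move=> v lv s; apply: regM; first exact: reg_cst.
- by split=> // s; apply: reg1.
- by [].
- by move=> i j; rewrite latop_scaleE subrr; apply: small0.
Qed.

(** The variable [R] is used for the row operation with entries [tau R], [shift R]
    and [tauV R].  At [q = 1] the outer two become the identity, and the function
    [n |-> p ^+ n] of the new variable is an eigenvector of the shift with
    eigenvalue [p]. *)
Lemma realizable_row_op k m (P : 'M[K]_(k, m)) (i i' : 'I_k) p :
  i' = i.+1 :> nat -> realizable P ->
  realizable (\matrix_(r, j) (P r j + (p * P i' j) *+ (r == i))).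
Proof.
move=> ii' [R [x [f [qx lx [lf f1] sf vx]]]].
(* The new eigenvector is mu f. *)
pose mu := diag R (fun n => spec_cst sp p ^+ n).
have smu : stable mu by apply: stable_diag => n; apply/regX/reg_cst.
have stau : stable (tau R) by apply: stable_diag => n; apply/regX/reg_q.
have stauV : stable (tauV R) by apply: stable_diag => n; apply/regX/reg_qV.
have [lx1 lx2] : (forall i j a, x i j * diag R a = diag R a * x i j) /\
                 (forall i j, x i j * shift R = shift R * x i j).
  by split=> r j; case: (lx r j) => /(_ R (leqnn R))[].
have muf r j : small (x r j (mu f) - spec_cst sp (P r j) *: mu f).
  rewrite -latop_mulE lx1 latop_mulE -latopZ -latopN -latopD.
  exact: small_op.
have smuf : shift R (mu f) = spec_cst sp p *: mu f.
  rewrite -latop_mulE shift_diag latop_mulE sf //.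
  by apply/funext => s /=; rewrite exprS -mulrA.
exists R.+1, (fun r => if r == i then fun j => tau R * x i j + shift R * x i' j
                     else if r == i' then fun j => tauV R * x i' j else x r), (mu f).
split.
- apply: (qmatrix_step q0 ii' (tauVK R) (tauKV R) (shift_tau R) (tauV_shift R)) => //.
  by move=> r j; split; [rewrite (lx1 r j) | rewrite (lx1 r j) | rewrite (lx2 r j)].
- have loc r r' j : (R < r)%N ->
      [/\ (forall a, x r' j * diag r a = diag r a * x r' j),
          x r' j * shift r = shift r * x r' j & r != R].
    by move=> lr; have [/(_ r (ltnW lr))[h1 h2] _] := lx r' j; split; rewrite // gtn_eqF.
  have mcomm (u v w : T) : u * w = w * u -> v * w = w * v -> u * v * w = w * (u * v).
    by move=> e1 e2; rewrite -mulrA e2 mulrA e1 mulrA.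
  move=> r' j; split.
    move=> r lr; have [[x1 x2 nr] [y1 y2 _]] := (loc r i j lr, loc r i' j lr).
    have nr' : R != r by rewrite eq_sym.
    have [_|_] := eqVneq r' i.
      split=> [a|]; rewrite mulrDl mulrDr; congr (_ + _); apply: mcomm => //.
      - exact: diagC.
      - exact: shift_diagC.
      - by rewrite shift_diagC.
      - exact: shiftC.
    have [_|_] := eqVneq r' i'; last by have [] := loc r r' j lr.
    split=> [a|]; apply: mcomm => //; first exact: diagC.
    by rewrite shift_diagC.
  have sx r : stable (x r j) by case: (lx r j).
  have [_|_] := eqVneq r' i.
    move=> v lv; apply: latD; first exact/stau/sx.
    exact/stable_shift/sx.
  have [_|_ //] := eqVneq r' i'.
  by move=> v lv; apply/stauV/sx.
- by split; [exact: smu | rewrite /= expr0 mul1r].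
- move=> r lr; rewrite -latop_mulE shift_diagC ?latop_mulE ?sf ?(ltnW lr) //.
  by rewrite ltn_eqF.
- have tau_val Z : stable Z -> (forall v, lat v -> small (Z v - v)) ->
      forall r j, small ((Z * x r j) (mu f) - spec_cst sp (P r j) *: mu f).
    move=> sZ tZ r j.
    have -> : (Z * x r j) (mu f) - spec_cst sp (P r j) *: mu f =
              Z (x r j (mu f) - spec_cst sp (P r j) *: mu f) +
              spec_cst sp (P r j) *: (Z (mu f) - mu f).
      by rewrite latop_mulE latopD latopN latopZ scalerBr addrA addrNK.
    apply: smallD; first exact: small_op.
    by apply: smallZ; [exact: reg_cst | apply/tZ/smu].
  move=> r j; rewrite mxE; have [->|_] := eqVneq r i.
    rewrite mulr1n rmorphD rmorphM scalerDl latop_addE opprD addrACA.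
    apply: smallD; first by apply: tau_val => // v; apply: tau_small.
    have -> : (shift R * x i' j) (mu f) - (spec_cst sp p * spec_cst sp (P i' j)) *: mu f =
              shift R (x i' j (mu f) - spec_cst sp (P i' j) *: mu f).
      by rewrite latopD latopN latopZ smuf scalerA [_ * spec_cst sp p]mulrC.
    by apply: small_op => //; apply: stable_shift.
  rewrite mulr0n addr0; have [->|_ //] := eqVneq r i'.
  by apply: tau_val => // v; apply: tauV_small.
Qed.
End Realization.

(** * Every matrix of scalars is a specialization *)

Section AllRealizable.
Context {K F : fieldType} {q : F} (sp : specialization K q).

Definition preserves_realizable n m (g : 'M[K]_n) :=
  forall P : 'M[K]_(n, m), realizable sp P -> realizable sp (g *m P).

Lemma preservesM n m (g g' : 'M[K]_n) : preserves_realizable m g ->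
  preserves_realizable m g' -> preserves_realizable m (g *m g').
Proof. by move=> pg pg' P rP; rewrite -mulmxA; apply/pg/pg'. Qed.

Lemma preserves_adjacent n m (i j : 'I_n) p : j = i.+1 :> nat ->
  preserves_realizable m (1%:M + p *: delta_mx i j).
Proof.
move=> eij P /(realizable_row_op p eij); congr (realizable _ _).
apply/matrixP => r s; rewrite mulmxDl mul1mx -scalemxAl !mxE; congr (_ + _).
rewrite (bigD1 j) //= !mxE eqxx andbT big1 ?addr0; last first.
  by move=> l nlj; rewrite !mxE (negPf nlj) andbF mul0r.
by case: eqP => _; rewrite ?mul1r ?mul0r ?mulr1n ?mulr0n ?mulr0.
Qed.

(** Transvections of rows far apart are commutators of closer ones. *)
Lemma transvection_commutator n (i j l : 'I_n) (p : K) : i != j -> j != l -> i != l ->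
  1%:M + p *: delta_mx i l =
  (1%:M + p *: delta_mx i j) *m (1%:M + 1 *: delta_mx j l)
    *m ((1%:M + (- p) *: delta_mx i j) *m (1%:M + (- 1) *: delta_mx j l)) :> 'M_n.
Proof.
move=> nij njl nil; rewrite scale1r !scaleNr scale1r.
set u := p *: delta_mx i j; set v := delta_mx j l.
have uv : u *m v = p *: delta_mx i l by rewrite -scalemxAl mul_delta_mx.
have uu : u *m u = 0.
  by rewrite -scalemxAl -scalemxAr mul_delta_mx_0 ?scaler0 // eq_sym.
have vv : v *m v = 0 by rewrite mul_delta_mx_0 // eq_sym.
have vu : v *m u = 0 by rewrite -scalemxAr mul_delta_mx_0 ?scaler0 // eq_sym.
rewrite -uv mulmxA -[_ *m (1%:M - u)]mulmxA.
have -> : (1%:M + v) *m (1%:M - u) = 1%:M - u + v.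
  by rewrite mulmxDl mul1mx mulmxDr mulmx1 mulmxN vu subr0.
have -> : (1%:M + u) *m (1%:M - u + v) = 1%:M + v + u *m v.
  rewrite mulmxDl mul1mx !mulmxDr mulmx1 mulmxN uu subr0.
  by rewrite addrA; congr (_ + _); rewrite addrAC subrK.
by rewrite !mulmxDl mul1mx !mulmxDr !mulmxN !mulmx1 vv -mulmxA vv mulmx0 !subr0 subrK.
Qed.

Lemma preserves_transvection n m (i j : 'I_n) p : (i < j)%N ->
  preserves_realizable m (1%:M + p *: delta_mx i j).
Proof.
elim: {j}_.+1 {-2}j p (ltnSn j) => // d IH j p ljd lij.
have [eij|nij] := eqVneq (i.+1) j; first exact: preserves_adjacent.
have lj : (j.-1 < n)%N by apply: leq_ltn_trans (leq_pred _) _.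
pose j' := Ordinal lj.
have lij' : (i < j')%N by rewrite /=; lia.
have ejj' : j = j'.+1 :> nat by rewrite /=; lia.
rewrite (@transvection_commutator _ i j' j) -?(inj_eq val_inj) /=; try lia.
apply: preservesM; apply: preservesM; try exact: preserves_adjacent.
  by apply: IH => //=; lia.
by apply: IH => //=; lia.
Qed.

Lemma preserves_block k m (M : 'M[K]_(k, m)) :
  preserves_realizable m (block_mx 1%:M M 0 1%:M).
Proof.
pose pr (M : 'M[K]_(k, m)) := preserves_realizable m (block_mx 1%:M M 0 1%:M).
rewrite -/(pr M).
have pr0 : pr 0.
  move=> P rP; rewrite (_ : block_mx _ _ _ _ = 1%:M) ?mul1mx //.
  by rewrite -scalar_mx_block.
have prD A B : pr A -> pr B -> pr (A + B).
  move=> pA pB; rewrite /pr.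
  have -> : block_mx 1%:M (A + B) 0 1%:M =
            block_mx 1%:M A 0 1%:M *m block_mx 1%:M B 0 1%:M.
    by rewrite mulmx_block !mul1mx !mulmx1 !mul0mx !mulmx0 !addr0 !add0r addrC.
  exact: preservesM.
rewrite (matrix_sum_delta M).
elim/big_ind: _ => // i _; elim/big_ind: _ => // j _.
rewrite /pr.
have -> : block_mx 1%:M (M i j *: delta_mx i j) 0 1%:M =
          1%:M + M i j *: delta_mx (lshift m i) (rshift k j).
  rewrite scalar_mx_block; apply/matrixP => r s; rewrite [RHS]mxE.
  by case: (split_ordP r) => r' ->; case: (split_ordP s) => s' ->;
    rewrite ?(block_mxEul, block_mxEur, block_mxEdl, block_mxEdr) !mxE
      ?(inj_eq (@lshift_inj _ _), inj_eq (@rshift_inj _ _)) ?eq_lrshift ?eq_rlshift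
      ?andbF ?mulr0 ?addr0 ?add0r.
apply: preserves_transvection => /=.
exact: leq_trans (ltn_ord i) (leq_addr _ _).
Qed.

(** The block matrix with rows [P] and [1%:M] arises from the one with rows [0]
    and [1%:M] by adding multiples of later rows to earlier ones, which is all
    that the row operations allow; then keep the first [k] rows. *)
Lemma all_realizable k m (P : 'M[K]_(k, m)) : realizable sp P.
Proof.
have r0 : realizable sp (col_mx 0 1%:M : 'M[K]_(k + m, m)).
  have := realizable_shift_id sp k m; congr (realizable _ _).
  apply/matrixP => r j; rewrite !mxE; case: splitP => i ->; rewrite !mxE.
    by case: eqP => // e; have := ltn_ord i; rewrite e; lia.
  by rewrite eqn_add2l (inj_eq val_inj).
have /(realizable_castL (g := @lshift k m)) := preserves_block P r0.
rewrite mul_block_col !mul1mx !mul0mx mulmx1 add0r.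
move=> /(_ (fun i j => id)); congr (realizable _ _).
by apply/matrixP => i j; rewrite mxE col_mxEu.
Qed.
End AllRealizable.

(** * The Poisson bracket at a point *)

Section Bracket.
Context {K F : fieldType} {q : F} (sp : specialization K q).
Local Notation V := (latfun F).
Local Notation T := (latop F).
Local Notation h := (q - 1).
Implicit Types (X Y Z : T).

Let q0 : q != 0 := spec_q0 sp.
Let h0 : h != 0. Proof. by rewrite subr_eq0 (spec_q1 sp). Qed.

(** [c] takes the value [c0] at [q = 1]. *)
Definition residue (c : F) (c0 : K) := exists2 e, reg sp e & c = spec_cst sp c0 + h * e.

Lemma residue_reg c c0 : residue c c0 -> reg sp c.
Proof.
case=> e re ->; apply: regD; first exact: reg_cst.
apply: regM => //; apply: regD; first exact: reg_q.
exact/regN/reg1.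
Qed.

Lemma residue_cst c0 : residue (spec_cst sp c0) c0.
Proof. by exists 0; rewrite ?mulr0 ?addr0 //; apply: reg0. Qed.
Lemma residue1 : residue 1 1.
Proof. by have := residue_cst 1; rewrite rmorph1. Qed.
Lemma residueD c d c0 d0 : residue c c0 -> residue d d0 -> residue (c + d) (c0 + d0).
Proof.
case=> e re -> [e' re' ->]; exists (e + e'); first exact: regD.
by rewrite rmorphD; ring.
Qed.
Lemma residueM c d c0 d0 : residue c c0 -> residue d d0 -> residue (c * d) (c0 * d0).
Proof.
move=> [e re ->] [e' re' ->]; exists (spec_cst sp c0 * e' + e * spec_cst sp d0 + h * e * e').
  have rh : reg sp h by apply: regD; [exact: reg_q | exact/regN/reg1].
  by repeat (apply: regD || apply: regM) => //; apply: reg_cst.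
by rewrite rmorphM; ring.
Qed.
Lemma residueN c c0 : residue c c0 -> residue (- c) (- c0).
Proof.
move=> rc; rewrite -[- c]mulN1r -[- c0]mulN1r; apply: residueM => //.
by have := residue_cst (- 1); rewrite rmorphN1.
Qed.
Lemma residueX c c0 n : residue c c0 -> residue (c ^+ n) (c0 ^+ n).
Proof.
by move=> rc; elim: n => [|n IH]; [exact: residue1 | rewrite !exprS; apply: residueM].
Qed.
Lemma residue_q : residue q 1.
Proof. by exists 1; [exact: reg1 | rewrite rmorph1; ring]. Qed.
Lemma residue_qV : residue q^-1 1.
Proof.
exists (- q^-1); first exact/regN/reg_qV.
by rewrite rmorph1; field.
Qed.

(** The quotient of [q ^ c - 1] by [q - 1] is the quantum integer [c]. *)
Lemma residue_expq c : exists2 e, residue e c%:~R & q ^ c - 1 = h * e.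
Proof.
have pos (n : nat) : exists2 e, residue e n%:R & q ^+ n - 1 = h * e.
  elim: n => [|n [e re E]].
    exists 0; last by rewrite mulr0 expr0 subrr.
    by have := residue_cst 0; rewrite rmorph0.
  exists (q * e + 1).
    rewrite -[n.+1%:R]/(n.+1%:R : K) -addn1 natrD; apply: residueD; last exact: residue1.
    by rewrite -[n%:R]mul1r; apply: residueM => //; apply: residue_q.
  by rewrite mulrDr mulrCA -E exprS; ring.
case: c => n; first exact: pos.
have [e re E] := pos n.+1; exists (- (q^-1 ^+ n.+1 * e)).
  rewrite NegzE mulrNz; apply: residueN.
  rewrite -[n.+1%:~R]mul1r; apply: residueM => //.
  by rewrite -(expr1n _ n.+1); apply: residueX; apply: residue_qV.
rewrite mulrN mulrCA -E NegzE -exprnN -exprVn mulrBr -exprMn mulVf //.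
by rewrite expr1n mulr1 opprB.
Qed.

Context {k m : nat} (P : 'M[K]_(k, m)) (R : nat) (x : 'I_k -> 'I_m -> T) (f : V).
Hypothesis rP : realizes sp P R x f.

(** [z] is the value of the operator [Z] at the point of the realization. *)
Definition opval Z (z : K) := stable sp Z /\ small sp (Z f - spec_cst sp z *: f).

Lemma opval_gen i j : opval (x i j) (P i j).
Proof. by case: rP => _ /(_ i j)[_ sx] _ _ /(_ i j). Qed.

Lemma opval_uniq Z z z' : opval Z z -> opval Z z' -> z = z'.
Proof.
have [_ _ [_ f1] _ _] := rP; move=> [_ s1] [_ s2]; apply/eqP; rewrite -subr_eq0; apply/eqP.
have [w lw] : small sp (spec_cst sp (z - z') *: f).
  have -> : spec_cst sp (z - z') *: f =
      (Z f - spec_cst sp z' *: f) + (- 1) *: (Z f - spec_cst sp z *: f).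
    by rewrite scaleN1r opprB rmorphB scalerBl [RHS]addrC addrA subrK.
  by apply: smallD => //; apply: smallZ => //; apply/regN/reg1.
move=> /(congr1 (fun v : V => v (fun=> 0%N))) E; apply: (reg_proper (lw (fun=> 0%N))).
by rewrite -[RHS]E -[RHS]/(_ * f _) f1 mulr1.
Qed.

Lemma opval1 : opval 1 1.
Proof. by split=> //; rewrite rmorph1 scale1r subrr; apply: small0. Qed.

Lemma opvalD Z Z' z z' : opval Z z -> opval Z' z' -> opval (Z + Z') (z + z').
Proof.
move=> [sZ vZ] [sZ' vZ']; split; first by move=> v lv; apply: latD; [apply: sZ|apply: sZ'].
by rewrite latop_addE rmorphD scalerDl opprD addrACA; apply: smallD.
Qed.

Lemma opvalM Z Z' z z' : opval Z z -> opval Z' z' -> opval (Z * Z') (z * z').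
Proof.
move=> [sZ vZ] [sZ' vZ']; split; first by move=> v lv; apply/sZ/sZ'.
have -> : (Z * Z') f - spec_cst sp (z * z') *: f =
   Z (Z' f - spec_cst sp z' *: f) + spec_cst sp z' *: (Z f - spec_cst sp z *: f).
  rewrite latop_mulE latopD latopN latopZ scalerBr addrA subrK scalerA.
  by rewrite rmorphM mulrC.
apply: smallD; first exact: small_op.
by apply: smallZ => //; apply: reg_cst.
Qed.

Lemma opvalZ c c0 Z z : residue c c0 -> opval Z z -> opval (c *: Z) (c0 * z).
Proof.
move=> rc [sZ vZ]; split.
  by move=> v lv; apply: latZ; [apply: residue_reg rc | apply: sZ].
have [_ _ [lf _] _ _] := rP; case: rc (residue_reg rc) => e re -> rce.
have -> : ((spec_cst sp c0 + h * e) *: Z) f - spec_cst sp (c0 * z) *: f =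
   spec_cst sp c0 *: (Z f - spec_cst sp z *: f) + h *: (e *: Z f).
  by rewrite latop_scaleE scalerDl scalerBr !scalerA -rmorphM addrAC.
apply: smallD; first by apply: smallZ => //; apply: reg_cst.
by exists (e *: Z f) => //; apply: latZ => //; apply: sZ.
Qed.

Lemma opval0 : opval 0 0.
Proof.
have -> : (0 : T) = 0 *: 1 by rewrite scale0r.
have -> : (0 : K) = 0 * 1 by rewrite mul0r.
by apply: opvalZ opval1; have := residue_cst 0; rewrite rmorph0.
Qed.

Lemma opval_sum (I : finType) (Z : I -> T) (z : I -> K) :
  (forall i, opval (Z i) (z i)) -> opval (\sum_i Z i) (\sum_i z i).
Proof.
move=> vZ; elim/big_ind2: _ => [||i _]; first exact: opval0; last exact: vZ.
by move=> *; apply: opvalD.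
Qed.

Lemma opval_prod n (Z : 'I_n -> T) (z : 'I_n -> K) :
  (forall i, opval (Z i) (z i)) -> opval (\prod_i Z i) (\prod_i z i).
Proof.
move=> vZ; elim/big_ind2: _ => [||i _]; first exact: opval1; last exact: vZ.
by move=> *; apply: opvalM.
Qed.

(** [b] is the value of the commutator divided by [q - 1], that is, of the
    Poisson bracket at the point. *)
Definition bracket Y X b := exists2 W, opval W b & Y * X - X * Y = h *: W.

Lemma bracket_uniq Y X b b' : bracket Y X b -> bracket Y X b' -> b = b'.
Proof.
case=> W vW e1 [W' vW']; rewrite e1 => /(scalerI h0) e; apply: opval_uniq vW _.
by rewrite e.
Qed.

Lemma bracketC Y X b : bracket Y X b -> bracket X Y (- b).
Proof.
case=> W vW e; exists (- 1 *: W).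
  rewrite -[- b]mulN1r; apply: opvalZ => //.
  by have := residue_cst (- 1); rewrite rmorphN1.
by rewrite scaleN1r scalerN -e opprB.
Qed.

Lemma bracket1 Y : bracket Y 1 0.
Proof. by exists 0; rewrite ?mulr1 ?mul1r ?subrr ?scaler0 //; apply: opval0. Qed.

Lemma bracket0 Y : bracket Y 0 0.
Proof. by exists 0; rewrite ?mulr0 ?mul0r ?subrr ?scaler0 //; apply: opval0. Qed.

Lemma bracketD Y X X' b b' : bracket Y X b -> bracket Y X' b' ->
  bracket Y (X + X') (b + b').
Proof.
case=> W vW e [W' vW' e']; exists (W + W'); first exact: opvalD.
by rewrite mulrDl mulrDr scalerDr -e -e' opprD addrACA.
Qed.

Lemma bracketZ Y X c c0 b : residue c c0 -> bracket Y X b -> bracket Y (c *: X) (c0 * b).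
Proof.
move=> rc [W vW e]; exists (c *: W); first exact: opvalZ.
by rewrite -scalerAl -scalerAr -scalerBr e !scalerA mulrC.
Qed.

Lemma bracketM Y X X' b b' z z' : opval X z -> opval X' z' ->
  bracket Y X b -> bracket Y X' b' -> bracket Y (X * X') (b * z' + z * b').
Proof.
move=> vX vX' [W vW e] [W' vW' e']; exists (W * X' + X * W').
  by apply: opvalD; apply: opvalM.
rewrite scalerDr scalerAl scalerAr -e -e' mulrBl mulrBr !mulrA addrA.
by rewrite subrK.
Qed.

Lemma bracket_sum (I : finType) Y (X : I -> T) (b : I -> K) :
  (forall i, bracket Y (X i) (b i)) -> bracket Y (\sum_i X i) (\sum_i b i).
Proof.
move=> vZ; elim/big_ind2: _ => [||i _]; first exact: bracket0; last exact: vZ.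
by move=> *; apply: bracketD.
Qed.

Lemma bracket_prod n Y (X : 'I_n -> T) (z b : 'I_n -> K) :
  (forall i, opval (X i) (z i)) -> (forall i, bracket Y (X i) (b i)) ->
  bracket Y (\prod_i X i) (\sum_i b i * \prod_(j | j != i) z j).
Proof.
elim: n X z b => [|n IH] X z b vX bX; first by rewrite !big_ord0; apply: bracket1.
have := bracketM (vX ord0) (opval_prod (fun i => vX (lift ord0 i))) (bX ord0)
  (IH _ _ _ (fun i => vX (lift ord0 i)) (fun i => bX (lift ord0 i))).
rewrite big_ord_recl; congr (bracket _ _ _).
rewrite big_ord_recl; congr (_ + _).
  by congr (_ * _); rewrite [RHS]big_mkcond [RHS]big_ord_recl eqxx /= mul1r.
rewrite mulr_sumr; apply: eq_bigr => i _; rewrite mulrCA; congr (_ * _).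
rewrite [RHS]big_mkcond [RHS]big_ord_recl /= [in LHS]big_mkcond; congr (_ * _).
Qed.

(** The relations at first order in [q - 1].  They are written for [s >= i] and,
    when [s = i], for [t >= j]; antisymmetry gives the other half. *)
Lemma bracket_gen (s i : 'I_k) (t j : 'I_m) :
  bracket (x s t) (x i j)
    (((s > i)%N%:R - (s < i)%N%:R + ((t > j)%N%:R - (t < j)%N%:R)) *
       (P i t * P s j)).
Proof.
have [qx _ _ _ _] := rP.
have vq c c0 i' j' s' t' : residue c c0 ->
    opval (c *: (x i' j' * x s' t')) (c0 * (P i' j' * P s' t')).
  by move=> rc; apply: opvalZ => //; apply: opvalM; apply: opval_gen.
have gen_le (s' i' : 'I_k) (t' j' : 'I_m) :
   (i' < s')%N || (i' == s') && (j' <= t')%N ->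
   bracket (x s' t') (x i' j')
    (((s' > i')%N%:R - (s' < i')%N%:R + ((t' > j')%N%:R - (t' < j')%N%:R)) *
       (P i' t' * P s' j')).
  case: (ltngtP i' s') => [lis _|lsi /andP[/eqP e _]|/val_inj <-] /=;
    first last.
  - rewrite eqxx leq_eqVlt => /predU1P[/val_inj ->|ltj].
      rewrite !ltnn !subrr addr0 mul0r; exists 0; first exact: opval0.
      by rewrite subrr scaler0.
    rewrite ltj ltnNge ltnW //= subrr subr0 add0r.
    exists (1 *: (x i' j' * x i' t')).
      by rewrite [P i' t' * _]mulrC; apply: vq; apply: residue1.
    by rewrite (qm_row _ qx ltj) scale1r scalerBl scale1r.
  - by rewrite e ltnn in lsi.
  case: (ltngtP j' t') => [ltj|ltj|/val_inj ->].
  - rewrite !subr0; exists ((1 + q^-1) *: (x i' t' * x s' j')).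
      by apply: vq; apply: residueD; [exact: residue1 | exact: residue_qV].
    rewrite (qm_cross qx lis ltj) addrC addKr scalerA; congr (_ *: _).
    by field.
  - rewrite subr0 sub0r subrr mul0r; exists 0; first exact: opval0.
    by rewrite (qm_comm qx lis ltj) subrr scaler0.
  - rewrite !subr0 addr0; exists (1 *: (x i' t' * x s' t')).
      by apply: vq; apply: residue1.
    by rewrite (qm_col _ qx lis) scale1r scalerBl scale1r.
case: (boolP ((i < s)%N || (i == s) && (j <= t)%N)) => [/gen_le//|].
rewrite negb_or -leqNgt negb_and -ltnNge => /andP[lsi ltj].
have /gen_le/bracketC : (s < i)%N || (s == i) && (t <= j)%N.
  move: lsi; rewrite leq_eqVlt => /predU1P[/val_inj e|->//].
  by move: ltj; rewrite e eqxx ltnn /= => /ltnW.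
congr (bracket _ _ _); rewrite -mulNr [P s j * _]mulrC; congr (_ * _).
by ring.
Qed.

End Bracket.

(** * The bracket of two minors *)

Lemma qmat_eval_qminor (F : fieldType) (q : F) k m (T : algType F)
  (x : 'I_k -> 'I_m -> T) (xP : qmatrix q x) (I : {set 'I_k}) (J : {set 'I_m})
  (eIJ : #|I| = #|J|) :
  qmat_eval x (qminor (q := q) eIJ) =
  \sum_(s : 'S_#|I|) (- q) ^ (- (perm_length s)%:Z) *:
    \prod_(a < #|I|) x (enum_val a) (enum_val (cast_ord eIJ (s a))).
Proof.
have e0 : qmat_eval x (0 : qmat q k m) = 0.
  by apply: (addrI (qmat_eval x (0 : qmat q k m))); rewrite -qmat_evalD ?addr0.
rewrite /qminor (big_morph (qmat_eval x) (qmat_evalD xP) e0).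
apply: eq_bigr => s _; rewrite qmat_evalZ //; congr (_ *: _).
rewrite (big_morph (qmat_eval x) (qmat_evalM xP) (qmat_eval1 xP)).
by apply: eq_bigr => a _; rewrite qmat_eval_qx.
Qed.

Section MinorValues.
Context {K F : fieldType} {q : F} (sp : specialization K q).
Context {k m : nat} (P : 'M[K]_(k, m)) (R : nat) (x : 'I_k -> 'I_m -> latop F)
  (f : latfun F).
Hypothesis rP : realizes sp P R x f.

Let xP : qmatrix q x. Proof. by case: rP. Qed.

(** Between [I] and the image of [M] the matrix [P] is a permutation matrix, so
    that only one monomial of the minor does not vanish at [P]. *)
Definition matches (I : {set 'I_k}) (J : {set 'I_m}) (M : 'I_k -> 'I_m) :=
  (forall i, i \in I -> M i \in J) /\
  {in I &, forall i i', P i (M i') = (i == i')%:R}.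

(** The coefficient [(- q)^(-length)] at [q = 1]. *)
Definition minor_sign l (s : 'S_l) : K := (- 1) ^+ perm_length s.

Lemma minor_sign_neq0 l (s : 'S_l) : minor_sign s != 0.
Proof. by rewrite /minor_sign signr_eq0. Qed.

Lemma residue_sign l (s : 'S_l) :
  residue sp ((- q) ^ (- (perm_length s)%:Z)) (minor_sign s).
Proof.
rewrite -exprnN -exprVn; apply: residueX; rewrite invrN.
exact/residueN/residue_qV.
Qed.

Section Matched.
Context (I : {set 'I_k}) (J : {set 'I_m}) (eIJ : #|I| = #|J|) (M : 'I_k -> 'I_m).
Hypothesis mM : matches I J M.

Let col (a : 'I_#|I|) : 'I_m := enum_val (cast_ord eIJ a).

Lemma matches_perm : exists p : 'S_#|I|,
  forall a, col (p a) = M (enum_val a).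
Proof.
case: mM => MJ MP.
have MJ' (a : 'I_#|I|) : M (enum_val a) \in J by apply/MJ/enum_valP.
pose g (a : 'I_#|I|) := cast_ord (esym eIJ) (enum_rank_in (MJ' a) (M (enum_val a))).
have gE a : col (g a) = M (enum_val a).
  by rewrite /col /g cast_ordKV enum_rankK_in ?MJ'.
have g_inj : injective g.
  move=> a b /(congr1 col); rewrite !gE => e; apply: enum_val_inj; apply/eqP.
  have := MP _ _ (enum_valP a) (enum_valP b); rewrite -e MP ?enum_valP // eqxx.
  by case: eqP => // _ /eqP; rewrite oner_eq0.
by exists (perm g_inj) => a; rewrite permE gE.
Qed.

Context (p : 'S_#|I|).
Hypothesis pM : forall a, col (p a) = M (enum_val a).

Lemma matched_entry (a b : 'I_#|I|) : P (enum_val a) (col b) = (b == p a)%:R.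
Proof.
case: mM => MJ MP; rewrite -(permKV p b) pM MP ?enum_valP //.
by rewrite (inj_eq enum_val_inj) (inj_eq perm_inj) eq_sym.
Qed.

Lemma opval_minor : opval sp f (qmat_eval x (qminor (q := q) eIJ)) (minor_sign p).
Proof.
rewrite qmat_eval_qminor //.
have -> : minor_sign p = \sum_(s : 'S_#|I|) minor_sign s *
    \prod_a P (enum_val a) (col (s a)).
  rewrite (bigD1 p) //= big1 => [|a _]; last by rewrite matched_entry eqxx.
  rewrite mulr1 big1 ?addr0 // => s nsp.
  have [a nsa] : exists a, s a != p a.
    apply/existsP; rewrite -negb_forall; apply: contra nsp => /forallP spE.
    by apply/eqP/permP => a; apply/eqP.
  by rewrite (bigD1 a) //= matched_entry (negPf nsa) mul0r mulr0.
apply: (opval_sum rP) => s.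
apply: (opvalZ rP); first exact: residue_sign.
by apply: opval_prod => a; apply: opval_gen rP _ _.
Qed.

(** A monomial other than the matched one has at least two factors that vanish
    at [P], hence contributes nothing to the derivative either. *)
Lemma bracket_minor Y (b : 'I_k -> 'I_m -> K) :
  (forall i j, bracket sp f Y (x i j) (b i j)) ->
  bracket sp f Y (qmat_eval x (qminor (q := q) eIJ))
    (minor_sign p * \sum_(i in I) b i (M i)).
Proof.
move=> bY; rewrite qmat_eval_qminor //.
have -> : minor_sign p * (\sum_(i in I) b i (M i)) =
  \sum_(s : 'S_#|I|) minor_sign s * \sum_(a < #|I|) b (enum_val a) (col (s a)) *
    \prod_(c | c != a) P (enum_val c) (col (s c)).
  rewrite (bigD1 p) //= big_enum_val [X in _ + X]big1 ?addr0 => [|s nsp].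
    congr (_ * _); apply: eq_bigr => a _; rewrite pM big1 ?mulr1 // => c _.
    by rewrite matched_entry eqxx.
  rewrite big1 ?mulr0 // => a _.
  (* Two permutations that agree except at a agree. *)
  have [c nca nsc] : exists2 c, c != a & s c != p c.
    have : ~~ [forall (c | c != a), s c == p c].
      apply: contra nsp => /forall_inP spE; apply/eqP/permP => c.
      have [->|nca] := eqVneq c a; last exact/eqP/spE.
      pose d := (p^-1)%g (s a); have pd : p d = s a by rewrite permKV.
      have [da|nda] := eqVneq d a; first by rewrite -pd da.
      by have /eqP := spE d nda; rewrite pd => /perm_inj; move: nda => /eqP.
    by rewrite negb_forall_in => /exists_inP[c nca nsc]; exists c.
  by rewrite (bigD1 c) //= matched_entry (negPf nsc) mul0r mulr0.
apply: (bracket_sum rP) => s.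
apply: (bracketZ rP); first exact: residue_sign.
by apply: (bracket_prod rP) => a //; apply: opval_gen rP _ _.
Qed.

End Matched.
End MinorValues.

Section QuasiCommutation.
Context {K F : fieldType} {q : F} (sp : specialization K q) {k m : nat}.

(** The bracket of [x s t] with [x i j] at the point [P]. *)
Definition pair_weight (P : 'M[K]_(k, m)) (s i : 'I_k) (t j : 'I_m) : K :=
  ((s > i)%N%:R - (s < i)%N%:R + ((t > j)%N%:R - (t < j)%N%:R)) *
    (P i t * P s j).

(** The bracket of the two minors, computed once from the relations of the
    generators by the Leibniz rule in both arguments and once from the
    quasi-commutation, divided by their values at [P]. *)
Theorem quasi_commute_weight (I I' : {set 'I_k}) (J J' : {set 'I_m})
    (eIJ : #|I| = #|J|) (eIJ' : #|I'| = #|J'|) :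
  quasi_commute (qminor (q := q) eIJ) (qminor eIJ') ->
  exists c : int, forall (P : 'M[K]_(k, m)) (M M' : 'I_k -> 'I_m),
    matches P I J M -> matches P I' J' M' ->
    \sum_(s in I') \sum_(i in I) pair_weight P s i (M' s) (M i) = c%:~R.
Proof.
case=> c qc; exists c => P M M' mM mM'.
have [R [x [f rP]]] := all_realizable sp P.
have xP : qmatrix q x by case: rP.
have [p pM] := matches_perm eIJ mM; have [p' pM'] := matches_perm eIJ' mM'.
have vX := opval_minor rP mM pM; have vY := opval_minor rP mM' pM'.
set X := qmat_eval x (qminor (q := q) eIJ) in vX; set Y := qmat_eval x (qminor (q := q) eIJ') in vY.
have bgen i j : bracket sp f Y (x i j)
    (minor_sign (K := K) p' * \sum_(s in I') pair_weight P s i (M' s) j).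
  rewrite -[X in bracket _ _ _ _ X]opprK; apply: (bracketC rP); rewrite -mulrN -sumrN.
  apply: (bracket_minor rP mM' pM' (b := fun s t => - pair_weight P s i t j)) => s t.
  by apply: (bracketC rP); apply: (bracket_gen rP s i t j).
have b1 := bracket_minor rP mM pM bgen.
have b2 : bracket sp f Y X (c%:~R * (minor_sign (K := K) p * minor_sign (K := K) p')).
  have [e re Ee] := residue_expq sp c.
  exists (e *: (X * Y)); first by apply: (opvalZ rP) => //; apply: opvalM.
  have /(congr1 (qmat_eval x)) := qc.
  rewrite qmat_evalZ // !qmat_evalM // -/X -/Y => ->.
  by rewrite -[X in _ - X]scale1r -scalerBl Ee scalerA.
have := bracket_uniq rP b1 b2.
rewrite -mulr_sumr exchange_big /= mulrA mulrC => /(mulIf _); apply.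
by rewrite mulf_neq0 ?minor_sign_neq0.
Qed.

End QuasiCommutation.

(** * Counting noncrossing families of sets *)

Section NoncrossingFamilies.
Local Open Scope nat_scope.
Context {n : nat}.
Implicit Types (A B I J : {set 'I_n}) (C : {set {set 'I_n}}).

Definition crossing A B := exists a b c d : 'I_n,
  [/\ a < b, b < c & c < d] /\
  [/\ a \in A :\: B, b \in B :\: A, c \in A :\: B & d \in B :\: A].

Definition prefix A N := [set i in A | i < N].

Lemma prefixP A N (i : 'I_n) : i < N -> (i \in prefix A N) = (i \in A).
Proof. by move=> lt; rewrite inE lt andbT. Qed.

Lemma card_prefix_suffix A N :
  #|A| = #|prefix A N| + #|[set i in A | N <= i]|.
Proof.
rewrite -cardsUI (_ : _ :&: _ = set0) ?cards0 ?addn0; last first.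
  by apply/setP => i; rewrite !inE; case: ltnP; rewrite ?andbF.
by congr #|pred_of_set _|; apply/setP => i; rewrite !inE -andb_orr; case: ltnP; rewrite andbT.
Qed.

Lemma card_suffix N : #|[set i : 'I_n | N <= i]| = n - N.
Proof.
by rewrite -sum1dep_card -(big_geq_mkord _ _ predT (fun=> 1)) sum_nat_const_nat muln1.
Qed.

Lemma card_prefix A N : N <= n -> #|prefix A N| <= N.
Proof.
move=> leNn; apply: (@leq_trans #|prefix setT N|).
  by apply: subset_leq_card; apply/subsetP => i; rewrite !inE => /andP[_ ->].
have := card_prefix_suffix setT N; rewrite cardsT card_ord.
have -> : [set i in [set: 'I_n] | N <= i] = [set i : 'I_n | N <= i].
  by apply/setP => i; rewrite !inE.
by rewrite card_suffix; lia.
Qed.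

(** The common prefixes at which the family splits: [N] is added to some members
    and not to others.  In the binary tree of all prefixes these are the nodes
    with two children. *)
Definition branching C (N : 'I_n) := [set I in [set prefix A N | A in C] |
  [exists A in C, (prefix A N == I) && (N \notin A)] &&
  [exists A in C, (prefix A N == I) && (N \in A)]].

Lemma card_prefixes_succ C (N : 'I_n) :
  #|[set prefix A N.+1 | A in C]| =
  #|[set prefix A N | A in C]| + #|branching C N|.
Proof.
set X := [set prefix A N.+1 | A in [set A in C | N \notin A]].
set Y := [set prefix A N.+1 | A in [set A in C | N \in A]].
set X' := [set prefix A N | A in [set A in C | N \notin A]].
set Y' := [set prefix A N | A in [set A in C | N \in A]].
have prefS A i : i \in prefix A N.+1 = (i \in prefix A N) || (i == N) && (N \in A).
  rewrite !inE ltnS leq_eqVlt (inj_eq val_inj).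
  by case: eqP => [->|_]; rewrite ?ltnn ?andbF ?andbT ?orbF.
have eX : X = X'.
  apply: eq_in_imset => A; rewrite inE => /andP[_ nNA].
  by apply/setP => i; rewrite prefS (negPf nNA) andbF orbF.
have eY : #|Y| = #|Y'|.
  have -> : Y = [set N |: I | I in Y'].
    rewrite -imset_comp; apply: eq_in_imset => A; rewrite inE => /andP[_ NA] /=.
    by apply/setP => i; rewrite prefS NA andbT in_setU1 orbC.
  rewrite card_in_imset // => _ _ /imsetP[A _ ->] /imsetP[B _ ->] /setP e.
  apply/setP => i; have := e i; rewrite !in_setU1.
  by case: eqP => // ->; rewrite !inE ltnn !andbF.
have split_img N' : [set prefix A N' | A in C] =
   [set prefix A N' | A in [set A in C | N \notin A]] :|:
   [set prefix A N' | A in [set A in C | N \in A]].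
  rewrite -imsetU; congr [set _ | _ in pred_of_set _].
  by apply/setP => A; rewrite !inE -andb_orr orNb andbT.
rewrite !split_img -/X -/Y -/X' -/Y' cardsU (_ : X :&: Y = set0) ?cards0 ?subn0; last first.
  apply/setP => I; rewrite !inE; apply/negP => /andP[/imsetP[A + ->] /imsetP[B + /setP /(_ N)]].
  rewrite !inE => /andP[_ nNA] /andP[_ NB]; rewrite ltnSn !andbT => e.
  by rewrite e NB in nNA.
rewrite eX eY -[LHS]cardsUI; congr (_ + _); apply: eq_card => I.
rewrite [RHS]inE in_setI; apply/andP/andP.
  case=> /imsetP[A + ->] /imsetP[B + e]; rewrite !inE => /andP[CA nA] /andP[CB NB].
  split; first exact: imset_f.
  by apply/andP; split; apply/exists_inP; [exists A | exists B]; rewrite ?e ?eqxx.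
case=> _ /andP[/exists_inP[A CA /andP[/eqP <- nA]] /exists_inP[B CB /andP[/eqP e NB]]].
by split; apply/imsetP; [exists A | exists B]; rewrite ?e // inE ?CA ?CB.
Qed.

Section Bound.
Context (k m : nat) (C : {set {set 'I_n}}).
Hypothesis nE : n = k + m.
Hypothesis cardC : forall A, A \in C -> #|A| = k.
Hypothesis ncC : forall A B, A \in C -> B \in C -> ~ crossing A B.

(** Let [A] continue [I] by [N] and let [B] continue [J] without it.  The sets
    have equal size, so [B] catches up by an element [d] beyond [N] that is not
    in [A], and [i < j < N < d] is a crossing. *)
Lemma branching_crossing N I J : I \in branching C N -> J \in branching C N ->
  #|I| = #|J| -> forall i j, i \in I :\: J -> j \in J :\: I -> i < j -> False.
Proof.
rewrite !inE => /and3P[_ _ /exists_inP[A CA /andP[/eqP eA NA]]].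
case/and3P=> _ /exists_inP[B CB /andP[/eqP eB NB]] _ eIJ i j.
move=> /setDP[iI niJ] /setDP[jJ njI] lij.
have iN : i < N by move: iI; rewrite -eA inE => /andP[].
have jN : j < N by move: jJ; rewrite -eB inE => /andP[].
have [d] : exists d : 'I_n, d \in [set i in B | N.+1 <= i] :\: [set i in A | N.+1 <= i].
  apply/set0Pn; rewrite setD_eq0; apply/negP => /subset_leq_card.
  have := card_prefix_suffix A N; have := card_prefix_suffix B N.
  rewrite (cardC CA) (cardC CB) eA eB eIJ => -> /addnI.
  have -> : [set i0 in B | N <= i0] = [set i0 in B | N < i0].
    apply/setP => s; rewrite !inE leq_eqVlt; case: eqP => [/val_inj <-|//].
    by rewrite (negPf NB).
  have -> : [set i0 in A | N <= i0] = N |: [set i0 in A | N < i0].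
    apply/setP => s; rewrite !inE leq_eqVlt (inj_eq val_inj) eq_sym.
    by case: eqP => [->|//]; rewrite NA.
  by rewrite cardsU1 !inE ltnn andbF /= => ->; rewrite add1n ltnn.
rewrite !inE => /andP[+ /andP[dB ltNd]]; rewrite ltNd andbT => ndA.
apply: (ncC CA CB); exists i, j, N, d; split; first by split.
rewrite !inE NA NB dB ndA /=.
rewrite -(prefixP A iN) -(prefixP A jN) -(prefixP B iN) -(prefixP B jN) eA eB.
by rewrite iI jJ niJ njI.
Qed.

Lemma branching_card_inj N : {in branching C N &, injective (fun I => #|I|)}.
Proof.
move=> I J bI bJ eIJ; apply/eqP; apply: contraT => nIJ.
have [i iIJ] : exists i, i \in I :\: J.
  apply/set0Pn; rewrite setD_eq0; apply: contra nIJ => sIJ.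
  by rewrite eqEcard sIJ eIJ leqnn.
have [j jJI] : exists j, j \in J :\: I.
  apply/set0Pn; rewrite setD_eq0; apply: contra nIJ => sIJ.
  by rewrite eq_sym eqEcard sIJ eIJ leqnn.
case: (ltngtP i j) => [lij|lji|/val_inj e].
- by case: (branching_crossing bI bJ eIJ iIJ jJI lij).
- by case: (branching_crossing bJ bI (esym eIJ) jJI iIJ lji).
- by move: iIJ jJI; rewrite e !inE => /andP[/negPf -> ->].
Qed.

Lemma branching_size N I : I \in branching C N -> #|I| < k /\ N - #|I| < m.
Proof.
rewrite !inE => /and3P[_ /exists_inP[B CB /andP[/eqP eB NB]]].
case/exists_inP=> A CA /andP[/eqP eA NA]; split.
  rewrite -(cardC CA) (card_prefix_suffix A N) eA -[X in X < _]addn0 ltn_add2l.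
  by rewrite card_gt0; apply/set0Pn; exists N; rewrite inE NA leqnn.
have := card_prefix_suffix B N; rewrite eB (cardC CB).
have : #|[set i in B | N <= i]| <= n - N.+1.
  rewrite -card_suffix; apply: subset_leq_card; apply/subsetP => s; rewrite !inE leq_eqVlt.
  by case: eqP => [/val_inj <-|_ /andP[]//]; rewrite (negPf NB).
by have := ltn_ord N; have := card_prefix B (ltnW (ltn_ord N)); rewrite eB; lia.
Qed.

(** A branching prefix below [N] is determined by its numbers of present and
    absent points, which add up to [N]. *)
Definition antidiagonal N := [set p : 'I_k * 'I_m | p.1 + p.2 == N].

Lemma card_branching N : #|branching C N| <= #|antidiagonal N|.
Proof.
have [->|[I0 bI0]] := set_0Vmem (branching C N); first by rewrite cards0.
have [k0 m0] := branching_size bI0.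
have pk : 0 < k by apply: leq_ltn_trans k0.
have pm : 0 < m by apply: leq_ltn_trans m0.
pose g I := (insubd (Ordinal pk) #|I|, insubd (Ordinal pm) (N - #|I|)).
rewrite -(@card_in_imset _ _ g (branching C N)); last first.
  move=> I J bI bJ [/(congr1 val) e _]; apply: (branching_card_inj bI bJ).
  move: e; rewrite !val_insubd.
  by rewrite (branching_size bI).1 (branching_size bJ).1.
apply: subset_leq_card; apply/subsetP => _ /imsetP[I bI ->].
rewrite inE /= !val_insubd (branching_size bI).1 (branching_size bI).2.
rewrite subnKC //; move: bI; rewrite !inE => /andP[/imsetP[A _ ->] _].
exact/card_prefix/ltnW/ltn_ord.
Qed.

(** A binary tree has one more leaf than it has nodes with two children, and
    those nodes have distinct coordinates in a [k] by [m] rectangle. *)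
Lemma card_noncrossing : #|C| <= (k * m).+1.
Proof.
have E N : N <= n -> #|[set prefix A N | A in C]| <=
    (\sum_(M < n | M < N) #|antidiagonal M|).+1.
  elim: N => [_|N IH ltNn].
    apply: (@leq_trans #|[set set0 : {set 'I_n}]|); last by rewrite cards1.
    apply: subset_leq_card; apply/subsetP => _ /imsetP[A _ ->].
    by rewrite inE; apply/eqP/setP => i; rewrite !inE andbF.
  rewrite (card_prefixes_succ C (Ordinal ltNn)) (bigD1 (Ordinal ltNn)) //=.
  rewrite addnC -addnS; apply: leq_add; first exact: card_branching.
  apply: leq_trans (IH (ltnW ltNn)) _; rewrite ltnS.
  by apply: eq_leq; apply: eq_bigl => i; rewrite ltnS -(inj_eq val_inj) /= andbC -ltn_neqAle.
have := E n (leqnn n).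
have -> : [set prefix A n | A in C] = C.
  rewrite -[RHS]imset_id; apply: eq_imset => A; apply/setP => i.
  by rewrite inE ltn_ord andbT.
move=> /leq_trans; apply; rewrite ltnS.
rewrite (eq_bigr (fun M : 'I_n => \sum_(p : 'I_k * 'I_m) (p.1 + p.2 == M))); last first.
  by move=> M _; rewrite -[LHS]sum1dep_card big_mkcond /=; apply: eq_bigr => p _; case: eqP.
have -> : k * m = \sum_(p : 'I_k * 'I_m) 1.
  by rewrite sum_nat_const muln1 card_prod !card_ord.
rewrite exchange_big /=.
apply: leq_sum => p _; rewrite big_mkcond /=.
have [lt|ge] := ltnP (p.1 + p.2) n.
  rewrite (bigD1 (Ordinal lt)) //= big1 ?addn0; first by case: ifP => // _; case: eqP.
  by move=> i; rewrite -(inj_eq val_inj) /= eq_sym => /negPf ->; case: ifP.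
rewrite big1 // => i _; case: ifP => // _; case: eqP => // e.
by move: (ltn_ord i); rewrite -e ltnNge ge.
Qed.

End Bound.
End NoncrossingFamilies.

(** * Comparison of two pairs of matchings *)

Definition bij_between (X Y : finType) (A : {set X}) (B : {set Y}) (M : X -> Y) :=
  {in A &, injective M} /\ M @: A = B.

Lemma bij_between_in (X Y : finType) (A : {set X}) (B : {set Y}) M a :
  bij_between A B M -> a \in A -> M a \in B.
Proof. by case=> _ <- aA; apply: imset_f. Qed.

(** Enumerate [A] beginning with [s] and [B] beginning with [t], and match the
    elements at equal positions. *)
Lemma exists_bij (X Y : finType) (A : {set X}) (B : {set Y}) (d : Y)
    (s : seq X) (t : seq Y) :
  #|A| = #|B| -> uniq s -> uniq t -> size s = size t ->
  {subset s <= A} -> {subset t <= B} ->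
  exists M, bij_between A B M /\ map M s = t.
Proof.
move=> eAB us ut est sA tB.
pose s' := s ++ [seq a <- enum A | a \notin s].
pose t' := t ++ [seq b <- enum B | b \notin t].
have us' : uniq s'.
  rewrite cat_uniq us filter_uniq ?enum_uniq // andbT.
  by apply/hasPn => a; rewrite mem_filter => /andP[].
have ut' : uniq t'.
  rewrite cat_uniq ut filter_uniq ?enum_uniq // andbT.
  by apply/hasPn => a; rewrite mem_filter => /andP[].
have ms' a : (a \in s') = (a \in A).
  rewrite mem_cat mem_filter mem_enum; case: (boolP (a \in s)) => //= /sA ->.
  by [].
have mt' a : (a \in t') = (a \in B).
  rewrite mem_cat mem_filter mem_enum; case: (boolP (a \in t)) => //= /tB ->.
  by [].
have sz : size s' = size t'.
  rewrite -(card_uniqP us') -(card_uniqP ut') (eq_card ms') (eq_card mt').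
  exact: eAB.
pose M a := nth d t' (index a s').
have Minj : {in A &, injective M}.
  move=> a b aA bA /eqP; rewrite nth_uniq -?sz ?index_mem ?ms' // => /eqP.
  by move=> /(congr1 (nth a s')); rewrite !nth_index ?ms'.
exists M; split; first split=> //.
  apply/eqP; rewrite eqEcard card_in_imset // eAB leqnn andbT.
  apply/subsetP => _ /imsetP[a aA ->].
  by rewrite -mt' mem_nth // -sz index_mem ms'.
apply: (@eq_from_nth _ d) => [|i]; first by rewrite size_map.
rewrite size_map => lti; have a0 : X by move: lti; clear; case: s.
rewrite (nth_map a0) // /M index_cat mem_nth // index_uniq //.
by rewrite nth_cat -est lti.
Qed.

Section Weights.
Context {K : numFieldType} {k m : nat}.
Implicit Types (I : {set 'I_k}) (J : {set 'I_m}).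

(** What remains of quasi-commutation: the statement only concerns scalar
    matrices, and it is symmetric under transposition. *)
Definition const_weight I I' J J' := exists c : int,
  forall (P : 'M[K]_(k, m)) (M M' : 'I_k -> 'I_m),
    matches P I J M -> matches P I' J' M' ->
    \sum_(s in I') \sum_(i in I) pair_weight P s i (M' s) (M i) = c%:~R.

Definition ordsg n (a b : 'I_n) : K := (b < a)%N%:R - (a < b)%N%:R.

Lemma ordsgC n (a b : 'I_n) : ordsg a b = - ordsg b a.
Proof. by rewrite /ordsg opprB. Qed.

Lemma const_weight_sym I I' J J' :
  const_weight I I' J J' -> const_weight I' I J' J.
Proof.
case=> c H; exists (- c) => P M M' mM mM'.
rewrite mulrNz -(H P M' M mM' mM) -sumrN exchange_big /=.
apply: eq_bigr => s _; rewrite -sumrN; apply: eq_bigr => i _.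
by rewrite /pair_weight; ring.
Qed.

Section Config.
Context (I I' : {set 'I_k}) (J J' : {set 'I_m}).
Hypotheses (eIJ : #|I| = #|J|) (eIJ' : #|I'| = #|J'|).

(** The last condition says that the columns common to [J] and [J'] are matched
    with the same row by both bijections; it lets [P] be the union of the two
    graphs without creating further monomials. *)
Definition config (M M' : 'I_k -> 'I_m) :=
  [/\ bij_between I J M, bij_between I' J' M' &
      {in I & I', forall i s, M i = M' s -> i = s}].

Section Edges.
Context (M M' : 'I_k -> 'I_m) (e : bool) (i0 s0 : 'I_k).
Hypothesis cM : config M M'.
Hypothesis h0 : e -> (i0 \in I :\: I') && (s0 \in I' :\: I).

(** The union of the two graphs, to which, if [e] is set, the two other edges of
    the square on the rows [i0], [s0] and the columns [M i0], [M' s0] are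
    added.  They do not change the minors but do change the bracket. *)
Definition edge i j := [|| (i \in I) && (j == M i), (i \in I') && (j == M' i) |
  e && ((i == i0) && (j == M' s0) || (i == s0) && (j == M i0))].

Lemma edge_M i i' : i \in I -> i' \in I -> edge i (M i') = (i == i').
Proof.
have [[Mi _] [M'i _] K1] := cM.
move=> iI i'I; apply/idP/eqP => [|->]; last by rewrite /edge i'I eqxx.
case/or3P=> [/andP[_ /eqP/Mi ->//]|/andP[iI' /eqP/K1 ->//]|/andP[/h0]].
rewrite !inE => /andP[/andP[ni0 iI0] /andP[ns0 sI0]].
case/orP=> /andP[/eqP ei]; first by move=> /eqP/K1 e'; rewrite -e' ?i'I in ns0.
by rewrite ei (negPf ns0) in iI.
Qed.

Lemma edge_M' i i' : i \in I' -> i' \in I' -> edge i (M' i') = (i == i').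
Proof.
have [[Mi _] [M'i _] K1] := cM.
move=> iI i'I; apply/idP/eqP => [|->]; last by rewrite /edge i'I eqxx orbT.
case/or3P=> [/andP[iI' /eqP/esym/K1 ->//]|/andP[_ /eqP/M'i ->//]|/andP[/h0]].
rewrite !inE => /andP[/andP[ni0 iI0] /andP[ns0 sI0]].
case/orP=> /andP[/eqP ei]; first by rewrite ei (negPf ni0) in iI.
by move=> /eqP/esym/K1 e'; rewrite e' ?i'I in ni0.
Qed.

Lemma edge_swap i s : i \in I -> s \in I' ->
  edge i (M' s) && edge s (M i) = (i == s) || [&& e, i == i0 & s == s0].
Proof.
have [[Mi _] [M'i _] K1] := cM.
move=> iI sI'; have [eis|nis] /= := eqVneq i s.
  by subst i; rewrite edge_M // edge_M' // !eqxx.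
apply/andP/and3P.
  case=> /or3P[/andP[_ /eqP/esym/K1 e']|/andP[iI' /eqP/M'i e']|/andP[/[dup] ee /h0]].
  - by rewrite e' ?eqxx in nis.
  - by rewrite e' ?eqxx in nis.
  rewrite !inE => /andP[/andP[ni0 iI0] /andP[ns0 sI0]].
  case/orP=> /andP[/eqP ei]; last by rewrite ei (negPf ns0) in iI.
  by move=> /eqP/M'i ->; rewrite // ei !eqxx.
by case=> ee /eqP -> /eqP ->; rewrite /edge ee !eqxx !orbT.
Qed.

Lemma edge_weight (P := \matrix_(i, j) (edge i j)%:R : 'M[K]_(k, m)) :
  [/\ matches P I J M, matches P I' J' M' &
   \sum_(s in I') \sum_(i in I) pair_weight P s i (M' s) (M i) =
   \sum_(i in I :&: I') ordsg (M' i) (M i) +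
   (ordsg s0 i0 + ordsg (M' s0) (M i0)) *+ e].
Proof.
have [bM bM' K1] := cM.
split.
- split=> [i|i i' iI i'I]; first exact: bij_between_in.
  by rewrite mxE edge_M.
- split=> [i|i i' iI i'I]; first exact: bij_between_in.
  by rewrite mxE edge_M'.
transitivity (\sum_(s in I') \sum_(i in I)
  ((ordsg (M' i) (M i)) *+ (i == s) +
   (ordsg s0 i0 + ordsg (M' s0) (M i0)) *+ [&& e, i == i0 & s == s0])).
  apply: eq_bigr => s sI'; apply: eq_bigr => i iI.
  rewrite /pair_weight !mxE -natrM mulnb edge_swap //.
  have [eis|nis] := eqVneq i s.
    subst s; have -> : [&& e, i == i0 & i == s0] = false.
      apply/negP => /and3P[/h0 + /eqP e1 /eqP _].
      by rewrite !inE -e1 sI'.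
    by rewrite mulr1 mulr1n mulr0n addr0 subrr add0r.
  rewrite mulr0n add0r /=; case: and3P => [[_ /eqP-> /eqP->]|_].
    by rewrite mulr1 mulr1n.
  by rewrite mulr0 mulr0n.
under eq_bigr => s _ do rewrite big_split /=.
rewrite big_split /=; congr (_ + _).
  rewrite exchange_big /= [RHS]big_mkcond [LHS]big_mkcond /=; apply: eq_bigr => i _.
  rewrite inE; case: (boolP (i \in I)) => //= iI.
  have [iI'|niI'] := boolP (i \in I').
    rewrite (bigD1 i) //= eqxx mulr1n big1 ?addr0 // => s /andP[_ nsi].
    by rewrite eq_sym (negPf nsi) mulr0n.
  rewrite big1 // => s sI'; case: eqP => [e'|]; last by rewrite mulr0n.
  by rewrite e' sI' in niI'.
case: e h0 => [/(_ isT)/andP[/setDP[i0I _] /setDP[s0I _]]|_]; last first.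
  by rewrite big1 // => s _; rewrite big1.
rewrite (bigD1 s0) //= (bigD1 i0) //= !eqxx big1 ?addr0; last first.
  by move=> i /andP[_ /negPf ->].
rewrite big1 ?addr0 // => s /andP[_ /negPf ns].
by rewrite big1 // => i _; rewrite ns andbF.
Qed.

End Edges.

(** The compatibility of the two bijections concerns common columns only, and
    the exchanged columns are not common. *)
Lemma config_swap M M' i1 i2 : config M M' -> i1 \in I -> i2 \in I ->
  M i1 \notin J' -> M i2 \notin J' -> config (M \o tperm i1 i2) M'.
Proof.
case=> [[Mi MI] bM' K1] i1I i2I n1 n2.
have tI i : (tperm i1 i2 i \in I) = (i \in I).
  by case: tpermP => [->|->|//]; rewrite i1I i2I.
split=> //; first split.
- move=> i j iI jI /= /Mi; rewrite !tI => /(_ iI jI).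
  exact: perm_inj.
- rewrite -MI; apply/setP => j; apply/imsetP/imsetP => [] [i iI ->].
    by exists (tperm i1 i2 i); rewrite ?tI.
  by exists (tperm i1 i2 i); rewrite ?tI //= tpermK.
move=> i s iI sI' /= e; have e' := K1 (tperm i1 i2 i) s.
rewrite tI in e'; have {}e' := e' iI sI' e.
have := bij_between_in bM' sI'; rewrite -e.
by case: tpermP e' => [_ _|_ _|//]; rewrite (negPf n1, negPf n2).
Qed.

(** Match the common columns with common rows outside [av], as many as there are
    columns, and extend both bijections with the prescribed values. *)
Lemma exists_config (d : 'I_m) (av s s' : seq 'I_k) (t t' : seq 'I_m) :
  (#|J :&: J'| + size av <= #|I :&: I'|)%N ->
  uniq s -> uniq s' -> uniq t -> uniq t' -> size s = size t -> size s' = size t' ->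
  {subset s <= I} -> {subset s' <= I'} ->
  {subset t <= J :\: J'} -> {subset t' <= J' :\: J} ->
  (forall i, i \in s ++ s' -> i \in I :&: I' -> i \in av) ->
  exists M M', [/\ config M M', map M s = t & map M' s' = t'].
Proof.
move=> lKN us us' ut ut' est est' sI sI' tJ tJ' sav.
(* NK below is the set of common rows matched with the common columns. *)
pose N0 := [seq i <- enum (I :&: I') | i \notin av].
pose NK := take #|J :&: J'| N0.
have szN0 : (#|J :&: J'| <= size N0)%N.
  rewrite -(leq_add2r (size av)); apply: leq_trans lKN _.
  have -> : #|I :&: I'| = (size N0 + count (mem av) (enum (I :&: I')))%N.
    by rewrite cardE addnC [size N0]size_filter; apply/esym/count_predC.
  rewrite leq_add2l.
  rewrite -size_filter; apply: uniq_leq_size; first by rewrite filter_uniq ?enum_uniq.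
  by move=> i; rewrite mem_filter => /andP[].
have szNK : size NK = size (enum (J :&: J')) by rewrite size_takel // -cardE.
have NKP i : i \in NK -> [/\ i \in I, i \in I' & i \notin av].
  by move=> /mem_take; rewrite mem_filter mem_enum !inE => /and3P[].
have uNK : uniq NK by rewrite take_uniq // filter_uniq // enum_uniq.
have NKs i : i \in s ++ s' -> i \notin NK.
  move=> is_; apply/negP => /NKP[iI iI' /negP]; apply.
  by apply: sav => //; rewrite inE iI.
have ucat (r : seq 'I_k) : uniq r -> {subset r <= s ++ s'} -> uniq (NK ++ r).
  move=> ur sr; rewrite cat_uniq uNK ur andbT; apply/hasPn => i /sr.
  exact: NKs.
have ucat' (B : {set 'I_m}) (r : seq 'I_m) : uniq r -> {subset r <= B} ->
    [disjoint B & J :&: J'] -> uniq (enum (J :&: J') ++ r).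
  move=> ur sr dB; rewrite cat_uniq enum_uniq ur andbT; apply/hasPn => j /sr jB.
  by rewrite mem_enum (disjointFr dB jB).
have [M [bM MP]] : exists M, bij_between I J M /\
    map M (NK ++ s) = enum (J :&: J') ++ t.
  apply: exists_bij => //.
  - by apply: ucat => // i; rewrite mem_cat => ->.
  - apply: (ucat' (J :\: J')) => //.
    by rewrite disjoints_subset; apply/subsetP => j; rewrite !inE => /andP[/negPf -> ->].
  - by rewrite !size_cat szNK est.
  - by move=> i; rewrite mem_cat => /orP[/NKP[]|/sI].
  - by move=> j; rewrite mem_cat mem_enum => /orP[/setIP[]|/tJ/setDP[]].
have [M' [bM' MP']] : exists M', bij_between I' J' M' /\
    map M' (NK ++ s') = enum (J :&: J') ++ t'.
  apply: exists_bij => //.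
  - by apply: ucat => // i; rewrite mem_cat orbC => ->.
  - apply: (ucat' (J' :\: J)) => //.
    by rewrite disjoints_subset; apply/subsetP => j; rewrite !inE => /andP[/negPf -> _].
  - by rewrite !size_cat szNK est'.
  - by move=> i; rewrite mem_cat => /orP[/NKP[]|/sI'].
  - by move=> j; rewrite mem_cat mem_enum => /orP[/setIP[]|/tJ'/setDP[]].
have catP (X : seq 'I_m) Y X' Y' : size X = size X' -> X ++ Y = X' ++ Y' -> X = X' /\ Y = Y'.
  by move=> e /eqP; rewrite eqseq_cat // => /andP[/eqP -> /eqP ->].
move: MP MP'; rewrite !map_cat => /catP[|M1 M2]; first by rewrite size_map.
move=> /catP[|M1' M2']; first by rewrite size_map.
exists M, M'; split=> //; split=> // i r iI rI' e.
have eMM i' : i' \in NK -> M i' = M' i'.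
  by move: i'; apply/eq_in_map; rewrite M1 M1'.
have : M i \in enum (J :&: J').
  by rewrite mem_enum inE (bij_between_in bM iI) e (bij_between_in bM' rI').
rewrite -M1 => /mapP[i' i'N ei']; have [i'I i'I' _] := NKP _ i'N.
have -> : i = i' by apply: bM.1.
by apply: bM'.1 => //; rewrite -eMM // -ei' e.
Qed.

Hypothesis cw : const_weight I I' J J'.

Lemma edge_const : exists c : int, forall M M' (e : bool) i0 s0, config M M' ->
  (e -> (i0 \in I :\: I') && (s0 \in I' :\: I)) ->
  \sum_(i in I :&: I') ordsg (M' i) (M i) +
    (ordsg s0 i0 + ordsg (M' s0) (M i0)) *+ e = c%:~R.
Proof.
case: cw => c H; exists c => M M' e i0 s0 cM h0.
have [mM mM' <-] := edge_weight cM h0.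
exact: H.
Qed.

Lemma config_const : exists c : int, forall M M', config M M' -> 'I_k ->
  \sum_(i in I :&: I') ordsg (M' i) (M i) = c%:~R.
Proof.
have [c H] := edge_const; exists c => M M' cM i0.
by rewrite -(H M M' false i0 i0 cM) // mulr0n addr0.
Qed.

Lemma sg_eq n (a b : 'I_n) : a != b -> ordsg a b = (- 1) ^+ (a < b)%N.
Proof.
rewrite -(inj_eq val_inj) /ordsg; case: ltngtP => // _ _;
by rewrite /= mulr0n mulr1n ?sub0r ?subr0 ?expr1.
Qed.

Lemma signrD_eq0 (b c : bool) : (- 1) ^+ b + (- 1) ^+ c = 0 :> K -> b = ~~ c.
Proof.
case: b c => [] [] //= /eqP; rewrite ?expr1 ?expr0 -?opprD ?oppr_eq0.
  by rewrite -[1 + 1]/(2%:R) pnatr_eq0.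
by rewrite -[1 + 1]/(2%:R) pnatr_eq0.
Qed.

Hypothesis leKN : (#|J :&: J'| <= #|I :&: I'|)%N.

(** Compare the weight with and without the two extra edges: their contribution
    [ordsg s0 i0 + ordsg b a] must vanish. *)
Lemma cross_pair_order i0 s0 a b : i0 \in I :\: I' -> s0 \in I' :\: I ->
  a \in J :\: J' -> b \in J' :\: J -> (s0 < i0)%N = (a < b)%N.
Proof.
move=> i0P s0P aP bP.
have [M [M' [cM [Mi0] [M's0]]]] : exists M M',
    [/\ config M M', map M [:: i0] = [:: a] & map M' [:: s0] = [:: b]].
  apply: (exists_config a (av := [::])) => //=; rewrite ?addn0 //.
  - by move=> i; rewrite inE => /eqP ->; case/setDP: i0P.
  - by move=> i; rewrite inE => /eqP ->; case/setDP: s0P.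
  - by move=> i; rewrite inE => /eqP ->.
  - by move=> i; rewrite inE => /eqP ->.
  move=> i; rewrite !inE; case/setDP: i0P => i0I /negPf i0I'.
  case/setDP: s0P => s0I' /negPf s0I.
  by case/orP=> /eqP ->; rewrite ?i0I' ?s0I ?andbF.
have [c H] := edge_const.
have h1 : true -> (i0 \in I :\: I') && (s0 \in I' :\: I) by rewrite i0P s0P.
have h0 : false -> (i0 \in I :\: I') && (s0 \in I' :\: I) by [].
have := H M M' true i0 s0 cM h1; rewrite -(H M M' false i0 s0 cM h0) => /addrI.
rewrite mulr0n mulr1n Mi0 M's0 !sg_eq; last first.
- by apply: contraTneq i0P => <-; case/setDP: s0P => sI' _; rewrite inE sI'.
- by apply: contraTneq bP => ->; case/setDP: aP => aJ _; rewrite inE aJ.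
move=> /signrD_eq0 ->; rewrite -leqNgt leq_eqVlt.
case: eqP => // /val_inj e.
by case/setDP: aP bP => aJ _; rewrite -e inE aJ.
Qed.

(** Exchange the columns of a common row [i1] and of [i2]: only the term of [i1]
    changes, from [ordsg b a1] to [ordsg b a2]. *)
Lemma cross_side i2 a1 a2 b : (#|J :&: J'| < #|I :&: I'|)%N ->
  i2 \in I :\: I' -> a1 \in J :\: J' -> a2 \in J :\: J' -> a1 != a2 ->
  b \in J' :\: J -> (b < a1)%N = (b < a2)%N.
Proof.
move=> ltKN i2P a1P a2P na bP.
have [i1 i1N] : exists i1, i1 \in I :&: I'.
  by apply/set0Pn; rewrite -card_gt0; apply: leq_ltn_trans ltKN.
have [i1I i1I'] := setIP i1N; have [i2I i2I'] := setDP i2P.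
have ni : i1 != i2 by apply: contraNneq i2I' => <-.
have [M [M' [cM [Mi1 Mi2] [M'i1]]]] : exists M M',
    [/\ config M M', map M [:: i1; i2] = [:: a1; a2] & map M' [:: i1] = [:: b]].
  apply: (exists_config a1 (av := [:: i1])) => //=; rewrite ?addn1 ?inE ?andbT //.
  - by move=> i; rewrite !inE => /orP[] /eqP ->.
  - by move=> i; rewrite inE => /eqP ->.
  - by move=> i; rewrite !inE => /orP[] /eqP ->; [move: a1P|move: a2P]; rewrite inE.
  - by move=> i; rewrite !inE => /eqP ->; move: bP; rewrite inE.
  by move=> i; rewrite !inE => /or3P[] /eqP -> //; rewrite (negPf i2I') andbF.
have cM2 : config (M \o tperm i1 i2) M'.
  apply: config_swap => //; first by rewrite Mi1; case/setDP: a1P.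
  by rewrite Mi2; case/setDP: a2P.
have [c H] := config_const.
have := H _ _ cM i1; rewrite -(H _ _ cM2 i1) !(bigD1 i1 i1N) /= tpermL M'i1 Mi1 Mi2.
rewrite [in RHS](eq_bigr (fun i => ordsg (M' i) (M i))); last first.
  move=> i /andP[/setIP[_ iI'] ni1]; congr (ordsg _ (M _)).
  by rewrite tpermD // eq_sym //; apply: contraNneq i2I' => <-.
move=> /addIr; rewrite !sg_eq.
- exact: signr_inj.
- by apply: contraTneq a2P => <-; case/setDP: bP => bJ' _; rewrite inE bJ'.
- by apply: contraTneq a1P => <-; case/setDP: bP => bJ' _; rewrite inE bJ'.
Qed.

(** Exchange the columns of two common rows: for the crossing columns the two
    terms add up to [2] before and to [0] after the exchange. *)
Lemma cross_quad a1 a2 b1 b2 : (#|J :&: J'| + 2 <= #|I :&: I'|)%N ->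
  a1 \in J :\: J' -> a2 \in J :\: J' -> b1 \in J' :\: J -> b2 \in J' :\: J ->
  (a1 < b1)%N -> (b1 < a2)%N -> (a2 < b2)%N -> False.
Proof.
move=> leKN2 a1P a2P b1P b2P l1 l2 l3.
have : (1 < #|I :&: I'|)%N by lia.
case/card_gt1P => i1 [i2 [i1N i2N ni]].
have [i1I i1I'] := setIP i1N; have [i2I i2I'] := setIP i2N.
have na : a1 != a2 by rewrite -(inj_eq val_inj) neq_ltn (ltn_trans l1).
have nb : b1 != b2 by rewrite -(inj_eq val_inj) neq_ltn (ltn_trans l2).
have [M [M' [cM [Mi1 Mi2] [M'i1 M'i2]]]] : exists M M',
    [/\ config M M', map M [:: i1; i2] = [:: a1; a2]
      & map M' [:: i1; i2] = [:: b1; b2]].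
  apply: (exists_config a1 (av := [:: i1; i2])) => //=; rewrite ?inE ?andbT //.
  - by move=> i; rewrite !inE => /orP[] /eqP ->.
  - by move=> i; rewrite !inE => /orP[] /eqP ->.
  - by move=> i; rewrite !inE => /orP[] /eqP ->; [move: a1P|move: a2P]; rewrite inE.
  - by move=> i; rewrite !inE => /orP[] /eqP ->; [move: b1P|move: b2P]; rewrite inE.
  by move=> i; rewrite !inE => /or4P[] /eqP ->; rewrite eqxx ?orbT.
have cM2 : config (M \o tperm i1 i2) M'.
  apply: config_swap => //; first by rewrite Mi1; case/setDP: a1P.
  by rewrite Mi2; case/setDP: a2P.
have [c H] := config_const.
have i2N' : (i2 \in I :&: I') && (i2 != i1) by rewrite i2N eq_sym.
have := H _ _ cM i1; rewrite -(H _ _ cM2 i1) !(bigD1 i1 i1N) /= !(bigD1 i2 i2N') /=.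
rewrite tpermL tpermR M'i1 M'i2 Mi1 Mi2.
rewrite [in RHS](eq_bigr (fun i => ordsg (M' i) (M i))); last first.
  move=> i /andP[/andP[_ n1] n2]; congr (ordsg _ (M _)).
  by rewrite tpermD // eq_sym.
rewrite (addrA (ordsg b1 a1)) (addrA (ordsg b1 a2)) => /addIr.
have sg1 (x y : 'I_m) : (x < y)%N -> ordsg y x = 1.
  by move=> lt; rewrite /ordsg lt ltnNge ltnW //= subr0.
have sgN1 (x y : 'I_m) : (x < y)%N -> ordsg x y = - 1.
  by move=> lt; rewrite ordsgC sg1.
rewrite (sg1 a1 b1) // (sg1 a2 b2) // (sgN1 b1 a2) // (sg1 a1 b2); last first.
  exact: ltn_trans l1 (ltn_trans l2 l3).
move=> /eqP; rewrite -subr_eq0.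
have -> : 1 + 1 - (- 1 + 1) = 2%:R :> K by ring.
by rewrite pnatr_eq0.
Qed.

End Config.
End Weights.

(** * Quasi-commuting minors have noncrossing words *)

Lemma matches_bij (K : numFieldType) k m (P : 'M[K]_(k, m)) (I : {set 'I_k})
    (J : {set 'I_m}) M : #|I| = #|J| -> matches P I J M -> bij_between I J M.
Proof.
move=> eIJ [MJ MP].
have Mi : {in I &, injective M}.
  move=> i i' iI i'I e; have := MP i i' iI i'I; rewrite -e MP // eqxx.
  by case: eqP => // _ /eqP; rewrite oner_eq0.
split=> //; apply/eqP; rewrite eqEcard card_in_imset // eIJ leqnn andbT.
by apply/subsetP => _ /imsetP[i iI ->]; apply: MJ.
Qed.

(** Transpose [P] and replace the bijections by their inverses. *)
Lemma const_weight_tr (K : numFieldType) k m (I I' : {set 'I_k}) (J J' : {set 'I_m}) :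
  'I_m -> #|I| = #|J| -> #|I'| = #|J'| ->
  const_weight (K := K) I I' J J' -> const_weight (K := K) J J' I I'.
Proof.
move=> d eIJ eIJ' [c H]; exists c => P N N' mN mN'.
have inv (A : {set 'I_m}) (B : {set 'I_k}) (L : 'I_m -> 'I_k) : #|B| = #|A| ->
    matches P A B L -> exists M, [/\ matches P^T B A M, {in A, cancel L M}
      & B = L @: A].
  move=> eBA mL; have [Li LB] := matches_bij (esym eBA) mL.
  exists (fun i => odflt d [pick j in A | L j == i]).
  have LK j : j \in A -> odflt d [pick j' in A | L j' == L j] = j.
    move=> jA; case: pickP => [j' /andP[j'A /eqP/Li ->]//|/(_ j)].
    by rewrite jA eqxx.
  split=> //; split=> [i|i i'].
    by rewrite -LB => /imsetP[j jA ->]; rewrite LK.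
  rewrite -LB => /imsetP[j jA ->] /imsetP[j' j'A ->]; rewrite mxE LK //.
  by case: mL => _ ->//; rewrite (inj_in_eq Li) // eq_sym.
have [M [mM MK eI]] := inv J I N eIJ mN.
have [M' [mM' MK' eI']] := inv J' I' N' eIJ' mN'.
have [Ni _] := matches_bij (esym eIJ) mN.
have [Ni' _] := matches_bij (esym eIJ') mN'.
rewrite -(H _ _ _ mM mM') [in RHS]eI' big_imset //=; apply: eq_bigr => t tJ'.
rewrite [in RHS]eI big_imset //=; apply: eq_bigr => j jJ.
rewrite MK // MK' // /pair_weight !mxE [P t (N j) * _]mulrC; congr (_ * _).
exact: addrC.
Qed.

Section Words.
Context {k m : nat}.
Implicit Types (I : {set 'I_k}) (J : {set 'I_m}).

(** Rows are listed from the last to the first and complemented: with this convention the minors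
    are the maximal minors of a matrix with [k] rows and [k + m] columns, and
    rows and columns enter symmetrically. *)
Definition word I J : {set 'I_(k + m)} :=
  [set p | match fintype.split p with inl i => rev_ord i \notin I | inr j => j \in J end].

Lemma word_lshift I J i : (lshift m i \in word I J) = (rev_ord i \notin I).
Proof. by rewrite inE (unsplitK (inl _ i)). Qed.

Lemma word_rshift I J j : (rshift k j \in word I J) = (j \in J).
Proof. by rewrite inE (unsplitK (inr _ j)). Qed.

Lemma word_inj I I' J J' : word I J = word I' J' -> I = I' /\ J = J'.
Proof.
move=> /setP e; split; apply/setP => i.
  by have := e (lshift m (rev_ord i)); rewrite !word_lshift rev_ordK => /negb_inj.
by have := e (rshift k i); rewrite !word_rshift.
Qed.

Lemma card_word I J : #|I| = #|J| -> #|word I J| = k.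
Proof.
move=> eIJ.
have -> : word I J = (@lshift k m @: [set i | rev_ord i \notin I]) :|: (@rshift k m @: J).
  apply/setP => p; rewrite in_setU; case: (split_ordP p) => i ->.
    rewrite word_lshift (mem_imset _ _ (@lshift_inj _ _)) inE.
    rewrite [X in _ || X](_ : _ = false) ?orbF //.
    by apply/imsetP => [[j _ /eqP]]; rewrite eq_lrshift.
  rewrite word_rshift (mem_imset _ _ (@rshift_inj _ _)).
  rewrite [X in X || _](_ : _ = false) //.
  by apply/imsetP => [[j _ /eqP]]; rewrite eq_rlshift.
rewrite cardsU (_ : _ :&: _ = set0); last first.
  apply/setP => p; rewrite !inE; apply/negP => /andP[/imsetP[i _ ->] /imsetP[j _ /eqP]].
  by rewrite eq_lrshift.
rewrite cards0 subn0 !card_imset; [|exact: rshift_inj|exact: lshift_inj].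
have -> : [set i | rev_ord i \notin I] = @rev_ord k @: ~: I.
  apply/setP => i; rewrite inE -[i in RHS]rev_ordK (mem_imset _ _ (@rev_ord_inj _)).
  by rewrite inE.
by rewrite card_imset; [rewrite -eIJ addnC cardsC card_ord | exact: rev_ord_inj].
Qed.

Lemma word_set0 I J : #|I| = #|J| -> ~ crossing (word I J) (word set0 set0) /\
  ~ crossing (word set0 set0) (word I J).
Proof.
move=> eIJ.
have rowP (p : 'I_(k + m)) : p \in word set0 set0 -> (p < k)%N.
  case: (split_ordP p) => i ->; first by rewrite /=.
  by rewrite word_rshift inE.
have colP (p : 'I_(k + m)) : p \notin word set0 set0 -> (k <= p)%N.
  case: (split_ordP p) => i ->; first by rewrite word_lshift inE.
  by rewrite /= leq_addr.
split=> -[a [b [c [d [[lab lbc lcd] [/setDP[a1 a2] /setDP[b1 b2] /setDP[c1 c2] /setDP[d1 d2]]]]]]].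
  by have := rowP _ b1; have := colP _ a2; lia.
by have := rowP _ c1; have := colP _ b2; lia.
Qed.
End Words.

(** Transposition reverses the word and complements it, which keeps the
    alternating pattern. *)
Lemma crossing_tr k m (I I' : {set 'I_k}) (J J' : {set 'I_m}) :
  crossing (word I J) (word I' J') -> crossing (word J I) (word J' I').
Proof.
pose g (p : 'I_(k + m)) : 'I_(m + k) := cast_ord (addnC k m) (rev_ord p).
have gw (A : {set 'I_k}) (B : {set 'I_m}) p : (g p \in word B A) = (p \notin word A B).
  case: (split_ordP p) => i ->.
    have -> : g (lshift m i) = rshift m (rev_ord i).
      by apply: val_inj => /=; have := ltn_ord i; lia.
    by rewrite word_rshift word_lshift negbK.
  have -> : g (rshift k i) = lshift k (rev_ord i).
    by apply: val_inj => /=; have := ltn_ord i; lia.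
  by rewrite word_lshift word_rshift rev_ordK.
case=> a [b [c [d [[lab lbc lcd] [aP bP cP dP]]]]].
exists (g d), (g c), (g b), (g a); split.
  by split=> /=; have := ltn_ord d; lia.
by move: aP bP cP dP; rewrite !in_setD !gw !negbK => aP bP cP dP; split; rewrite andbC.
Qed.

Lemma ltn_shift_rl k m (i : 'I_m) (j : 'I_k) : (rshift k i < lshift m j)%N = false.
Proof. by apply/negbTE; rewrite -leqNgt /= ltnW // ltn_addr. Qed.

Lemma ltn_shift_rr k m (i j : 'I_m) : (rshift k i < rshift k j)%N = (i < j)%N.
Proof. by rewrite /= ltn_add2l. Qed.

Lemma ltn_rev_ord k (i j : 'I_k) : (rev_ord i < rev_ord j)%N = (j < i)%N.
Proof. by rewrite /=; have := ltn_ord i; have := ltn_ord j; lia. Qed.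

Section SetDifferences.
Context {k m : nat} {I I' : {set 'I_k}} {J J' : {set 'I_m}}.
Hypothesis eIJ : #|I| = #|J|.

Lemma card_differences : (#|J :\: J'| + #|J :&: J'| = #|I :\: I'| + #|I :&: I'|)%N.
Proof. by rewrite ![(#|_ :\: _| + _)%N]addnC !cardsID. Qed.

Lemma exists_col_difference x : (#|J :&: J'| <= #|I :&: I'|)%N ->
  x \in I :\: I' -> exists y, y \in J :\: J'.
Proof.
move=> leKN xP; apply/set0Pn; rewrite -card_gt0.
have : (0 < #|I :\: I'|)%N by rewrite card_gt0; apply/set0Pn; exists x.
by have := card_differences; lia.
Qed.

Lemma ltn_common y : I :\: I' = set0 -> y \in J :\: J' ->
  (#|J :&: J'| < #|I :&: I'|)%N.
Proof.
move=> e0 yP; have : (0 < #|J :\: J'|)%N by rewrite card_gt0; apply/set0Pn; exists y.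
by have := card_differences; rewrite e0 cards0; lia.
Qed.

Lemma ltn_common2 y y' : I :\: I' = set0 -> y \in J :\: J' -> y' \in J :\: J' ->
  y != y' -> (#|J :&: J'| + 2 <= #|I :&: I'|)%N.
Proof.
move=> e0 yP yP' ne.
have : (1 < #|J :\: J'|)%N by apply/card_gt1P; exists y, y'.
by have := card_differences; rewrite e0 cards0; lia.
Qed.
End SetDifferences.

(** A crossing consists of some rows followed by some columns.  If both minors
    have private rows, then also private columns, and [cross_pair_order] forces
    the order of the private rows to determine that of the private columns,
    so the word does not alternate.  Otherwise there are spare common rows and
    [cross_side] or [cross_quad] applies to the columns. *)
Lemma const_weight_noncrossing_rows (K : numFieldType) k m
    (I I' : {set 'I_k}) (J J' : {set 'I_m}) :
  #|I| = #|J| -> #|I'| = #|J'| -> (#|J :&: J'| <= #|I :&: I'|)%N ->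
  const_weight (K := K) I I' J J' -> ~ crossing (word I J) (word I' J').
Proof.
move=> eIJ eIJ' leKN cw.
have leKN' : (#|J' :&: J| <= #|I' :&: I|)%N by rewrite [J' :&: _]setIC [I' :&: _]setIC.
have E1 := cross_pair_order eIJ eIJ' cw leKN.
have E2 := cross_side eIJ eIJ' cw.
have E2' := cross_side eIJ' eIJ (const_weight_sym cw).
have E3 := cross_quad eIJ eIJ' cw leKN.
case=> a [b [c [d]]].
case: (split_ordP d) => d' ->.
  case: (split_ordP c) => c' ->; last by case=> [[_ _]]; rewrite ltn_shift_rl.
  case: (split_ordP b) => b' ->; last by case=> [[_]]; rewrite ltn_shift_rl.
  case: (split_ordP a) => a' ->; last by case=> [[]]; rewrite ltn_shift_rl.
  rewrite !in_setD !word_lshift !negbK => -[[lab lbc _] [aP bP cP _]].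
  have aP' : rev_ord a' \in I' :\: I by rewrite in_setD andbC.
  have bP' : rev_ord b' \in I :\: I' by rewrite in_setD andbC.
  have cP' : rev_ord c' \in I' :\: I by rewrite in_setD andbC.
  have [x xP] := exists_col_difference eIJ leKN bP'.
  have [y yP] := exists_col_difference eIJ' leKN' aP'.
  have := E1 _ _ _ _ bP' aP' xP yP; rewrite -(E1 _ _ _ _ bP' cP' xP yP) !ltn_rev_ord.
  by rewrite lbc ltnNge ltnW.
case: (split_ordP c) => c' ->.
  case: (split_ordP b) => b' ->; last by case=> [[_]]; rewrite ltn_shift_rl.
  case: (split_ordP a) => a' ->; last by case=> [[]]; rewrite ltn_shift_rl.
  rewrite !in_setD !word_lshift !word_rshift !negbK => -[[lab lbc _] [aP bP cP yP]].
  have aP' : rev_ord a' \in I' :\: I by rewrite in_setD andbC.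
  have bP' : rev_ord b' \in I :\: I' by rewrite in_setD andbC.
  have cP' : rev_ord c' \in I' :\: I by rewrite in_setD andbC.
  have [x xP] := exists_col_difference eIJ leKN bP'.
  have yP' : d' \in J' :\: J by rewrite in_setD.
  have := E1 _ _ _ _ bP' aP' xP yP'; rewrite -(E1 _ _ _ _ bP' cP' xP yP') !ltn_rev_ord.
  by rewrite lbc ltnNge ltnW.
case: (split_ordP b) => b' ->.
  case: (split_ordP a) => a' ->; last by case=> [[]]; rewrite ltn_shift_rl.
  rewrite !in_setD !word_lshift !word_rshift !negbK => -[[lab _ lcd] [aP bP cP dP]].
  have aP' : rev_ord a' \in I' :\: I by rewrite in_setD andbC.
  have bP' : rev_ord b' \in I :\: I' by rewrite in_setD andbC.
  have cP' : c' \in J :\: J' by rewrite in_setD.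
  have dP' : d' \in J' :\: J by rewrite in_setD.
  have := E1 _ _ _ _ bP' aP' cP' dP'; rewrite ltn_rev_ord.
  rewrite ltn_shift_rr in lcd; rewrite lcd.
  by rewrite ltnNge ltnW.
have bcd : (b' < c')%N -> (c' < d')%N -> b' != d'.
  by move=> l1 l2; rewrite -(inj_eq val_inj) neq_ltn (ltn_trans l1 l2).
case: (split_ordP a) => a' ->.
  rewrite !in_setD !word_lshift !word_rshift !negbK => -[[_ lbc lcd] [aP bP cP dP]].
  rewrite !ltn_shift_rr in lbc lcd.
  have aP' : rev_ord a' \in I' :\: I by rewrite in_setD andbC.
  have bP' : b' \in J' :\: J by rewrite in_setD.
  have cP' : c' \in J :\: J' by rewrite in_setD.
  have dP' : d' \in J' :\: J by rewrite in_setD.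
  have [RB0|[x xP]] := set_0Vmem (I :\: I').
    have lt : (#|J' :&: J| < #|I' :&: I|)%N.
      by rewrite [J' :&: _]setIC [I' :&: _]setIC; apply: ltn_common RB0 cP'.
    have := E2' _ _ _ _ lt aP' bP' dP' (bcd lbc lcd) cP'.
    by rewrite lcd ltnNge ltnW.
  have := E1 _ _ _ _ xP aP' cP' bP'; rewrite (E1 _ _ _ _ xP aP' cP' dP') lcd.
  by rewrite ltnNge ltnW.
rewrite !in_setD !word_rshift => -[[lab lbc lcd] [aP' bP' cP' dP']].
rewrite !ltn_shift_rr in lab lbc lcd.
move: aP' bP' cP' dP'; rewrite -!in_setD => aP bP cP dP.
have ac : a' != c' by rewrite -(inj_eq val_inj) neq_ltn (ltn_trans lab lbc).
have [RB0|[x xP]] := set_0Vmem (I :\: I'); have [RA0|[y yP]] := set_0Vmem (I' :\: I).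
- by apply: (E3 a' c' b' d') => //; apply: ltn_common2 RB0 aP cP ac.
- have lt : (#|J' :&: J| < #|I' :&: I|)%N.
    by rewrite [J' :&: _]setIC [I' :&: _]setIC; apply: ltn_common RB0 cP.
  have := E2' _ _ _ _ lt yP bP dP (bcd lbc lcd) cP.
  by rewrite lcd ltnNge ltnW.
- have lt : (#|J :&: J'| < #|I :&: I'|)%N.
    by rewrite [J :&: _]setIC [I :&: _]setIC; apply: ltn_common RA0 bP.
  have := E2 _ _ _ _ lt xP aP cP ac bP.
  by rewrite lbc ltnNge ltnW.
- have := E1 _ _ _ _ xP yP aP bP; rewrite (E1 _ _ _ _ xP yP cP bP) lab.
  by rewrite ltnNge ltnW.
Qed.

Theorem const_weight_noncrossing (K : numFieldType) k m
    (I I' : {set 'I_k}) (J J' : {set 'I_m}) :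
  (0 < m)%N -> #|I| = #|J| -> #|I'| = #|J'| ->
  const_weight (K := K) I I' J J' -> ~ crossing (word I J) (word I' J').
Proof.
move=> m0 eIJ eIJ' cw; have [le|/ltnW le] := leqP #|J :&: J'| #|I :&: I'|.
  exact: const_weight_noncrossing_rows cw.
move=> /crossing_tr; apply: (@const_weight_noncrossing_rows K) => //.
exact: const_weight_tr (Ordinal m0) _ _ cw.
Qed.

(** * Minors as sums over permutations *)

Lemma pairwise_enum_ord n : pairwise (@ordlt n) (enum 'I_n).
Proof.
have := enum_ordlt [set: 'I_n].
by rewrite (@eq_enum _ [set: 'I_n] 'I_n) // => i; rewrite !inE.
Qed.

Lemma enum_val_ltn n (J : {set 'I_n}) (a b : 'I_#|J|) :
  (enum_val a < enum_val b)%N = (a < b)%N.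
Proof.
have lt (c d : 'I_#|J|) : (c < d)%N -> (enum_val c < enum_val d)%N.
  have x0 : 'I_n := enum_val c.
  move=> lcd; rewrite !(enum_val_nth x0).
  apply: (sorted_ltn_nth (@ordlt_trans n)); rewrite ?inE -?cardE //.
  by rewrite sorted_pairwise ?enum_ordlt //; apply: ordlt_trans.
case: (ltngtP a b) => [/lt->//|/lt l|/val_inj ->]; last by rewrite ltnn.
by rewrite ltnNge ltnW.
Qed.

Section Leibniz.
Context {F : fieldType} (q : F) {T : algType F} {k m : nat} (x : 'I_k -> 'I_m -> T).
Let w := - q^-1.

Fixpoint inversions (c : seq 'I_m) : nat :=
  if c is j :: c' then (count (fun i : 'I_m => i < j)%N c' + inversions c')%N else 0.

Lemma extprod_tuples l rs J : size rs = l ->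
  extprod q x rs J =
  \sum_(c : l.-tuple 'I_m | uniq c && ([set j in c] == J))
    w ^+ inversions c *: \prod_(p <- zip rs c) x p.1 p.2.
Proof.
move=> <-; elim: rs J => [|r rs IH] J /=.
  rewrite /ext1 (eq_bigl (fun c : 0.-tuple 'I_m => (c == [tuple]) && (J == set0))).
    case: (J == set0).
      under eq_bigl do rewrite andbT; rewrite big_pred1_eq /= big_nil scale1r.
      by [].
    by rewrite big_pred0 // => c; rewrite andbF.
  move=> c; rewrite (tuple0 c); have -> : [set j in [tuple]] = set0 :> {set 'I_m}.
    by apply/setP => j; rewrite !inE.
  by rewrite [set0 == J]eq_sym (eqxx ([tuple] : 0.-tuple 'I_m)).
rewrite (reindex (fun p : 'I_m * (size rs).-tuple 'I_m => cons_tuple p.1 p.2)) /=; last first.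
  exists (fun c : (size rs).+1.-tuple 'I_m => (thead c, behead_tuple c)).
    by move=> [j c] _ /=; congr (_, _); apply: val_inj.
  by move=> c _; rewrite [RHS]tuple_eta; apply: val_inj.
rewrite -(pair_big_dep predT (fun j (c : (size rs).-tuple 'I_m) =>
   (j \notin c) && uniq c && ([set j0 in j :: c] == J)) (fun j (c : (size rs).-tuple 'I_m) =>
   w ^+ (count (fun i : 'I_m => (i < j)%N) c + inversions c) *:
   (\prod_(p <- (r, j) :: zip rs c) x p.1 p.2))) /=.
rewrite [RHS](bigID (mem J)) /= [X in _ + X]big1 ?addr0; last first.
  move=> j njJ; apply: big_pred0 => c; apply: contraNF njJ => /andP[_ /eqP <-].
  by rewrite !inE eqxx.
apply: eq_bigr => j jJ; rewrite IH mulr_sumr scaler_sumr; apply: eq_big => c.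
  rewrite -andbA andbCA; case: (uniq c) => //=.
  apply/eqP/andP => [/setP e|[njc /eqP /setP e]].
    have njc : j \notin c by have := e j; rewrite !inE eqxx => ->.
    split=> //; apply/eqP/setP => i; rewrite !inE.
    by have := e i; rewrite !inE => ->; case: eqP => // ->.
  apply/setP => i; rewrite !inE -e !inE.
  by case: eqP => // ->; rewrite (negPf njc).
case/andP=> uc /eqP /setP ec.
rewrite -scalerAr scalerA -exprD big_cons; congr (_ ^+ (_ + _) *: _).
rewrite -below_self /below -size_filter.
rewrite -(card_uniqP (filter_uniq _ uc)); apply: eq_card => i.
by rewrite [LHS]inE -ec inE mem_filter andbC.
Qed.

End Leibniz.

Lemma inversions_map n m (f : 'I_n -> 'I_m) (s : seq 'I_n) :
  pairwise (@ordlt n) s -> inversions (map f s) = #|[set p : 'I_n * 'I_n |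
    [&& p.1 \in s, p.2 \in s, (p.1 < p.2)%N & (f p.2 < f p.1)%N]]|.
Proof.
elim: s => [_|a s IH] /=.
  by apply/esym/eq_card0 => p; rewrite !inE.
case/andP=> /allP as_ ps; rewrite IH //.
pose B := [set (a, b) | b in [set b in s | (f b < f a)%N]].
have -> : count (fun i : 'I_m => (i < f a)%N) (map f s) = #|B|.
  rewrite card_imset => [|b b' []] //; rewrite count_map -size_filter.
  have us : uniq s.
    apply: (sorted_uniq (@ordlt_trans n)) => [b|]; first by rewrite /ordlt ltnn.
    by rewrite sorted_pairwise //; apply: ordlt_trans.
  rewrite -(card_uniqP (filter_uniq _ us)); apply: eq_card => b.
  by rewrite inE mem_filter andbC.
rewrite -cardsUI (_ : _ :&: _ = set0) ?cards0 ?addn0; last first.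
  apply/setP => p; rewrite !inE; apply/negP => /andP[/imsetP[b _ ->] /=].
  by case/andP=> /as_; rewrite /ordlt ltnn.
apply: eq_card => -[b c]; rewrite !inE /=.
have [->|nb] := eqVneq b a.
  rewrite /=; have -> : (a \in s) = false.
    by apply/negP => /as_; rewrite /ordlt ltnn.
  rewrite orbF; apply/imsetP/and3P => [[d]|[cs lac lfca]].
    by rewrite inE => /andP[ds lfd] [->]; split=> //; [rewrite ds orbT | apply: as_].
  exists c => //; rewrite inE lfca andbT; case/orP: cs => // /eqP e.
  by rewrite e ltnn in lac.
have -> : (b, c) \in B = false by apply/imsetP => -[d _ [e _]]; rewrite e eqxx in nb.
rewrite /=; case: (boolP (b \in s)) => //= bs; case: eqP => //= ->.
rewrite [a \in s](_ : _ = false); last by apply/negP => /as_; rewrite /ordlt ltnn.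
by have := as_ _ bs; rewrite /ordlt /= => lab; rewrite ltnNge ltnW.
Qed.

Lemma qminor_minor (F : fieldType) (q : F) k m (I : {set 'I_k}) (J : {set 'I_m})
  (eIJ : #|I| = #|J|) : qminor eIJ = minor q (@qx F q k m) I J.
Proof.
rewrite /minor (extprod_tuples _ _ _ (esym (cardE I))).
pose col (s : 'S_#|I|) a := enum_val (cast_ord eIJ (s a)).
have col_inj s : injective (col s).
  by move=> a b /enum_val_inj/cast_ord_inj/perm_inj.
pose f s := [tuple col s a | a < #|I|].
have f_inj : injective f.
  move=> s s' e; apply/permP => a; have := congr1 (fun t => tnth t a) e.
  by rewrite !tnth_mktuple => /enum_val_inj/cast_ord_inj.
have fP s : uniq (f s) && ([set j in f s] == J).
  have uf : uniq (f s) by rewrite map_inj_uniq ?enum_uniq.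
  rewrite uf /= eqEcard cardsE (card_uniqP uf) size_tuple -eIJ leqnn andbT.
  by apply/subsetP => j; rewrite inE => /mapP[a _ ->]; apply: enum_valP.
have -> : \sum_(c : #|I|.-tuple 'I_m | uniq c && ([set j in c] == J))
    (- q^-1) ^+ inversions c *: \prod_(p <- zip (enum I) c) @qx F q k m p.1 p.2 =
  \sum_(c in f @: [set: 'S_#|I|])
    (- q^-1) ^+ inversions c *: \prod_(p <- zip (enum I) c) qx p.1 p.2.
  apply: eq_bigl => c; apply/idP/imsetP => [/andP[uc /eqP ec]|[s _ ->]//].
  have cJ a : tnth c a \in J by rewrite -ec inE mem_tnth.
  pose g a := cast_ord (esym eIJ) (enum_rank_in (cJ a) (tnth c a)).
  have gE a : enum_val (cast_ord eIJ (g a)) = tnth c a.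
    by rewrite /g cast_ordKV enum_rankK_in.
  have gi : injective g.
    move=> a b e; have := gE a; rewrite e gE.
    by move/tuple_uniqP: uc => ti /ti ->.
  exists (perm gi); first by rewrite inE.
  by apply: eq_from_tnth => a; rewrite tnth_mktuple /col permE gE.
rewrite big_imset /=; last by move=> s s' _ _; apply: f_inj.
rewrite /qminor; apply: eq_big => [s|s _]; first by rewrite inE.
rewrite -exprnN -exprVn invrN; congr (_ ^+ _ *: _).
  rewrite inversions_map ?pairwise_enum_ord //.
  by apply: eq_card => p; rewrite !inE !mem_enum /= enum_val_ltn.
have -> : enum I = [seq enum_val a | a <- enum 'I_#|I|].
  apply: enum_ordlt_eq => [|i].
    rewrite pairwise_map; apply: sub_pairwise (pairwise_enum_ord _) => a b.
    by rewrite /ordlt /relpre /= enum_val_ltn.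
  apply/idP/mapP => [iI|[a _ ->]]; last exact: enum_valP.
  by exists (enum_rank_in iI i); rewrite ?mem_enum // enum_rankK_in.
by rewrite zip_map big_map -deprecated_filter_index_enum big_filter.
Qed.

(** * Solid minors quasi-commute *)

Lemma quasi_commute_sym (F : fieldType) (q : F) k m (x y : qmat q k m) :
  q != 0 -> quasi_commute x y -> quasi_commute y x.
Proof.
move=> q0 [c e]; exists (- c); rewrite e scalerA -expfzDr //.
by rewrite addNr expr0z scale1r.
Qed.

Section EntryCommutation.
Context {F : fieldType} {q : F} {k m : nat}.
Hypothesis q0 : q != 0.
Local Notation Q := (qmat q k m).
Local Notation x := (@qx F q k m).

Definition before n (A : {set 'I_n}) (i : 'I_n) := [forall i' in A, (i < i')%N].
Definition after n (A : {set 'I_n}) (i : 'I_n) := [forall i' in A, (i' < i)%N].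
(** The power of [q] contributed by one coordinate of the entry when it passes
    the minor. *)
Definition side n (A : {set 'I_n}) (i : 'I_n) : int :=
  if i \in A then 0 else if before A i then 1 else -1.

Context (I : {set 'I_k}) (J : {set 'I_m}).
Hypothesis eIJ : #|I| = #|J|.

(** For an entry outside both the rows and the columns the two contributions
    cancel, as they must, since it lies below and to the left, or above and to
    the right, of all entries of the minor and commutes with each of them. *)
Lemma minor_entry i j :
  [|| i \in I, before I i | after I i] -> [|| j \in J, before J j | after J j] ->
  ~~ (before I i && before J j) -> ~~ (after I i && after J j) ->
  I != set0 ->
  minor q x I J * x i j = q ^ (side I i + side J j) *: (x i j * minor q x I J).
Proof.
have qxP : qmatrix q x := @qx_qmatrix F q k m; have qxT := qmatrix_tr qxP.
move=> iok jok nb na I0.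
rewrite /side; case: (boolP (i \in I)) iok nb na => [iI|niI] /=.
  move=> _ _ _; case: (boolP (j \in J)) jok => [jJ|njJ] /=.
    by rewrite minor_central // addr0 expr0z scale1r.
  case: (boolP (before J j)) => [/forall_inP bj _|_ /= /forall_inP aj].
    by rewrite (minor_left_col _ _ eIJ) // add0r expr1z.
  by rewrite (minor_right_col _ _ eIJ) // add0r exprN1.
case: (boolP (j \in J)) jok => [jJ _ iok _ _|njJ /= jok iok nb na].
  rewrite (minor_tr qxP eIJ).
  case: (boolP (before I i)) iok => [/forall_inP bi _|_ /= /forall_inP ai].
    by rewrite (@minor_left_col _ q _ q0 _ _ (xtr x) qxT J I (esym eIJ) j i) // addr0 expr1z.
  by rewrite (@minor_right_col _ q _ q0 _ _ (xtr x) qxT J I (esym eIJ) j i) // addr0 exprN1.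
case: (boolP (before I i)) iok nb => [/forall_inP bi _ /= nbj|_ /= ai _].
  rewrite (negPf nbj) /= in jok *.
  rewrite subrr expr0z scale1r -minor_comm // => i' j' i'I j'J.
  move/forall_inP: jok => /(_ _ j'J) ?.
  by rewrite (qm_comm qxP (bi _ i'I)).
rewrite ai /= in na; rewrite (negPf na) orbF in jok; rewrite jok.
rewrite addNr expr0z scale1r -minor_comm // => i' j' i'I j'J.
move/forall_inP: ai => /(_ _ i'I) ?; move/forall_inP: jok => /(_ _ j'J) ?.
exact: (qm_comm qxP).
Qed.

Lemma minors_quasi_commute (I' : {set 'I_k}) (J' : {set 'I_m}) : I != set0 ->
  (forall i j, i \in I' -> j \in J' ->
     [/\ [|| i \in I, before I i | after I i], [|| j \in J, before J j | after J j],
      ~~ (before I i && before J j) & ~~ (after I i && after J j)]) ->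
  quasi_commute (minor q x I' J') (minor q x I J).
Proof.
move=> I0 ok.
have pow (X : Type) (r : seq X) P (s : X -> int) :
    exists c, \prod_(i <- r | P i) q ^ s i = q ^ c.
  elim/big_ind: _ => [|_ _ [c ->] [d ->]|i _]; first by exists 0.
    by exists (c + d); rewrite expfzDr.
  by exists (s i).
have [c ec] := pow _ (enum I') xpredT (side I).
have [d ed] := pow _ (index_enum 'I_m) (mem J') (side J).
exists (c + d); rewrite expfzDr // -ec -ed; apply: extprod_qcomm => i j.
rewrite mem_enum => iI' jJ'; have [? ? ? ?] := ok i j iI' jJ'.
by rewrite minor_entry // expfzDr.
Qed.

End EntryCommutation.

Section SolidMinors.
Context {k m : nat}.
Implicit Types p : 'I_k * 'I_m.

Definition interval n a r : {set 'I_n} := [set i : 'I_n | (a <= i < a + r)%N].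

Lemma card_interval n a r : (a + r <= n)%N -> #|interval n a r| = r.
Proof.
move=> le.
have -> : interval n a r =
    [set i : 'I_n | (a <= i)%N] :\: [set i : 'I_n | (a + r <= i)%N].
  by apply/setP => i; rewrite !inE -ltnNge andbC.
rewrite cardsDS; first by rewrite !card_suffix; lia.
by apply/subsetP => i; rewrite !inE; lia.
Qed.

Lemma interval_before n a r (i : 'I_n) : (0 < r)%N -> (a + r <= n)%N ->
  before (interval n a r) i = (i < a)%N.
Proof.
move=> r0 le; apply/forall_inP/idP => [H|lt i']; last by rewrite inE; lia.
have an : (a < n)%N by lia.
by have := H (Ordinal an); apply; rewrite inE /=; lia.
Qed.

Lemma interval_after n a r (i : 'I_n) : (0 < r)%N -> (a + r <= n)%N ->
  after (interval n a r) i = (a + r <= i)%N.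
Proof.
move=> r0 le; apply/forall_inP/idP => [H|lt i']; last by rewrite inE; lia.
have an : ((a + r).-1 < n)%N by lia.
have := H (Ordinal an); rewrite inE /= => /(_ _) h.
by have := h ltac:(lia); lia.
Qed.

(** The square with upper left corner [p] is extended until it meets the last
    row or the last column. *)
Definition solid_size p := minn (k - p.1) (m - p.2).
Definition solid_rows p := interval k p.1 (solid_size p).
Definition solid_cols p := interval m p.2 (solid_size p).

Lemma solid_bounds p : [/\ (0 < solid_size p)%N, (p.1 + solid_size p <= k)%N,
  (p.2 + solid_size p <= m)%N &
  (p.1 + solid_size p == k)%N || (p.2 + solid_size p == m)%N].
Proof.
case: p => a b; rewrite /solid_size /=.
by have := ltn_ord a; have := ltn_ord b; split; lia.
Qed.

Lemma solid_card p : #|solid_rows p| = #|solid_cols p|.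
Proof. by have [_ h1 h2 _] := solid_bounds p; rewrite !card_interval. Qed.

Lemma solid_rows_neq0 p : solid_rows p != set0.
Proof. by have [h0 h1 h2 _] := solid_bounds p; rewrite -cards_eq0 card_interval // -lt0n. Qed.

Lemma solid_inj p p' : solid_rows p = solid_rows p' -> solid_cols p = solid_cols p' ->
  p = p'.
Proof.
case: p p' => a b [a' b'] /setP e1 /setP e2.
have [h0 h1 h2 _] := solid_bounds (a, b); have [h0' h1' h2' _] := solid_bounds (a', b').
have := e1 a; have := e1 a'; have := e2 b; have := e2 b'; rewrite !inE /= in h0 h0' *.
move=> *; congr (_, _); apply: val_inj => /=; lia.
Qed.

(** As both squares reach the last row or column, neither has an entry strictly
    below and to the right of the other.  So it is enough to choose the order
    in which the first one does not start strictly above and to the left of the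
    second. *)
Lemma solid_quasi_commute (F : fieldType) (q : F) p p' : q != 0 ->
  quasi_commute (minor q (@qx F q k m) (solid_rows p) (solid_cols p))
                (minor q (@qx F q k m) (solid_rows p') (solid_cols p')).
Proof.
move=> q0.
wlog np : p p' / ~~ ((p.1 < p'.1) && (p.2 < p'.2))%N => [H|].
  have [/H//|np'] := boolP (~~ ((p.1 < p'.1) && (p.2 < p'.2))%N).
  by apply: quasi_commute_sym => //; apply: H; lia.
apply: minors_quasi_commute => //; [exact: solid_card|exact: solid_rows_neq0|].
have [h0 h1 h2 h3] := solid_bounds p; have [h0' h1' h2' h3'] := solid_bounds p'.
move=> i j; rewrite !(interval_before, interval_after) // !inE => ip jp.
by split; lia.
Qed.
End SolidMinors.

(** * Distinct minors *)

Section Distinct.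
Context {K F : fieldType} {q : F} (sp : specialization K q) {k m : nat}.

(** If, say, the second minor has a row or column that the first one lacks, then
    it vanishes at a 0/1 matrix that matches the rows and columns of the
    first one. *)
Lemma qminor_inj (I I' : {set 'I_k}) (J J' : {set 'I_m})
    (eIJ : #|I| = #|J|) (eIJ' : #|I'| = #|J'|) : I != set0 -> I' != set0 ->
  qminor (q := q) eIJ = qminor eIJ' -> I = I' /\ J = J'.
Proof.
wlog nsub : I I' J J' eIJ eIJ' / ~~ ((I' \subset I) && (J' \subset J)) => [H|].
  move=> I0 I0' e.
  have [/H h|] := boolP (~~ ((I' \subset I) && (J' \subset J))); first exact: h e.
  rewrite negbK => /andP[sI sJ].
  have [/H h|] := boolP (~~ ((I \subset I') && (J \subset J'))).
    by have [] := h eIJ' eIJ I0' I0 (esym e).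
  by rewrite negbK => /andP[sI' sJ']; split; apply/eqP; rewrite eqEsubset ?sI ?sI' ?sJ ?sJ'.
move=> I0 I0' e; exfalso.
have [d _] : exists d, d \in J by apply/set0Pn; rewrite -cards_eq0 -eIJ cards_eq0.
have [M [bM _]] : exists M, bij_between I J M /\ map M [::] = [::].
  by apply: exists_bij.
pose P : 'M[K]_(k, m) := \matrix_(i, j) ((i \in I) && (j == M i))%:R.
have mM : matches P I J M.
  split=> [i|i i' iI i'I]; first exact: bij_between_in.
  by rewrite mxE iI /= (inj_in_eq bM.1) // eq_sym.
have [R [x [f rP]]] := all_realizable sp P.
have [p pM] := matches_perm eIJ mM.
have vX := opval_minor rP mM pM.
have v0 : opval sp f (qmat_eval x (qminor (q := q) eIJ)) 0.
  rewrite e qmat_eval_qminor; last by case: rP.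
  have -> : (0 : K) = \sum_(s : 'S_#|I'|) minor_sign s *
      \prod_a P (enum_val a) (enum_val (cast_ord eIJ' (s a))).
    rewrite big1 // => s _; suff [a Pa] : exists a : 'I_#|I'|,
        P (enum_val a) (enum_val (cast_ord eIJ' (s a))) = 0.
      by rewrite (bigD1 a) //= Pa mul0r mulr0.
    move: nsub; rewrite negb_and => /orP[] /subsetPn[i iA niB].
      exists (enum_rank_in iA i); rewrite enum_rankK_in // mxE (negPf niB).
      by [].
    pose b := enum_rank_in iA i; pose a := (s^-1)%g (cast_ord (esym eIJ') b).
    exists a; rewrite /a permKV cast_ordKV enum_rankK_in // mxE.
    case: (boolP (enum_val _ \in I)) => //= aI; case: eqP => // ei.
    by rewrite ei (bij_between_in bM aI) in niB.
  apply: (opval_sum rP) => s.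
  apply: (opvalZ rP); first exact: residue_sign.
  by apply: opval_prod => a; apply: opval_gen rP _ _.
have := opval_uniq rP vX v0; apply/eqP; exact: minor_sign_neq0.
Qed.

End Distinct.

(** * Rational functions regular at one *)

Section RationalFunctions.
Context (K : fieldType).
Local Notation F := {fraction {poly K}}.
Local Notation frac := (@tofrac {poly K}).

Definition regular_at1 (z : F) := exists a b : {poly K}, b.[1] != 0 /\ z = frac a / frac b.

Lemma frac_neq0 (b : {poly K}) : b.[1] != 0 -> frac b != 0.
Proof. by rewrite tofrac_eq0; apply: contraNneq => ->; rewrite horner0. Qed.

Lemma regular_frac (a : {poly K}) : regular_at1 (frac a).
Proof. by exists a, 1; rewrite hornerC oner_neq0 rmorph1 divr1. Qed.

Lemma regular_add y z : regular_at1 y -> regular_at1 z -> regular_at1 (y + z).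
Proof.
move=> [a [b [b1 ->]]] [a' [b' [b1' ->]]]; exists (a * b' + a' * b), (b * b').
split; first by rewrite hornerM mulf_neq0.
by rewrite rmorphD !rmorphM /= addf_div // frac_neq0.
Qed.

Lemma regular_mul y z : regular_at1 y -> regular_at1 z -> regular_at1 (y * z).
Proof.
move=> [a [b [b1 ->]]] [a' [b' [b1' ->]]]; exists (a * a'), (b * b').
split; first by rewrite hornerM mulf_neq0.
by rewrite !rmorphM /= mulf_div.
Qed.

Lemma regular_varV : regular_at1 (frac 'X)^-1.
Proof. by exists 1, 'X; rewrite hornerX oner_neq0 rmorph1 mul1r. Qed.

Lemma regular_proper (c : K) z : regular_at1 z ->
  frac c%:P = (frac 'X - 1) * z -> c = 0.
Proof.
move=> [a [b [b1 ->]]]; rewrite mulrA => e.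
have : c%:P * b = ('X - 1) * a.
  apply/eqP; rewrite -tofrac_eq; apply/eqP.
  by rewrite !rmorphM rmorphB rmorph1 /= e mulfVK // frac_neq0.
move=> /(congr1 (horner^~ 1)); rewrite !hornerM hornerC hornerD hornerN hornerX hornerC.
by rewrite subrr mul0r => /eqP; rewrite mulf_eq0 (negPf b1) orbF => /eqP.
Qed.

Definition specialization_at1 : specialization K (frac 'X).
Proof.
apply: (@Specialization K F (frac 'X) (GRing.RMorphism.clone K F (frac \o polyC) _)
  regular_at1).
- exact: regular_add.
- exact: regular_mul.
- by move=> c; apply: regular_frac.
- exact: regular_frac.
- exact: regular_varV.
- by move=> c a ra; apply: regular_proper.
- by rewrite tofrac_eq0 polyX_eq0.
- rewrite -(rmorph1 frac) tofrac_eq.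
  by apply/eqP => /(congr1 (fun p : {poly K} => size p)); rewrite size_polyX size_poly1.
Defined.
End RationalFunctions.

(** * The bound and the extremal collection *)

Section Bound.
Context {K : numFieldType} {F : fieldType} {q : F} (sp : specialization K q) {k m : nat}.
Hypothesis m0 : (0 < m)%N.

Lemma qminor_irrelevant (I I' : {set 'I_k}) (J J' : {set 'I_m}) (eIJ : #|I| = #|J|)
    (eIJ' : #|I'| = #|J'|) :
  I = I' -> J = J' -> qminor (q := q) eIJ = qminor eIJ'.
Proof. by move=> e e'; subst I' J'; congr qminor; apply: eq_irrelevance. Qed.

(** The word of the empty minor is added to the words of the collection; it
    accounts for the [1] in [card_noncrossing]. *)
Lemma card_qc_collection (S : {fset (qmat q k m)}) :
  qc_collection S -> (#|` S|%fset <= k * m)%N.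
Proof.
case=> qS qcS.
pose is_word x A := x \in S -> exists (I : {set 'I_k}) (J : {set 'I_m}) (eIJ : #|I| = #|J|),
  [/\ I != set0, x = qminor eIJ & A = word I J].
have /boolp.choice[f fP] : forall x, exists A, is_word x A.
  move=> x; have [xS|nxS] := boolP (x \in S); last first.
    by exists set0; rewrite /is_word (negPf nxS).
  have [I [J [eIJ [I0 e]]]] := qS x xS.
  by exists (word I J) => _; exists I, J, eIJ.
pose C := [set f (val x) | x : S].
have wC : word (set0 : {set 'I_k}) (set0 : {set 'I_m}) \notin C.
  apply/imsetP => -[[x xS] _ /= e]; have [I [J [eIJ [I0 _ ew]]]] := fP x xS.
  by move: I0; rewrite (word_inj (etrans e ew)).1 eqxx.
have cC : #|C| = #|` S|%fset.
  rewrite card_imset ?cardfE // => -[x xS] [y yS] /= e; apply: val_inj => /=.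
  have [I [J [eIJ [_ xE ex]]]] := fP x xS; have [I' [J' [eIJ' [_ yE ey]]]] := fP y yS.
  have [eI eJ] := word_inj (etrans (esym ex) (etrans e ey)).
  by rewrite xE yE; apply: qminor_irrelevant.
rewrite -ltnS -cC; apply: leq_trans (@card_noncrossing _ k m (word set0 set0 |: C) erefl _ _).
- by rewrite cardsU1 wC.
- move=> A /setU1P[->|/imsetP[[x xS] _ ->] /=]; first by rewrite card_word ?cards0.
  by have [I [J [eIJ [_ _ ->]]]] := fP x xS; rewrite card_word.
- have e0 : #|@set0 'I_k| = #|@set0 'I_m| by rewrite !cards0.
  move=> A B /setU1P[->|/imsetP[[x xS] _ ->]] /setU1P[->|/imsetP[[y yS] _ ->]] /=.
  + by have [] := @word_set0 k m set0 set0 e0.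
  + by have [I [J [eIJ [_ _ ->]]]] := fP y yS; have [] := word_set0 eIJ.
  + by have [I [J [eIJ [_ _ ->]]]] := fP x xS; have [] := word_set0 eIJ.
  have [I [J [eIJ [_ ex ->]]]] := fP x xS; have [I' [J' [eIJ' [_ ey ->]]]] := fP y yS.
  apply: (@const_weight_noncrossing K) => //.
  by apply: (quasi_commute_weight sp (eIJ := eIJ) (eIJ' := eIJ')); rewrite -ex -ey; apply: qcS.
Qed.

Definition solid_minor (p : 'I_k * 'I_m) : qmat q k m := qminor (solid_card p).

Lemma solid_minor_inj : injective solid_minor.
Proof.
move=> p p' /(qminor_inj sp) []; try exact: solid_rows_neq0.
exact: solid_inj.
Qed.

Lemma exists_maximal_qc_collection :
  exists S : {fset (qmat q k m)}, maximal_qc_collection S /\ #|` S|%fset = (k * m)%N.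
Proof.
pose S := [fset solid_minor p | p : 'I_k * 'I_m]%fset.
have cS : #|` S|%fset = (k * m)%N.
  by rewrite card_imfset /=; [rewrite -cardE card_prod !card_ord | exact: solid_minor_inj].
have qS : qc_collection S.
  split=> [x /imfsetP[p _ ->]|x y /imfsetP[p _ ->] /imfsetP[p' _ ->]].
    by exists (solid_rows p), (solid_cols p), (solid_card p); split; first exact: solid_rows_neq0.
  rewrite /solid_minor !qminor_minor; apply: solid_quasi_commute.
  exact: (spec_q0 sp).
exists S; split=> //; split=> // T qT sST; apply/eqP; rewrite eq_sym eqEfcard sST /=.
by rewrite cS; apply: card_qc_collection.
Qed.
End Bound.

Theorem proposition1 (R : realType) (k m : nat) (hk : (1 <= k)%N)
    (hkm : (k <= m)%N) :
  (forall S : {fset (qmat (@qvar R) k m)},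
     maximal_qc_collection S -> (#|` S|%fset <= k * m)%N) /\
  (exists S : {fset (qmat (@qvar R) k m)},
     maximal_qc_collection S /\ #|` S|%fset = (k * m)%N).
Proof.
have m0 := leq_trans hk hkm; have sp := specialization_at1 (complex R).
split=> [S [qS _]|]; first exact: (@card_qc_collection (complex R) _ _ sp).
exact: (@exists_maximal_qc_collection (complex R) _ _ sp).
Qed.
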